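(* Let $G=(V,E)$ be a connected, infinite, locally finite, vertex-transitive graph. Let $G_n=(V_n,E_n)$ be a sequence of finite connected subgraphs of $G$ such that $|V_n|\to\infty$ and, for every $r>0$, $|\{v\in V_n : S(v,r)\not\subset G_n\}|=o(|V_n|)$. Assign i.i.d. nonnegative weights to the edges of $G$ with a non-degenerate distribution $\mu$ having finite $(4+\delta)$-th moment for some $\delta>0$, and let $M_n$ be the total weight of a minimal spanning tree of $G_n$ (with the inherited weights). Then (i) $\mathrm{Var}(M_n)=\Theta(|V_n|)$, and (ii) $(M_n-\mathbb{E}(M_n))/\sqrt{\mathrm{Var}(M_n)}$ converges in distribution to the standard normal $N(0,1)$.
   Context: For a vertex $v\in V$ and $r>0$, $S(v,r)$ denotes the subgraph of $G$ spanned by all vertices $v'\in V$ with $d_G(v',v)\le r$, where $d_G$ is the graph distance in $G$. A minimal spanning tree of a finite connected edge-weighted graph is a spanning tree minimizing the sum of its edge weights. *)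

(* Defs.v *)
From HB Require Import structures.
From mathcomp Require Import all_boot all_order all_algebra finmap.
From mathcomp Require Import all_classical all_reals all_analysis.
Set Implicit Arguments. Unset Strict Implicit. Unset Printing Implicit Defensive.
Import Order.TTheory GRing.Theory Num.Theory numFieldNormedType.Exports.
Local Open Scope classical_set_scope.
Local Open Scope ring_scope.
Local Open Scope fset_scope.

Definition is_edge {V : choiceType} (adj : rel V) (e : {fset V}) : Prop :=
  exists u v, adj u v /\ e = [fset u; v].

Definition simple_graph {V : choiceType} (adj : rel V) : Prop :=
  symmetric adj /\ irreflexive adj.

Definition walk {V : choiceType} (adj : rel V) (u v : V) (k : nat) : Prop :=
  exists s : seq V, size s = k /\ path adj u s /\ last u s = v.

Definition connected_graph {V : choiceType} (adj : rel V) : Prop :=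
  forall u v, exists k, walk adj u v k.

Definition locally_finite {V : choiceType} (adj : rel V) : Prop :=
  forall v, finite_set [set u | adj v u].

Definition infinite_graph (V : choiceType) : Prop := ~ finite_set [set: V].

Definition automorphism {V : choiceType} (adj : rel V) (f : V -> V) : Prop :=
  bijective f /\ forall x y, adj (f x) (f y) = adj x y.

Definition vertex_transitive {V : choiceType} (adj : rel V) : Prop :=
  forall u v, exists f, automorphism adj f /\ f u = v.

Definition in_ball {V : choiceType} {R : realType} (adj : rel V) (v : V) (r : R)
  (u : V) : Prop := exists k : nat, walk adj v u k /\ (k%:R <= r).

Definition fadj {V : choiceType} (Es : {fset {fset V}}) : rel V :=
  fun x y => [fset x; y] \in Es.

Definition subgraph_of {V : choiceType} (adj : rel V) (Vs : {fset V})
  (Es : {fset {fset V}}) : Prop :=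
  forall e, e \in Es -> is_edge adj e /\ e `<=` Vs.

Definition fconnected {V : choiceType} (Vs : {fset V}) (Es : {fset {fset V}}) :
  Prop :=
  forall u v, u \in Vs -> v \in Vs ->
    exists s : seq V, path (fadj Es) u s /\ last u s = v /\ all (mem Vs) s.

(* S(v,r), the subgraph of G spanned (induced) by the vertices at distance
   <= r from v, is contained in (Vs, Es) *)
Definition ball_in {V : choiceType} {R : realType} (adj : rel V) (v : V) (r : R)
  (Vs : {fset V}) (Es : {fset {fset V}}) : Prop :=
  (forall u, in_ball adj v r u -> u \in Vs) /\
  (forall x y, in_ball adj v r x -> in_ball adj v r y -> adj x y ->
     [fset x; y] \in Es).

Definition has_cycle {V : choiceType} (T : {fset {fset V}}) : Prop :=
  exists s : seq V, (3 <= size s)%N /\ uniq s /\ cycle (fadj T) s.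

Definition spanning_tree {V : choiceType} (Vs : {fset V})
  (Es T : {fset {fset V}}) : Prop :=
  T `<=` Es /\ fconnected Vs T /\ ~ has_cycle T.

Definition mst_weight {V : choiceType} {R : realType} (w : {fset V} -> R)
  (Vs : {fset V}) (Es : {fset {fset V}}) : R :=
  inf [set x : R | exists T, spanning_tree Vs Es T /\ x = \sum_(e <- T) w e].

Definition mutually_independent {d} {T : measurableType d} {R : realType}
  {I : eqType} (P : probability T R) (J : I -> Prop) (X : I -> T -> R) : Prop :=
  forall (s : seq I) (B : I -> set R),
    (forall i, i \in s -> J i) -> uniq s ->
    (forall i, measurable (B i)) ->
    P (\bigcap_(i in [set i | i \in s]) (X i @^-1` B i)) =
    (\prod_(i <- s) P (X i @^-1` B i))%E.

(* Main.v *)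
Require Import Defs.
From HB Require Import structures.
From mathcomp Require Import all_boot all_order all_algebra finmap.
From mathcomp Require Import all_classical all_reals all_analysis.
From mathcomp Require Import measurable_realfun.
From mathcomp Require Import ring lra.
Import Order.TTheory GRing.Theory Num.Theory numFieldNormedType.Exports.
Set Implicit Arguments.
Unset Strict Implicit.
Unset Printing Implicit Defensive.
Local Open Scope ring_scope.

(** For an edge e = uv of a connected graph H, raising w_e from 0 to its value
    raises the weight of the minimal spanning tree by min(w_e, m_e), where m_e
    is the minimax weight of a path from u to v in H - e.  This increment is
    nonincreasing in H, so on the vertices whose r-ball lies in G_n it is
    squeezed between its value on G_n and its value on the r-ball; a
    nonincreasing sequence of second moments being Cauchy, and by vertex
    transitivity uniformly so, the r-ball version is L^2-close to the true
    increment for large r.  The martingale differences of M_n along an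
    enumeration of the edges depend only on these increments; replacing each
    increment by its truncated r-ball version gives a sum of bounded, centered,
    locally dependent variables, and orthogonality turns the edgewise L^2 bounds
    into an error of order eps |V_n| for the whole sum.  Stein's method for
    locally dependent sums gives the normal limit.  The variance lower bound
    comes from the one-coordinate projections: when all other edges at an
    endpoint of e are heavy, moving w_e from a light to a heavy value moves M_n
    by a fixed amount.

    All of this takes place on finite product spaces: the weights are rounded to
    finitely many values, at a precision depending on n, which moves M_n by an
    L^2-negligible amount, and the rounding commutes with minimax up to a
    controlled error. *)

(** * Finite product spaces and martingale differences *)

(** The Cauchy argument gives no rate: for each tolerance it only yields one radius valid for all
    edges. It works because 0 <= H <= D implies (D - H)^2 <= D^2 - H^2, so the L^2 distance between
    the true increment H and the r-ball increment D is bounded by a difference of two second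
    moments, and automorphisms reduce these to the finitely many edges at one vertex. The order of
    the choices shapes the proof. Tolerance, radius and truncation level are fixed before n; the
    rounding precision comes after n, because the Lipschitz bound on the mean square rounding error
    is quadratic in the number of edges. Hence the second moments on balls must be stable uniformly
    in the precision. Fourth moments enter twice: rounding with mesh 1/K and cut-off K costs up to
    (1 + x^2)/K pointwise, and truncating an increment at level K costs at most a fourth moment
    divided by K^2 in mean square. Martingale differences stay local: on a product space,
    conditioning a function of the coordinates in T on those in S leaves a function of the
    coordinates common to S and T. *)

Section FiniteProduct.
Import mathcomp.boot.fintype mathcomp.boot.finset.
Variables (R : realFieldType) (I A : finType) (p : A -> R).
Hypothesis p_ge0 : forall a, 0 <= p a.
Hypothesis p_sum1 : \sum_a p a = 1.

Local Notation cfg := {ffun I -> A}.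
Implicit Types (F G : cfg -> R) (S T : {set I}) (x y z : cfg).

Definition pr x : R := \prod_i p (x i).
Definition fE F : R := \sum_x pr x * F x.
Definition mix S x y : cfg := [ffun i => if i \in S then x i else y i].
(** Conditional expectation given the coordinates in [S], realised as a genuine function: the
    coordinates outside [S] are resampled from an independent copy. Its laws then hold pointwise
    rather than almost surely. *)
Definition cE S F x : R := fE (fun y => F (mix S x y)).
Definition depends S F := forall x y, (forall i, i \in S -> x i = y i) -> F x = F y.

Lemma pr_ge0 x : 0 <= pr x.
Proof. by apply: prodr_ge0. Qed.

Lemma pr_sum1 : \sum_x pr x = 1.
Proof.
rewrite /pr -(bigA_distr_bigA (fun (_ : I) a => p a)) /=.
by rewrite big1.
Qed.

Lemma eq_fE F G : F =1 G -> fE F = fE G.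
Proof. by move=> FG; apply: eq_bigr => x _; rewrite FG. Qed.

Lemma fE_cst c : fE (fun=> c) = c.
Proof. by rewrite /fE -mulr_suml pr_sum1 mul1r. Qed.

Lemma fED F G : fE (fun x => F x + G x) = fE F + fE G.
Proof. by rewrite /fE -big_split; apply: eq_bigr => x _; rewrite mulrDr. Qed.

Lemma fEZ c F : fE (fun x => c * F x) = c * fE F.
Proof. by rewrite /fE mulr_sumr; apply: eq_bigr => x _; rewrite mulrCA. Qed.

Lemma fEN F : fE (fun x => - F x) = - fE F.
Proof. by rewrite -mulN1r -fEZ; apply: eq_fE => x; rewrite mulN1r. Qed.

Lemma fEB F G : fE (fun x => F x - G x) = fE F - fE G.
Proof. by rewrite fED fEN. Qed.

Lemma fE_sum (J : Type) (s : seq J) (Q : pred J) (F : J -> cfg -> R) :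
  fE (fun x => \sum_(j <- s | Q j) F j x) = \sum_(j <- s | Q j) fE (F j).
Proof.
rewrite /fE exchange_big; apply: eq_bigr => x _.
by rewrite mulr_sumr.
Qed.

Lemma fE_ge0 F : (forall x, 0 <= F x) -> 0 <= fE F.
Proof. by move=> F0; apply: sumr_ge0 => x _; rewrite mulr_ge0 ?pr_ge0. Qed.

Lemma le_fE F G : (forall x, F x <= G x) -> fE F <= fE G.
Proof. by move=> FG; apply: ler_sum => x _; rewrite ler_wpM2l ?pr_ge0. Qed.

Lemma norm_fE F : `|fE F| <= fE (fun x => `|F x|).
Proof.
apply: le_trans (ler_norm_sum _ _ _) _; apply: ler_sum => x _.
by rewrite normrM (ger0_norm (pr_ge0 x)).
Qed.

Lemma sqr_fE F : fE F ^+ 2 <= fE (fun x => F x ^+ 2).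
Proof.
have : 0 <= fE (fun x => (F x - fE F) ^+ 2) by apply: fE_ge0 => x; exact: sqr_ge0.
have -> : fE (fun x => (F x - fE F) ^+ 2) = fE (fun x => F x ^+ 2) - fE F ^+ 2.
  rewrite (eq_fE (G := fun x => (F x ^+ 2 - (2 * fE F) * F x) + fE F ^+ 2)).
    by rewrite fED fEB fEZ fE_cst; ring.
  by move=> x; ring.
by rewrite subr_ge0.
Qed.

Lemma swap_pr S x y : pr (mix S x y) * pr (mix S y x) = pr x * pr y.
Proof.
rewrite /pr -!big_split; apply: eq_bigr => i _ /=.
by rewrite !ffunE; case: ifP => // _; rewrite mulrC.
Qed.

(** Exchanging the coordinates outside [S] between two independent configurations is an involution
    that preserves their joint weight ([swap_pr]), so a mixture of the two has the law of either. *)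
Lemma fE2_mix S (H : cfg -> R) :
  fE (fun x => fE (fun y => H (mix S x y))) = fE H.
Proof.
transitivity (\sum_(u : cfg * cfg) (pr u.1 * pr u.2) * H (mix S u.1 u.2)).
  rewrite /fE (eq_bigr (fun x => \sum_y (pr x * pr y) * H (mix S x y))).
    by rewrite pair_bigA.
  by move=> x _; rewrite mulr_sumr; apply: eq_bigr => y _; rewrite mulrA.
pose g (u : cfg * cfg) := (mix S u.1 u.2, mix S u.2 u.1).
have gK : involutive g.
  by move=> [x y]; rewrite /g /=; congr (_, _); apply/ffunP => i; rewrite !ffunE; case: (i \in S).
rewrite (reindex g) /=; last by apply: onW_bij; exact: inv_bij.
rewrite (eq_bigr (fun u => (pr u.1 * pr u.2) * H u.1)); last first.
  move=> [x y] _ /=; rewrite swap_pr; congr (_ * H _).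
  by apply/ffunP => i; rewrite !ffunE; case: (i \in S).
rewrite -(pair_bigA _ (fun x y => (pr x * pr y) * H x)) /=.
apply: eq_bigr => x _.
rewrite -mulr_suml -mulr_sumr pr_sum1 mulr1 //.
Qed.

Lemma fE_cE S F : fE (cE S F) = fE F.
Proof. exact: fE2_mix. Qed.

Lemma cEB S F G x : cE S (fun x => F x - G x) x = cE S F x - cE S G x.
Proof. by rewrite /cE fEB. Qed.

Lemma cE_depends S T F : depends T F -> depends (S :&: T) (cE S F).
Proof.
move=> dF x y xy; apply: eq_fE => z; apply: dF => i iT; rewrite !ffunE.
by case: ifP => // iS; apply: xy; rewrite inE iS.
Qed.

Lemma dependsS S T F : S \subset T -> depends S F -> depends T F.
Proof. by move=> /subsetP ST dF x y xy; apply: dF => i /ST; exact: xy. Qed.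

Lemma dependsT F : depends [set: I] F.
Proof. by move=> x y xy; congr F; apply/ffunP => i; apply: xy. Qed.

Lemma cE_pull S F G x : depends S G -> cE S (fun x => G x * F x) x = G x * cE S F x.
Proof.
move=> dG; rewrite /cE -fEZ; apply: eq_fE => y; congr (_ * _).
by apply: dG => i iS; rewrite ffunE iS.
Qed.

(** Tower property for arbitrary, not only nested, sets of coordinates. The two successive
    resamplings amount to a single one by [mix T y z], which again has the product law. *)
Lemma cE_cE S T F : cE S (cE T F) =1 cE (S :&: T) F.
Proof.
move=> x; rewrite /cE -(fE2_mix T (fun y => F (mix (S :&: T) x y))).
apply: eq_fE => y; apply: eq_fE => z; congr F; apply/ffunP => i.
by rewrite !ffunE inE; do 2 case: (i \in _).
Qed.

Lemma cE_disjoint S T F x : depends T F -> [disjoint S & T] -> cE S F x = fE F.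
Proof.
move=> dF /pred0P ST; apply: eq_fE => y; apply: dF => i iT.
by rewrite ffunE; have := ST i; rewrite /= iT andbT => ->.
Qed.

Lemma fE_indep S T F G : depends S F -> depends T G -> [disjoint S & T] ->
  fE (fun x => F x * G x) = fE F * fE G.
Proof.
move=> dF dG ST; rewrite -(fE_cE S).
rewrite (eq_fE (G := fun x => fE G * F x)); first by rewrite fEZ mulrC.
by move=> x; rewrite cE_pull // (cE_disjoint _ dG ST) mulrC.
Qed.

Lemma sqr_cE S F : fE (fun x => cE S F x ^+ 2) <= fE (fun x => F x ^+ 2).
Proof.
rewrite -[leRHS](fE_cE S); apply: le_fE => x; exact: sqr_fE.
Qed.

Lemma norm_cE S F K x : (forall x, `|F x| <= K) -> `|cE S F x| <= K.
Proof.
move=> FK; apply: le_trans (norm_fE _) _; rewrite -[leRHS]fE_cst.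
exact: le_fE.
Qed.

Lemma fE_cauchy F : fE (fun x => `|F x|) ^+ 2 <= fE (fun x => F x ^+ 2).
Proof.
apply: le_trans (sqr_fE _) _; apply: le_fE => x; rewrite real_normK //.
exact: num_real.
Qed.

Definition sle (i : I) : {set I} := [set j | (enum_rank j <= enum_rank i)%N].
Definition slt (i : I) : {set I} := [set j | (enum_rank j < enum_rank i)%N].
Definition mdiff (i : I) F x : R := cE (sle i) F x - cE (slt i) F x.

Lemma mdiff_sum F x : \sum_i mdiff i F x = F x - fE F.
Proof.
pose c (k : nat) := cE [set j | (enum_rank j < k)%N] F x.
have -> : \sum_i mdiff i F x = \sum_(k < #|I|) (c k.+1 - c k).
  rewrite (reindex (@enum_val I I)) /=; last first.
    by apply: onW_bij; exact: enum_val_bij.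
  apply: eq_bigr => k _; rewrite /mdiff /c /sle /slt enum_valK.
  by congr (cE _ F x - _); apply/setP => j; rewrite !inE ltnS.
rewrite -(big_mkord xpredT (fun k => c k.+1 - c k)) telescope_sumr //.
congr (_ - _).
  rewrite /c /cE -[RHS](fE_cst (F x)); apply: eq_fE => y; congr F.
  by apply/ffunP => i; rewrite ffunE inE ltn_ord.
rewrite /c /cE; apply: eq_fE => y; congr F.
by apply/ffunP => i; rewrite ffunE inE.
Qed.

Lemma mdiffB i F G x : mdiff i (fun x => F x - G x) x = mdiff i F x - mdiff i G x.
Proof. by rewrite /mdiff !cEB; ring. Qed.

Lemma mdiff_indep0 i F x : depends (~: [set i]) F -> mdiff i F x = 0.
Proof.
move=> dF; apply/eqP; rewrite subr_eq0; apply/eqP; apply: eq_fE => y; apply: dF.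
move=> j; rewrite !inE !ffunE !inE => ji; rewrite ltn_neqAle.
suff -> : (nat_of_ord (enum_rank j) != enum_rank i) by [].
by apply: contra ji => /eqP/val_inj/enum_rank_inj ->.
Qed.

(** This is what allows a function to be replaced, inside its [i]-th martingale difference, by its
    increment in the coordinate [i]. *)
Lemma mdiff_indep i F G x : depends (~: [set i]) (fun x => F x - G x) ->
  mdiff i F x = mdiff i G x.
Proof. by move=> /mdiff_indep0 => /(_ x); rewrite mdiffB => /eqP; rewrite subr_eq0 => /eqP. Qed.

Lemma mdiff_depends i S F : depends S F -> depends S (mdiff i F).
Proof.
move=> dF x y xy; rewrite /mdiff.
have h T : cE T F x = cE T F y.
  by apply: (dependsS (subsetIr T S) (cE_depends (S := T) dF)).
by rewrite !h.
Qed.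

Lemma mdiff_depends_sle i F : depends (sle i) (mdiff i F).
Proof.
move=> x y xy; rewrite /mdiff; congr (_ - _).
  apply: (dependsS _ (cE_depends (S := sle i) (@dependsT F))) xy.
  by rewrite subsetIl.
apply: (dependsS _ (cE_depends (S := slt i) (@dependsT F))) xy.
by apply: subset_trans (subsetIl _ _) _; apply/subsetP => j; rewrite !inE; exact: ltnW.
Qed.

Lemma slt_sle i : slt i \subset sle i.
Proof. by apply/subsetP => j; rewrite !inE; exact: ltnW. Qed.

Lemma fE_mdiff i F : fE (mdiff i F) = 0.
Proof. by rewrite /mdiff fEB !fE_cE subrr. Qed.

Lemma cE_mdiff0 i S F x : S \subset slt i -> cE S (mdiff i F) x = 0.
Proof.
move=> Si; rewrite cEB !cE_cE.
rewrite (finset.setIidPl Si) (finset.setIidPl (subset_trans Si (slt_sle i))).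
by rewrite subrr.
Qed.

(** For [i] before [j], conditioning on [sle i] freezes the first factor and kills the second. The
    two functions may differ, as the approximating sum uses a different function for each index. *)
Lemma mdiff_orth i j F G : i != j -> fE (fun x => mdiff i F x * mdiff j G x) = 0.
Proof.
wlog ij : i j F G / (enum_rank i < enum_rank j)%N => [hw|] ne.
  case: (ltngtP (enum_rank i) (enum_rank j)) => [ij|ij|/val_inj/enum_rank_inj].
  - exact: hw.
  - rewrite (eq_fE (G := fun x => mdiff j G x * mdiff i F x)); last first.
      by move=> x; rewrite mulrC.
    by apply: hw => //; rewrite eq_sym.
  - by move=> e; rewrite e eqxx in ne.
rewrite -(fE_cE (sle i)).
rewrite (eq_fE (G := fun x => 0)) ?fE_cst // => x.
rewrite cE_pull; last exact: mdiff_depends_sle.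
rewrite cE_mdiff0 ?mulr0 //.
by apply/subsetP => k; rewrite !inE => /leq_ltn_trans; apply.
Qed.

Lemma fE_mdiff_sqr i F : fE (fun x => mdiff i F x ^+ 2) <= fE (fun x => F x ^+ 2).
Proof.
apply: le_trans (sqr_cE (sle i) F).
(* Pythagoras: the martingale difference is orthogonal to the conditional expectation on the smaller
   set. *)
have e : fE (fun x => cE (slt i) F x * cE (sle i) F x) = fE (fun x => cE (slt i) F x ^+ 2).
  rewrite -(fE_cE (slt i)); apply: eq_fE => x.
  rewrite cE_pull; last first.
    by apply: (dependsS _ (cE_depends (S := slt i) (@dependsT F))); rewrite subsetIl.
  by rewrite cE_cE (finset.setIidPl (slt_sle i)) expr2.
rewrite (eq_fE (G := fun x => (cE (sle i) F x ^+ 2 - 2 * (cE (slt i) F x * cE (sle i) F x)) + cE (slt i) F x ^+ 2)); last first.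
  by move=> x; rewrite /mdiff; ring.
rewrite fED fEB fEZ e.
have := fE_ge0 (F := fun x => cE (slt i) F x ^+ 2) (fun x => sqr_ge0 _).
lra.
Qed.

Lemma norm_mdiff i F K x : (forall x, `|F x| <= K) -> `|mdiff i F x| <= 2 * K.
Proof.
move=> FK; apply: le_trans (ler_normB _ _) _.
rewrite mulr_natl mulr2n lerD //; exact: norm_cE.
Qed.

Lemma fE_sum_sqr (xi : I -> cfg -> R) :
  (forall i j, i != j -> fE (fun x => xi i x * xi j x) = 0) ->
  fE (fun x => (\sum_i xi i x) ^+ 2) = \sum_i fE (fun x => xi i x ^+ 2).
Proof.
move=> orth.
rewrite (eq_fE (G := fun x => \sum_i \sum_j xi i x * xi j x)); last first.
  move=> x; rewrite expr2 mulr_suml; apply: eq_bigr => i _.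
  by rewrite mulr_sumr.
rewrite fE_sum; apply: eq_bigr => i _; rewrite fE_sum (bigD1 i) //= big1 ?addr0.
  by apply: eq_fE => x; rewrite expr2.
by move=> j ji; apply: orth; rewrite eq_sym.
Qed.

Lemma fE_sum_mdiff_sqr (F : I -> cfg -> R) :
  fE (fun x => (\sum_i mdiff i (F i) x) ^+ 2) = \sum_i fE (fun x => mdiff i (F i) x ^+ 2).
Proof. by apply: fE_sum_sqr => i j; exact: mdiff_orth. Qed.

Definition upd (i : I) (a : A) x : cfg := [ffun j => if j == i then a else x j].

Lemma fE_prod_coord (J : {set I}) (Q : pred A) :
  fE (fun z => \prod_(j in J) (Q (z j))%:R) = (\sum_(a | Q a) p a) ^+ #|J|.
Proof.
rewrite /fE /pr.
rewrite (eq_bigr (fun z : cfg => \prod_i (p (z i) * (if i \in J then (Q (z i))%:R else 1)))).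
  rewrite -(bigA_distr_bigA (fun i a => p a * (if i \in J then (Q a)%:R else 1))) /=.
  rewrite (bigID (mem J)) /= [X in _ * X]big1 ?mulr1.
    rewrite (eq_bigr (fun=> \sum_(a | Q a) p a)) ?prodr_const // => i iJ.
    rewrite [RHS]big_mkcond; apply: eq_bigr => a _; rewrite iJ.
    by case: (Q a); rewrite ?mulr1 ?mulr0.
  move=> i /negPf iJ; rewrite -[RHS]p_sum1; apply: eq_bigr => a _.
  by rewrite iJ mulr1.
move=> z _; rewrite big_split /=; congr (_ * _).
by rewrite [LHS]big_mkcond.
Qed.

Lemma fE_coord (i : I) (g : A -> R) : fE (fun z => g (z i)) = \sum_a p a * g a.
Proof.
rewrite /fE /pr.
rewrite (eq_bigr (fun z : cfg => \prod_j (p (z j) * (if j == i then g (z j) else 1)))).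
  rewrite -(bigA_distr_bigA (fun j a => p a * (if j == i then g a else 1))) /=.
  rewrite (bigD1 i) //= [X in _ * X]big1 ?mulr1.
    by apply: eq_bigr => a _; rewrite eqxx.
  move=> j /negPf ji; rewrite -[RHS]p_sum1; apply: eq_bigr => a _.
  by rewrite ji mulr1.
move=> z _; rewrite big_split /=; congr (_ * _).
rewrite (bigD1 i) //= eqxx big1 ?mulr1 // => j /negPf -> //.
Qed.

(* [cE [set i]] contracts L^2 and maps the i-th martingale difference to the
   centered one-coordinate projection of F. *)
Lemma mdiff_sqr_ge i F (lo hi : pred A) (q c : R) :
  0 <= q -> 0 <= c ->
  q <= \sum_(a | lo a) p a -> q <= \sum_(a | hi a) p a ->
  (forall a b, lo a -> hi b -> c <= fE (fun z => F (upd i b z) - F (upd i a z))) ->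
  q ^+ 2 * c ^+ 2 / 2 <= fE (fun x => mdiff i F x ^+ 2).
Proof.
move=> q0 c0 qlo qhi Fc.
pose g a := fE (fun z => F (upd i a z)).
have gE x : cE [set i] F x = g (x i).
  apply: eq_fE => y; congr F; apply/ffunP => j; rewrite !ffunE inE.
  by case: eqP => // ->.
have proj x : cE [set i] (mdiff i F) x = g (x i) - fE F.
  rewrite cEB !cE_cE.
  have -> : [set i] :&: sle i = [set i].
    by apply/finset.setIidPl/subsetP => j; rewrite !inE => /eqP ->.
  have -> : [set i] :&: slt i = set0.
    by apply/setP => j; rewrite !inE; case: eqP => // ->; rewrite ltnn.
  rewrite gE; congr (_ - _).
  by apply: eq_fE => y; congr F; apply/ffunP => j; rewrite ffunE inE.
apply: le_trans (sqr_cE [set i] _).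
rewrite (eq_fE (G := fun x => (g (x i) - fE F) ^+ 2)); last by move=> x; rewrite proj.
rewrite (fE_coord i (fun a => (g a - fE F) ^+ 2)).
set m := fE F.
(* Up to the square of a mean, twice the variance of [g] is the mean of (g b - g a)^2 over
   independent [a] and [b]; the pairs with [a] in [lo] and [b] in [hi] carry mass at least q^2. *)
have step : q ^+ 2 * c ^+ 2 <=
    \sum_a \sum_b p a * p b * ((g b - m) - (g a - m)) ^+ 2.
  apply: (@le_trans _ _ (\sum_(a | lo a) \sum_(b | hi b) p a * p b * c ^+ 2)).
    have -> : \sum_(a | lo a) \sum_(b | hi b) p a * p b * c ^+ 2 =
       ((\sum_(a | lo a) p a) * (\sum_(b | hi b) p b)) * c ^+ 2.
      rewrite mulr_suml mulr_suml; apply: eq_bigr => a _.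
      by rewrite mulr_sumr mulr_suml.
    apply: ler_wpM2r; first exact: sqr_ge0.
    by rewrite expr2; apply: ler_pM.
  rewrite big_mkcond; apply: ler_sum => a _.
  case: ifP => la; last first.
    by apply: sumr_ge0 => b _; apply: mulr_ge0; [exact: mulr_ge0|exact: sqr_ge0].
  rewrite big_mkcond; apply: ler_sum => b _.
  case: ifP => hb; last by apply: mulr_ge0; [exact: mulr_ge0|exact: sqr_ge0].
  apply: ler_wpM2l; first by rewrite mulr_ge0.
  have -> : g b - m - (g a - m) = g b - g a by ring.
  have := Fc a b la hb; rewrite fEB -/(g b) -/(g a) => h.
  by rewrite ler_pXn2r ?nnegrE //; apply: le_trans h.
set V := \sum_a p a * (g a - m) ^+ 2.
set B := \sum_a p a * (g a - m).
have e : \sum_a \sum_b p a * p b * ((g b - m) - (g a - m)) ^+ 2 = 2 * V - 2 * B ^+ 2.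
  rewrite (eq_bigr (fun a => p a * V + ((p a * (g a - m) ^+ 2) - (2 * B) * (p a * (g a - m))))).
    rewrite big_split /= -mulr_suml p_sum1 mul1r sumrB -/V -mulr_sumr -/B.
    ring.
  move=> a _.
  rewrite (eq_bigr (fun b => p a * (p b * (g b - m) ^+ 2) + ((p a * (g a - m) ^+ 2) * p b - (2 * (p a * (g a - m))) * (p b * (g b - m))))).
    rewrite big_split /= sumrB -!mulr_sumr p_sum1 -/V -/B; ring.
  by move=> b _; ring.
rewrite e in step.
have := sqr_ge0 B.
lra.
Qed.

Lemma fE_sum_local_sqr (eta : I -> cfg -> R) (N : I -> {set I}) (K : R) (D : nat) :
  (forall i j, j \notin N i -> fE (fun x => eta i x * eta j x) = 0) ->
  (forall i x, `|eta i x| <= K) -> (forall i, #|N i| <= D)%N ->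
  fE (fun x => (\sum_i eta i x) ^+ 2) <= #|I|%:R * D%:R * K ^+ 2.
Proof.
move=> orth etaK ND.
rewrite (eq_fE (G := fun x => \sum_i \sum_j eta i x * eta j x)); last first.
  by move=> x; rewrite expr2 mulr_suml; apply: eq_bigr => i _; rewrite mulr_sumr.
rewrite fE_sum.
apply: (@le_trans _ _ (\sum_(i in I) (D%:R * K ^+ 2))); last first.
  by rewrite sumr_const -[leLHS]mulr_natl mulrA.
apply: ler_sum => i _; rewrite fE_sum (bigID (mem (N i))) /= [X in _ + X]big1 ?addr0; last first.
  by move=> j; exact: orth.
apply: (@le_trans _ _ (\sum_(j in N i) K ^+ 2)); last first.
  by rewrite sumr_const -[leLHS]mulr_natl ler_wpM2r ?sqr_ge0 // ler_nat.
apply: ler_sum => j _; rewrite -[leRHS]fE_cst; apply: le_fE => x.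
by apply: le_trans (ler_norm _) _; rewrite normrM expr2 ler_pM.
Qed.

Lemma depends_mul S T F G : depends S F -> depends T G ->
  depends (S :|: T) (fun x => F x * G x).
Proof.
move=> dF dG x y xy; congr (_ * _).
  by apply: dF => i iS; apply: xy; rewrite inE iS.
by apply: dG => i iS; apply: xy; rewrite inE iS orbT.
Qed.

(** Stein's method on a dependency graph. [U i] gathers the terms that may be correlated with
    [xi i], so that [W - U i / s] is independent of [xi i]; expanding [f] turns E W f(W) into E T
    f'(W) plus a Taylor remainder, where [T] has mean E W^2. The hypothesis on [delta] controls the
    variance of [T]. [W] is not normalised: the defect |1 - E W^2| appears in the bound. *)
Lemma stein_local (B : I -> {set I}) (xi : I -> cfg -> R) (K s c1 c2 delta : R)
    (D : nat) (f f' : R -> R) (W := fun x => (\sum_i xi i x) / s) :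
  (forall i, i \in B i) -> (forall i, depends (B i) (xi i)) ->
  (forall i x, `|xi i x| <= K) -> (forall i, fE (xi i) = 0) ->
  (forall i, #|[set j | ~~ [disjoint B i & B j]]| <= D)%N ->
  0 < s -> (forall u, `|f' u| <= c1) ->
  (forall u v, `|f v - f u - (v - u) * f' u| <= c2 * (v - u) ^+ 2) ->
  0 <= delta ->
  #|I|%:R * (D ^ 3)%:R * (2 * (D%:R * K ^+ 2)) ^+ 2 / s ^+ 4 <= delta ^+ 2 ->
  `|fE (fun x => f' (W x) - W x * f (W x))| <=
    c1 * (`|1 - fE (fun x => W x ^+ 2)| + delta)
    + #|I|%:R * K * c2 * (D%:R * K) ^+ 2 / s ^+ 3.
Proof.
move=> iB dxi xiK xi0 ND s0 f'c1 fc2 d0 hd.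
pose N i := [set j | ~~ [disjoint B i & B j]].
pose U i x := \sum_(j in N i) xi j x.
pose T x := (\sum_i xi i x * U i x) / s ^+ 2.
have Nsym i j : (j \in N i) = (i \in N j) by rewrite !inE disjoint_sym.
have K0 (i : I) x : 0 <= K by apply: le_trans (xiK i x).
have UK i x : `|U i x| <= D%:R * K.
  apply: le_trans (ler_norm_sum _ _ _) _.
  apply: (@le_trans _ _ (\sum_(j in N i) K)); first exact: ler_sum.
  by rewrite sumr_const -[leLHS]mulr_natl ler_wpM2r ?(K0 i x) // ler_nat; exact: ND.
have sn0 : s != 0 by rewrite gt_eqF.
have xi_orth i j : j \notin N i -> fE (fun x => xi i x * xi j x) = 0.
  rewrite inE negbK => dis.
  by rewrite (fE_indep (dxi i) (dxi j) dis) xi0 mul0r.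
have ET : fE T = fE (fun x => W x ^+ 2).
  rewrite (eq_fE (G := fun x => (s ^+ 2)^-1 * \sum_i xi i x * U i x)); last by move=> x; rewrite mulrC.
  rewrite (eq_fE (F := fun x => W x ^+ 2) (G := fun x => (s ^+ 2)^-1 * \sum_i \sum_j xi i x * xi j x)).
    rewrite !fEZ !fE_sum; congr (_ * _); apply: eq_bigr => i _.
    rewrite [RHS]fE_sum (bigID (mem (N i))) /= [X in _ = _ + X]big1 ?addr0; last first.
      by move=> j; exact: xi_orth.
    rewrite (eq_fE (G := fun x => \sum_(j in N i) xi i x * xi j x)) ?fE_sum //.
    by move=> x; rewrite mulr_sumr.
  move=> x; rewrite /W expr_div_n mulrC; congr (_ * _).
  by rewrite expr2 mulr_suml; apply: eq_bigr => i _; rewrite mulr_sumr.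
have ETabs : fE (fun x => `|1 - T x|) <= `|1 - fE (fun x => W x ^+ 2)| + delta.
  apply: (@le_trans _ _ (fE (fun x => `|1 - fE T| + `|T x - fE T|))).
    apply: le_fE => x; have -> : 1 - T x = (1 - fE T) - (T x - fE T) by ring.
    exact: ler_normB.
  rewrite fED fE_cst ET lerD2l -ET.
  have h0 : 0 <= fE (fun x => `|T x - fE T|) by apply: fE_ge0.
  rewrite -(ler_pXn2r (n := 2)) ?nnegrE //.
  apply: le_trans (fE_cauchy _) _; apply: le_trans hd.
  pose eta i x := xi i x * U i x - fE (fun x => xi i x * U i x).
  pose C i := \bigcup_(j in N i) B j.
  have iN i : i \in N i.
    by rewrite inE; apply/pred0Pn; exists i; rewrite /= iB.
  have dU i : depends (C i) (U i).
    move=> x y xy; apply: eq_bigr => j jN; apply: (dxi j) => k kB.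
    by apply: xy; apply/bigcupP; exists j.
  have deta i : depends (C i) (eta i).
    move=> x y xy; congr (_ - _).
    apply: (dependsS _ (depends_mul (dxi i) (dU i))) xy.
    by rewrite subUset subxx andbT; apply: bigcup_sup.
  have eta0 i : fE (eta i) = 0 by rewrite /eta fEB fE_cst subrr.
  (* [eta i] depends on the sets [B j] with [j] next to [i], so two of these variables can be
     correlated only across three steps of the dependency graph, whence [D ^ 3]. *)
  pose N3 i := \bigcup_(j in N i) \bigcup_(k in N j) N k.
  have eta_orth i j : j \notin N3 i -> fE (fun x => eta i x * eta j x) = 0.
    move=> jN.
    rewrite (fE_indep (deta i) (deta j)) ?eta0 ?mul0r //.
    apply: contraR jN => /pred0Pn[v /andP[/= /bigcupP[k kN vk] /bigcupP[l lN vl]]].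
    apply/bigcupP; exists k => //; apply/bigcupP; exists l.
      by rewrite inE; apply/pred0Pn; exists v; rewrite /= vk.
    by rewrite -Nsym.
  have etaK i x : `|eta i x| <= 2 * (D%:R * K ^+ 2).
    have h y : `|xi i y * U i y| <= D%:R * K ^+ 2.
      rewrite normrM expr2 mulrA mulrC; exact: ler_pM.
    apply: le_trans (ler_normB _ _) _.
    rewrite mulr_natl mulr2n lerD //.
    by apply: le_trans (norm_fE _) _; rewrite -[leRHS]fE_cst; exact: le_fE.
  have bigD (X : {set I}) (Y : I -> {set I}) (a b : nat) : (#|X| <= a)%N ->
      (forall i, #|Y i| <= b)%N -> (#|\bigcup_(i in X) Y i| <= a * b)%N.
    move=> Xa Yb.
    apply: (@leq_trans (\sum_(i in X) #|Y i|)).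
      elim/big_ind2: _ => [|u Z v Z' uZ vZ'|//]; first by rewrite cards0.
      by apply: leq_trans (leq_card_setU _ _) _; exact: leq_add.
    apply: (@leq_trans (\sum_(i in X) b)); first exact: leq_sum.
    by rewrite sum_nat_const leq_mul2r Xa orbT.
  have N3D i : (#|N3 i| <= D ^ 3)%N.
    by rewrite !expnS expn0 muln1; apply: (bigD) => [|j]; [exact: ND|apply: (bigD) => [|k]; exact: ND].
  rewrite (eq_fE (G := fun x => (s ^+ 4)^-1 * (\sum_i eta i x) ^+ 2)); last first.
    move=> x; rewrite /eta sumrB.
    have -> : \sum_i fE (fun x => xi i x * U i x) = s ^+ 2 * fE T.
      rewrite -fE_sum -fEZ; apply: eq_fE => y; rewrite /T; field.
      by rewrite sn0.
    rewrite /T; field; by rewrite sn0.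
  rewrite fEZ mulrC ler_wpM2r ?invr_ge0 ?exprn_ge0 ?(ltW s0) //.
  exact: (@fE_sum_local_sqr eta N3).
(* Without the neighbours of [i], the sum is a function of coordinates outside [B i]. *)
pose Wi i x := W x - U i x / s.
have Wi0 i : fE (fun x => xi i x * f (Wi i x)) = 0.
  pose S := \bigcup_(j in ~: N i) B j.
  have dW : depends S (fun x => f (Wi i x)).
    move=> x y xy; congr f.
    suff h z : Wi i z = (\sum_(j in ~: N i) xi j z) / s.
      rewrite !h; congr (_ / _); apply: eq_bigr => j jN; apply: (dxi j) => k kB.
      by apply: xy; apply/bigcupP; exists j.
    rewrite /Wi /W /U (bigID (mem (N i))) /= mulrDl addrAC subrr add0r.
    by congr (_ / _); apply: eq_bigl => j; rewrite !inE.
  rewrite (fE_indep (dxi i) dW) ?xi0 ?mul0r //.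
  apply/pred0P => k /=; apply/negP => /andP[kB /bigcupP[j]].
  by rewrite !inE negbK => /pred0P /(_ k) /=; rewrite kB /= => ->.
pose er i x := f (Wi i x) - f (W x) - (Wi i x - W x) * f' (W x).
(* The terms E xi_i f(W_i) vanish, so they may be subtracted. The expansion is at [W] and not at
   [Wi i], so that the first-order terms add up to [T]. *)
have key : fE (fun x => f' (W x) - W x * f (W x)) =
    fE (fun x => f' (W x) * (1 - T x)) + \sum_i fE (fun x => s^-1 * (xi i x * er i x)).
  have -> : \sum_i fE (fun x => s^-1 * (xi i x * er i x)) =
     \sum_i (fE (fun x => s^-1 * (xi i x * er i x)) - s^-1 * fE (fun x => xi i x * f (Wi i x))).
    by apply: eq_bigr => i _; rewrite Wi0 mulr0 subr0.
  rewrite (eq_bigr (fun i => fE (fun x => s^-1 * (xi i x * (- f (W x) + U i x / s * f' (W x)))))).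
    rewrite -fE_sum -fED; apply: eq_fE => x.
    rewrite (eq_bigr (fun i => (f' (W x) / s ^+ 2) * (xi i x * U i x) - (f (W x) / s) * xi i x)).
      by rewrite sumrB -!mulr_sumr /T /W; field; rewrite sn0.
    by move=> i _; field; rewrite sn0.
  move=> i _; rewrite -fEZ -fEB; apply: eq_fE => x; rewrite /er /Wi; field.
  by rewrite sn0.
rewrite key; apply: le_trans (ler_normD _ _) _; apply: lerD.
  apply: le_trans (norm_fE _) _.
  apply: (@le_trans _ _ (fE (fun x => c1 * `|1 - T x|))).
    by apply: le_fE => x; rewrite normrM ler_wpM2r.
  by rewrite fEZ ler_wpM2l //; apply: le_trans (f'c1 0).
apply: le_trans (ler_norm_sum _ _ _) _.
apply: (@le_trans _ _ (\sum_(i in I) (s^-1 * (K * (c2 * ((D%:R * K) / s) ^+ 2))))).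
  apply: ler_sum => i _; apply: le_trans (norm_fE _) _.
  rewrite -[leRHS]fE_cst; apply: le_fE => x.
  rewrite !normrM gtr0_norm ?invr_gt0 // ler_wpM2l ?invr_ge0 ?(ltW s0) //.
  apply: ler_pM => //; apply: le_trans (fc2 _ _) _.
  have -> : Wi i x - W x = - (U i x / s) by rewrite /Wi; ring.
  rewrite sqrrN; apply: ler_wpM2l.
    have := fc2 0 1; rewrite subr0 expr1n mulr1; apply: le_trans.
    exact: normr_ge0.
  rewrite !expr_div_n ler_wpM2r ?invr_ge0 ?exprn_ge0 ?(ltW s0) //.
  rewrite -[leLHS]real_normK ?num_real // ler_pXn2r ?nnegrE //.
  by apply: le_trans (UK i x).
rewrite sumr_const -[leLHS]mulr_natl le_eqVlt; apply/orP; left; apply/eqP.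
by field; rewrite sn0.
Qed.

End FiniteProduct.

Local Open Scope classical_set_scope.
Local Open Scope fset_scope.
Local Open Scope ring_scope.

(** * Stein's equation *)

Section SteinEquation.
Variable R : realType.
Implicit Types (x y u v s t : R).
Local Notation phi := (@normal_pdf R 0 1).
Local Notation mu := (@lebesgue_measure R).

Lemma phiE x : phi x = normal_peak 1 * expR (- (x ^+ 2) / 2).
Proof.
rewrite normal_pdfE ?oner_neq0 // /normal_fun subr0 expr1n.
by [].
Qed.

Lemma phi_gt0 x : 0 < phi x.
Proof. by rewrite phiE mulr_gt0 ?expR_gt0 // normal_peak_gt0 // oner_neq0. Qed.

Lemma phi_opp x : phi (- x) = phi x.
Proof. by rewrite !phiE sqrrN. Qed.

Lemma is_derive_phi x : is_derive x 1 (phi : R -> R) (- x * phi x).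
Proof.
have -> : (phi : R -> R) = (fun x => normal_peak 1 * expR (- (x ^+ 2) / 2)).
  by apply/funext => y; rewrite phiE.
apply: is_derive_eq.
rewrite /GRing.scale /=.
by field.
Qed.

Lemma nondecreasing_from_derive (g dg : R -> R) x y :
  (forall t, x <= t <= y -> is_derive t 1 g (dg t)) ->
  (forall t, x <= t <= y -> 0 <= dg t) -> x <= y -> g x <= g y.
Proof.
move=> gd dg0; rewrite le_eqVlt => /orP[/eqP->//|xy].
have [||t] := @MVT R g dg x y xy.
- by move=> t; rewrite in_itv /= => /andP[xt ty]; apply: gd; rewrite !ltW.
- apply: derivable_within_continuous => t; rewrite in_itv /= => h.
  by have [] := gd t h.
rewrite in_itv /= => /andP[xt ty] e.
rewrite -subr_ge0 e mulr_ge0 ?subr_ge0 ?(ltW xy) //.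
by apply: dg0; rewrite !ltW.
Qed.

Lemma nonincreasing_from_derive (g dg : R -> R) x y :
  (forall t, x <= t <= y -> is_derive t 1 g (dg t)) ->
  (forall t, x <= t <= y -> dg t <= 0) -> x <= y -> g y <= g x.
Proof.
move=> gd dg0 xy; rewrite -lerN2.
apply: (@nondecreasing_from_derive (fun t => - g t) (fun t => - dg t)) => //.
  by move=> t h; have := gd t h => ?; apply: is_deriveN.
by move=> t h; rewrite oppr_ge0 dg0.
Qed.

Lemma lipschitz_from_derive (g dg : R -> R) (c : R) :
  (forall t, is_derive t 1 g (dg t)) -> (forall t, `|dg t| <= c) ->
  forall x y, `|g y - g x| <= c * `|y - x|.
Proof.
move=> gd dgc x y; wlog xy : x y / x <= y => [hw|].
  by case/orP: (le_total x y) => h; [exact: hw|rewrite distrC (distrC y); exact: hw].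
rewrite (ger0_norm (x := y - x)) ?subr_ge0 //.
have idd t : is_derive t 1 (fun s : R => c * s) c.
  by apply: is_derive_eq; rewrite /GRing.scale /= mulr1.
rewrite ler_norml; apply/andP; split.
  have : c * x + g x <= c * y + g y.
    apply: (@nondecreasing_from_derive (fun t => c * t + g t) (fun t => c + dg t)) => // t _.
    by have := dgc t; rewrite ler_norml; lra.
  by lra.
have : c * x - g x <= c * y - g y.
  apply: (@nondecreasing_from_derive (fun t => c * t - g t) (fun t => c - dg t)) => // t _.
  by have := dgc t; rewrite ler_norml; lra.
by lra.
Qed.

Lemma taylor_from_lipschitz (g dg : R -> R) (c : R) :
  (forall t, is_derive t 1 g (dg t)) ->
  (forall x y, `|dg y - dg x| <= c * `|y - x|) ->
  forall x y, `|g y - g x - (y - x) * dg x| <= c * (y - x) ^+ 2.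
Proof.
move=> gd dgc x y.
have c0 : 0 <= c.
  have := dgc 0 1; rewrite subr0 normr1 mulr1; apply: le_trans; exact: normr_ge0.
suff [t [tx e]] : exists t, `|t - x| <= `|y - x| /\ g y - g x = (y - x) * dg t.
  rewrite e -mulrBr normrM -[(y - x) ^+ 2]real_normK ?num_real // expr2 mulrCA.
  apply: ler_wpM2l => //; apply: le_trans (dgc _ _) _.
  exact: ler_wpM2l.
have within u v : {within `[u, v], continuous g}.
  by apply: derivable_within_continuous => t _; have [] := gd t.
case: (ltgtP x y) => [xy|yx|->]; last first.
- by exists y; split => //; rewrite !subrr mul0r.
- have [//|t] := @MVT R g dg y x yx (fun t _ => gd t).
  rewrite in_itv /= => /andP[yt tx] e.
  exists t; split; last by rewrite -opprB e; ring.
  by rewrite !ltr0_norm ?subr_lt0 // lerN2 lerD2r ltW.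
- have [//|t] := @MVT R g dg x y xy (fun t _ => gd t).
  rewrite in_itv /= => /andP[xt ty] e.
  exists t; split; last by rewrite e; ring.
  by rewrite !gtr0_norm ?subr_gt0 // lerD2r ltW.
Qed.

(* Stated for any v with [v' = - phi] and [v (+oo) = 0] because both Gaussian
   tails, [1 - Phi x] and [Phi (- x)], are of this form. *)
Lemma mills_ratio (v : R -> R) :
  (forall t, is_derive t 1 v (- phi t)) -> (forall t, 0 <= v t) ->
  v t @[t --> +oo%R] --> (0 : R) ->
  forall x, 0 < x -> phi x / x - phi x / x ^+ 3 <= v x <= phi x / x.
Proof.
move=> vd v0 vlim x x0; apply/andP; split.
  (* The difference of the two sides has derivative -3 phi / t^4, so it decreases, and its limit at
     infinity is 0. *)
  have mono y : x <= y -> v y - (phi y / y - phi y / y ^+ 3) <= v x - (phi x / x - phi x / x ^+ 3).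
    apply: (@nonincreasing_from_derive (fun t => v t - (phi t / t - phi t / t ^+ 3)) (fun t => - (3 * phi t / t ^+ 4))).
      move=> t /andP[xt ty].
      have t0 : t != 0 by rewrite gt_eqF // (lt_le_trans x0).
      have := vd t => ?; have := is_derive_phi t => ?.
      have t3 : t ^+ 3 != 0 by rewrite expf_neq0.
      have d1 : is_derive t 1 (fun s : R => s^-1) (- t ^- 2 *: 1).
        by apply: is_deriveV.
      have d3 : is_derive t 1 (fun s : R => (s ^+ 3)^-1) (- (t ^+ 3) ^- 2 *: (3 * t ^+ 2)).
        apply: is_deriveV => //.
        by apply: is_derive_eq; rewrite /GRing.scale /= mulr1; ring.
      apply: is_derive_eq.
      by rewrite /GRing.scale /=; field; rewrite t0.
    move=> t /andP[xt ty]; rewrite oppr_le0 !mulr_ge0 ?invr_ge0 ?exprn_ge0 ?(ltW (phi_gt0 _)) //.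
    by rewrite (le_trans (ltW x0)).
  rewrite -subr_ge0; apply/ler_addgt0Pr => e e0.
  (* Far enough out that [phi y / y <= e], as [phi] never exceeds [normal_peak 1]. *)
  pose y := Num.max x (normal_peak 1 / e).
  have xy : x <= y by rewrite le_max lexx.
  have y0 : 0 < y by rewrite (lt_le_trans x0).
  have py : phi y / y <= e.
    apply: (@le_trans _ _ (normal_peak 1 / y)).
      by rewrite ler_wpM2r ?invr_ge0 ?(ltW y0) // normal_pdf_ub // oner_neq0.
    by rewrite ler_pdivrMr // mulrC -ler_pdivrMr // le_max lexx orbT.
  have := mono y xy; have := v0 y.
  have : 0 <= phi y / y ^+ 3 by rewrite divr_ge0 ?exprn_ge0 ?(ltW (phi_gt0 _)) ?(ltW y0).
  lra.
have mono y : x <= y -> phi y / y - v y <= phi x / x - v x.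
  apply: (@nonincreasing_from_derive (fun t => phi t / t - v t) (fun t => - (phi t / t ^+ 2))).
    move=> t /andP[xt ty].
    have t0 : t != 0 by rewrite gt_eqF // (lt_le_trans x0).
    have := vd t => ?; have := is_derive_phi t => ?.
    have d1 : is_derive t 1 (fun s : R => s^-1) (- t ^- 2 *: 1).
      by apply: is_deriveV.
    apply: is_derive_eq.
    by rewrite /GRing.scale /=; field; rewrite t0.
  move=> t /andP[xt ty]; rewrite oppr_le0 !mulr_ge0 ?invr_ge0 ?exprn_ge0 ?(ltW (phi_gt0 _)) //.
  by rewrite (le_trans (ltW x0)).
rewrite -subr_ge0; apply/ler_addgt0Pr => e e0.
have [y [xy vy]] : exists y, x <= y /\ v y <= e.
  near (pinfty_nbhs R) => y; exists y; split; near: y; first (apply: nbhs_pinfty_ge; exact: num_real).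
  by apply: (cvgr_le 0).
have y0 : 0 < y by rewrite (lt_le_trans x0).
have := mono y xy.
have : 0 <= phi y / y by rewrite divr_ge0 ?(ltW (phi_gt0 _)) ?(ltW y0).
lra.
Unshelve. all: by end_near.
Qed.

Section primitive.
Variable g : R -> R.
Hypothesis g01 : forall x, 0 <= g x <= 1.
Hypothesis g_cont : continuous g.

Lemma integrable_mul_phi (A : set R) : measurable A ->
  mu.-integrable A (EFin \o (fun t => g t * phi t)).
Proof.
move=> mA; apply: (integrableS measurableT) => //.
apply: le_integrable (integrable_normal_pdf 0 1) => //.
  apply/measurable_EFinP; apply: measurable_funM.
    exact: continuous_measurable_fun.
  exact: measurable_normal_pdf.
move=> x _; rewrite lee_fin normrM ler_piMl //.
by have /andP[g0 g1] := g01 x; rewrite ger0_norm.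
Qed.

(** With [g = 1] this is the distribution function of N(0,1); with [g] a ramp it enters the
    numerator of the solution of Stein's equation. *)
Definition prim x : R := \int[mu]_(t in `]-oo, x]) (g t * phi t).

Lemma is_derive_prim x : is_derive x 1 prim (g x * phi x).
Proof.
have [] := @continuous_FTC1 R (fun t => g t * phi t) -oo%O x (x + 1).
- by rewrite ltrDl.
- exact: integrable_mul_phi.
- by rewrite ltNyr.
- apply: continuousM; first exact: g_cont.
  by apply: continuous_normal_pdf; rewrite oner_neq0.
by move=> d e; apply: DeriveDef; [exact: d|rewrite -derive1E e].
Qed.

End primitive.

Definition Phi x : R := fine (normal_prob 0 1 `]-oo, x]).

Lemma PhiE : Phi = prim (fun=> 1).
Proof.
apply/funext => x; rewrite /prim.
transitivity (\int[mu]_(t in `]-oo, x]) phi t)%R; first by [].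
by apply: eq_Rintegral => t _; rewrite mul1r.
Qed.

Lemma is_derive_Phi x : is_derive x 1 Phi (phi x).
Proof.
rewrite PhiE -[phi x]mul1r; apply: (@is_derive_prim (fun=> 1)).
  by move=> y; rewrite ler01 lexx.
exact: cst_continuous.
Qed.

Lemma Phi01 x : 0 <= Phi x <= 1.
Proof.
rewrite /Phi fine_ge0 //= -lee_fin fineK ?fin_num_measure //.
exact: probability_le1.
Qed.

(** Makes [Phi] the cumulative distribution function of a random variable, the identity, so that its
    limits at both infinities follow. *)
Let mid : (idfun : measurableTypeR R -> R) \in mfun.
Proof. by apply: mem_set; exact: measurable_id. Qed.

Lemma Phi_y : Phi x @[x --> +oo%R] --> (1 : R).
Proof.
have := @cvg_cdfy1 _ _ R (normal_prob 0 1) (mfun_Sub mid).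
exact: fine_cvg.
Qed.

Lemma Phi_Ny : Phi (- x) @[x --> +oo%R] --> (0 : R).
Proof.
have := @cvg_cdfNy0 _ _ R (normal_prob 0 1) (mfun_Sub mid).
rewrite cvgNy_compNP; exact: fine_cvg.
Qed.

(** Lipschitz stand-in for the indicator of a half-line: 1 up to [a], 0 from [b] on, affine between.
    Distribution functions are sandwiched between two ramps. *)
Definition ramp a b u : R := Num.max 0 (Num.min 1 ((b - u) / (b - a))).

Lemma ramp01 a b u : 0 <= ramp a b u <= 1.
Proof. by rewrite /ramp le_max lexx /= ge_max ler01 /= ge_min lexx. Qed.

Lemma ramp_le a b u : a < b -> u <= a -> ramp a b u = 1.
Proof.
move=> ab ua; rewrite /ramp min_l; first by rewrite max_r // ler01.
by rewrite ler_pdivlMr ?subr_gt0 // mul1r; lra.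
Qed.

Lemma ramp_ge a b u : a < b -> b <= u -> ramp a b u = 0.
Proof.
move=> ab bu; rewrite /ramp max_l // ge_min; apply/orP; right.
by rewrite pmulr_lle0 ?invr_gt0 ?subr_gt0 // subr_le0.
Qed.

Lemma ramp_lipschitz a b u v : a < b ->
  `|ramp a b v - ramp a b u| <= (b - a)^-1 * `|v - u|.
Proof.
move=> ab.
have e : (b - u) / (b - a) - (b - v) / (b - a) = (b - a)^-1 * (v - u).
  by field; rewrite subr_eq0 gt_eqF.
have -> : (b - a)^-1 * `|v - u| = `|(b - u) / (b - a) - (b - v) / (b - a)|.
  by rewrite e normrM gtr0_norm // invr_gt0 subr_gt0.
rewrite /ramp; move: (_ / _) (_ / _) => s t.
have cl (r : R) : [\/ Num.max 0 (Num.min 1 r) = 0 /\ r <= 0,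
    Num.max 0 (Num.min 1 r) = r /\ 0 <= r <= 1 | Num.max 0 (Num.min 1 r) = 1 /\ 1 <= r].
  case: (lerP r 0) => r0; first by apply: Or31; rewrite max_l // ge_min r0 orbT.
  case: (lerP r 1) => r1; first by apply: Or32; rewrite max_r ?(ltW r0).
  by apply: Or33; rewrite max_r ?ler01 ?(ltW r1).
rewrite distrC; wlog ts : s t {e} / t <= s => [hw|].
  by case/orP: (le_total t s) => ?; [exact: hw|rewrite distrC (distrC s); exact: hw].
rewrite (ger0_norm (x := s - t)) ?subr_ge0 // ler_norml.
by case: (cl s) => -[-> hs]; case: (cl t) => -[-> ht]; apply/andP; split; lra.
Qed.

Lemma ramp_continuous a b : a < b -> continuous (ramp a b).
Proof.
move=> ab x; apply/cvgrPdist_le => e e0; near=> y.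
apply: le_trans (ramp_lipschitz _ _ ab) _.
rewrite mulrC ler_pdivrMr ?subr_gt0 //.
near: y; apply: cvgr_dist_le; first exact: cvg_id.
by rewrite mulr_gt0 ?subr_gt0.
Unshelve. all: by end_near.
Qed.

End SteinEquation.

Section SteinSolution.
Variable R : realType.
Implicit Types (x y u v s t : R).
Local Notation phi := (@normal_pdf R 0 1).
Local Notation Phi := (@Phi R).

Lemma continuous_bounded_itv (g : R -> R) (A : R) : continuous g ->
  exists C, forall x, `|x| <= A -> `|g x| <= C.
Proof.
move=> gc; have gw (h : R -> R) : continuous h -> {within `[- A, A], continuous h}.
  by move=> hc; apply/continuous_subspaceT => x; exact: hc.
case: (ltP A 0) => [A0|A0].
  exists 0 => x /(le_trans (normr_ge0 x)); lra.
have AA : - A <= A by lra.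
have [p _ hp] := EVT_max AA (gw _ gc).
have [q _ hq] := EVT_max AA (gw (fun x => - g x) (fun x => continuousN (gc x))).
exists (`|g p| + `|g q|) => x; rewrite ler_norml => xA.
have xi : x \in `[- A, A]%R by rewrite in_itv.
have := hp x xi; have := hq x xi; have := ler_norm (g p).
have := ler_norm (- g q); rewrite normrN.
have := normr_ge0 (g p); have := normr_ge0 (g q).
move=> *; rewrite ler_norml; apply/andP; split; lra.
Qed.

(** [c] is the Gaussian mean of the ramp [h], of which only the bracket by [Phi a] and [Phi b] is
    recorded. The solution is f = (Q - c Phi) / phi with [Q] the primitive of h phi. To the left of
    [a] and to the right of [b] the ramp is constant, so f is a constant times a Mills ratio, which
    bounds f and x f' there; on a compact interval continuity suffices. These bounds make f' = x f +
    h - c Lipschitz, hence the quadratic Taylor bound. *)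
Lemma stein_solution a b : a < b -> exists (f f' : R -> R) (c1 c2 c : R),
  [/\ Phi a <= c <= Phi b, (forall u, `|f' u| <= c1),
      (forall u v, `|f v - f u - (v - u) * f' u| <= c2 * (v - u) ^+ 2) &
      forall u, f' u - u * f u = ramp a b u - c].
Proof.
move=> ab.
pose h := ramp a b; have h01 x : 0 <= h x <= 1 by exact: ramp01.
have hc : continuous h by exact: ramp_continuous.
pose Q := prim h; pose c := Q b.
have Qd x : is_derive x 1 Q (h x * phi x) by exact: is_derive_prim.
have phin0 x : phi x != 0 by rewrite gt_eqF ?phi_gt0.
have hphi0 x : 0 <= h x * phi x.
  by rewrite mulr_ge0 ?(ltW (phi_gt0 _)) //; case/andP: (h01 x).
have Qle x y : x <= y -> Q x <= Q y.
  by apply: (@nondecreasing_from_derive _ Q (fun t => h t * phi t)).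
have Qge x : b <= x -> Q x = c.
  move=> bx; apply/le_anti/andP; split; last exact: Qle.
  apply: (@nonincreasing_from_derive _ Q (fun t => h t * phi t)) bx => // t /andP[bt _].
  by rewrite /h ramp_ge // mul0r.
have QPhi x : x <= a -> Q x = Phi x.
  move=> xa; rewrite PhiE; apply: eq_Rintegral => t.
  rewrite inE /= in_itv /= => tx; rewrite /h ramp_le //; exact: le_trans xa.
have cab : Phi a <= c <= Phi b.
  rewrite -(QPhi a) // Qle ?(ltW ab) //= /c PhiE.
  apply: le_Rintegral; [by []| | |].
  - by apply: integrable_mul_phi.
  - apply: integrable_mul_phi => //; first by move=> x; rewrite ler01 lexx.
    exact: cst_continuous.
  - move=> t _; rewrite ler_wpM2r ?(ltW (phi_gt0 _)) //.
    by case/andP: (h01 t).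
have c01 : 0 <= c <= 1.
  case/andP: cab => h1 h2; case/andP: (Phi01 a) => h3 _; case/andP: (Phi01 b) => _ h4.
  by rewrite (le_trans h3 h1) (le_trans h2 h4).
pose f x := (Q x - c * Phi x) / phi x.
pose f' x := x * f x + h x - c.
have fd x : is_derive x 1 f (f' x).
  have := is_derive_phi x => ?; have := Qd x => ?; have := is_derive_Phi x => ?.
  have d1 : is_derive x 1 (fun s => (phi s)^-1) (- (phi x) ^- 2 *: (- x * phi x)).
    exact: is_deriveV.
  apply: is_derive_eq; rewrite /GRing.scale /= /f' /f; field.
  exact: phin0.
have fc : continuous f.
  by move=> x; apply/differentiable_continuous/derivable1_diffP; have [] := fd x.
(* Outside [-A, A] the ramp is constant and |x| >= 1. *)
pose A : R := `|a| + `|b| + 1.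
have [C fC] := continuous_bounded_itv A fc.
have A1 : 1 <= A by rewrite lerDr addr_ge0.
have C0 : 0 <= C by apply: le_trans (normr_ge0 (f 0)) (fC 0 _); rewrite normr0; lra.
have mR := @mills_ratio R (fun x => 1 - Phi x).
have mL := @mills_ratio R (fun x => Phi (- x)).
have {mR} mR x : 0 < x -> phi x / x - phi x / x ^+ 3 <= 1 - Phi x <= phi x / x.
  apply: mR.
  - move=> t; have := is_derive_Phi t => ?; apply: is_derive_eq.
    by rewrite add0r mul1r.
  - by move=> t; case/andP: (Phi01 t); lra.
  - rewrite -[X in _ --> X](subrr 1); apply: cvgB; first exact: cvg_cst.
    exact: Phi_y.
have {mL} mL x : 0 < x -> phi x / x - phi x / x ^+ 3 <= Phi (- x) <= phi x / x.
  apply: mL.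
  - move=> t; have := is_derive_Phi (- t) => ?.
    have -> : - phi t = phi (- t) * (- 1) by rewrite phi_opp; ring.
    by apply: is_derive1_comp.
  - by move=> t; case/andP: (Phi01 (- t)).
  - exact: Phi_Ny.
(* Mills' bounds place x^2 (v / phi x) between x - 1/x and x. The second conclusion is the form that
   x f' takes on the tails, up to a constant factor in [0, 1]. *)
have ratio v x : 1 <= x -> phi x / x - phi x / x ^+ 3 <= v <= phi x / x ->
    0 <= v / phi x <= 1 /\ `|x * (x * (v / phi x) - 1)| <= 1.
  move=> x1 /andP[v1 v2]; have x0 : 0 < x by rewrite (lt_le_trans ltr01).
  have xn0 : x != 0 by rewrite gt_eqF.
  have px := phi_gt0 x.
  pose m := v / phi x.
  have m1 : x^-1 - (x ^+ 3)^-1 <= m.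
    rewrite /m ler_pdivlMr //; apply: le_trans v1; rewrite le_eqVlt; apply/orP; left; apply/eqP.
    by field.
  have m2 : m <= x^-1 by rewrite /m ler_pdivrMr // mulrC.
  have xV : x^-1 <= 1 by rewrite invf_le1.
  have x2 : 0 < x ^+ 2 by rewrite exprn_gt0.
  have e1 : x ^+ 2 * (x^-1 - (x ^+ 3)^-1) = x - x^-1 by field.
  have e2 : x ^+ 2 * x^-1 = x by field.
  have := m1; rewrite -(ler_pM2l x2) e1 => q1.
  have := m2; rewrite -(ler_pM2l x2) e2 => q2.
  rewrite -/m; split.
    rewrite (le_trans m2 xV) andbT; apply: le_trans m1.
    rewrite subr_ge0 lef_pV2 ?posrE ?exprn_gt0 //.
    by rewrite -[leLHS]expr1 ler_weXn2l.
  have -> : x * (x * m - 1) = x ^+ 2 * m - x by ring.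
  by rewrite ler_norml; apply/andP; split; lra.
have tail x : A < `|x| -> `|f x| <= 1 /\ `|x * f' x| <= 1.
  move=> Ax; case: (lerP 0 x) => x0.
    rewrite (ger0_norm x0) in Ax.
    have xb : b <= x by move: Ax; rewrite /A; have := ler_norm b; have := normr_ge0 a; lra.
    have x1 : 1 <= x by lra.
    have [/andP[q0 q1] q2] := ratio (1 - Phi x) x x1 (mR x (lt_le_trans ltr01 x1)).
    have fE : f x = c * ((1 - Phi x) / phi x) by rewrite /f Qge //; ring.
    have f'E : x * f' x = c * (x * (x * ((1 - Phi x) / phi x) - 1)).
      by rewrite /f' fE /h ramp_ge //; ring.
    rewrite f'E fE; case/andP: c01 => c0 c1.
    by split; rewrite normrM mulr_ile1 // ger0_norm.
  rewrite (ltr0_norm x0) in Ax.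
  have xa : x <= a.
    by move: Ax; rewrite /A; have := ler_norm (- a); rewrite normrN; have := normr_ge0 b; lra.
  have x1 : 1 <= - x by lra.
  have := mL (- x) (lt_le_trans ltr01 x1); rewrite opprK => mLx.
  have [/andP[q0 q1] q2] := ratio (Phi x) (- x) x1 mLx.
  rewrite phi_opp in q0 q1 q2.
  have fE : f x = (1 - c) * (Phi x / phi x) by rewrite /f QPhi //; ring.
  have f'E : x * f' x = (1 - c) * (- x * (- x * (Phi x / phi x) - 1)).
    by rewrite /f' fE /h ramp_le //; ring.
  rewrite f'E fE; case/andP: c01 => c0 c1.
  have d0 : 0 <= 1 - c by lra.
  have d1 : 1 - c <= 1 by lra.
  by split; rewrite normrM mulr_ile1 // ger0_norm.
have hc1 x : `|h x - c| <= 1.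
  case/andP: c01 => ? ?; case/andP: (h01 x) => ? ?.
  by rewrite ler_norml; apply/andP; split; lra.
have mid1 x : `|x| <= A -> `|f' x| <= A * C + 1.
  move=> xA; rewrite /f' -addrA; apply: le_trans (ler_normD _ _) _.
  rewrite lerD // normrM; apply: ler_pM => //; exact: fC.
have f'b x : `|f' x| <= A * C + 1.
  case: (lerP `|x| A) => [|Ax]; first exact: mid1.
  have [_ q] := tail x Ax.
  apply: (@le_trans _ _ 1); last by rewrite lerDr mulr_ge0 // (le_trans ler01).
  apply: le_trans q; rewrite normrM ler_peMl //; lra.
have fb x : `|f x| <= C + 1.
  case: (lerP `|x| A) => [/fC|Ax]; first by lra.
  by have [q _] := tail x Ax; lra.
have xf'b x : `|x * f' x| <= A * (A * C + 1) + 1.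
  case: (lerP `|x| A) => [xA|Ax].
    rewrite normrM; apply: (@le_trans _ _ (A * (A * C + 1))); last by lra.
    by apply: ler_pM.
  have [_ q] := tail x Ax; apply: le_trans q _; rewrite lerDr !mulr_ge0 //; first by lra.
  by rewrite addr_ge0 // mulr_ge0 //; lra.
pose L := (C + 1) + (A * (A * C + 1) + 1).
have kd t : is_derive t 1 (fun s => s * f s) (f t + t * f' t).
  have := fd t => ?; apply: is_derive_eq; rewrite /GRing.scale /=; ring.
have kL : forall x y, `|y * f y - x * f x| <= L * `|y - x|.
  apply: (lipschitz_from_derive kd) => t.
  by apply: le_trans (ler_normD _ _) _; exact: lerD.
have f'L x y : `|f' y - f' x| <= (L + (b - a)^-1) * `|y - x|.
  have -> : f' y - f' x = (y * f y - x * f x) + (h y - h x) by rewrite /f'; ring.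
  apply: le_trans (ler_normD _ _) _; rewrite mulrDl lerD //.
  exact: ramp_lipschitz.
exists f, f', (A * C + 1), (L + (b - a)^-1), c; split => //.
  exact: taylor_from_lipschitz.
by move=> u; rewrite /f' /h; ring.
Qed.

End SteinSolution.

(** * Minimal spanning trees and minimax paths *)

Section Connectivity.
Variable V : choiceType.
Implicit Types (x y z u v a b : V) (C H T : {fset {fset V}}) (e f : {fset V}).

(** Unlike [fconnected], this asks nothing of the vertices visited; when the edges lie inside [Vs]
    the two agree, see [fconnectedE]. *)
Definition conn C u v := exists s : seq V, path (fadj C) u s /\ last u s = v.

Lemma fset2C x y : [fset x; y] = [fset y; x].
Proof. exact: fsetUC. Qed.

Lemma fset2_inj x y u v : [fset x; y] = [fset u; v] ->
  (x = u /\ y = v) \/ (x = v /\ y = u).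
Proof.
move=> e.
have hx : x \in [fset u; v] by rewrite -e !inE eqxx.
have hy : y \in [fset u; v] by rewrite -e !inE eqxx orbT.
have hu : u \in [fset x; y] by rewrite e !inE eqxx.
have hv : v \in [fset x; y] by rewrite e !inE eqxx orbT.
move: hx hy hu hv; rewrite !inE.
move=> /orP[]/eqP-> /orP[]/eqP-> => [_|_ _|_ _|]; [|by left|by right|].
  by rewrite orbb => /eqP->; left.
by rewrite orbb => /eqP-> _; left.
Qed.

Lemma fadjC C : symmetric (fadj C).
Proof. by move=> x y; rewrite /fadj fset2C. Qed.

Lemma conn_refl C u : conn C u u.
Proof. by exists [::]. Qed.

Lemma conn_edge C u v : fadj C u v -> conn C u v.
Proof. by move=> h; exists [:: v]; rewrite /= h. Qed.

Lemma conn_trans C u v z : conn C u v -> conn C v z -> conn C u z.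
Proof.
move=> [s [ps ls]] [r [pr lr]]; exists (s ++ r).
by rewrite cat_path last_cat ps ls.
Qed.

Lemma conn_sym C u v : conn C u v -> conn C v u.
Proof.
move=> [s [ps ls]]; exists (rev (belast u s)); split.
  by rewrite -ls rev_path (eq_path (e' := fadj C)) // => x y; exact: fadjC.
by case: s ps ls => [|x s] //= _ _; rewrite rev_cons last_rcons.
Qed.

Lemma conn_sub C C' u v : (forall x y, fadj C x y -> conn C' x y) ->
  conn C u v -> conn C' u v.
Proof.
move=> h [s [ps <-]]; elim: s u ps => [|x s IH] u /=; first by move=> _; exact: conn_refl.
by move=> /andP[/h ux /IH]; exact: conn_trans.
Qed.

Lemma connS C C' u v : C `<=` C' -> conn C u v -> conn C' u v.
Proof.
move=> /fsubsetP CC'; apply: conn_sub => x y h; apply: conn_edge; exact: CC'.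
Qed.

Lemma path_del C f y u s : path (fadj C) u s -> y \in f -> y \notin u :: s ->
  path (fadj (C `\ f)) u s.
Proof.
move=> + yf; elim: s u => [//|x s IH] u /= /andP[ux ps].
rewrite !inE !negb_or => /and3P[yu yx ys].
rewrite IH // ?andbT; last by rewrite inE negb_or yx.
rewrite /fadj in ux *; rewrite !inE ux andbT.
apply: contraTneq yf => <-; rewrite !inE negb_or yu yx //.
Qed.

Lemma path_first_exit (Q : V -> Prop) (r : rel V) u s :
  path r u s -> Q u -> ~ Q (last u s) -> exists x y, [/\ r x y, Q x & ~ Q y].
Proof.
elim: s u => [//|x s IH] u /= /andP[ux ps] Qu nQ.
have [Qx|nQx] := pselect (Q x); first exact: (IH x).
by exists u, x.
Qed.

(** Each time the path crosses uv it can be restarted at the endpoint reached, so only the last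
    crossing counts. *)
Lemma conn_del C u v a z : conn C a z ->
  [\/ conn (C `\ [fset u; v]) a z, conn (C `\ [fset u; v]) u z |
      conn (C `\ [fset u; v]) v z].
Proof.
move=> [s [ps <-]]; elim/last_ind: s ps => [|s x IH]; first by move=> _; apply: Or31; exact: conn_refl.
rewrite rcons_path last_rcons => /andP[/IH h sx].
have [e|ne] := eqVneq [fset last a s; x] [fset u; v].
  have [[_ ->]|[_ ->]] := fset2_inj e; [apply: Or33|apply: Or32]; exact: conn_refl.
have hx : conn (C `\ [fset u; v]) (last a s) x.
  by apply: conn_edge; rewrite /fadj !inE ne.
by case: h => h; [apply: Or31|apply: Or32|apply: Or33]; exact: conn_trans hx.
Qed.

Definition connected_on (Vs : {fset V}) C := forall u v, u \in Vs -> v \in Vs -> conn C u v.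

(** Cut property. If deleting uv separates [u] from [v], every vertex of [Vs] stays connected to one
    of them, and a path of [P] from [u] to [v] must leave the component of [u]; the edge by which it
    does so reconnects the two sides. *)
Lemma exchange_add Vs C P u v : connected_on Vs C -> u \in Vs ->
  (forall f, f \in P -> f `<=` Vs) -> conn P u v ->
  conn (C `\ [fset u; v]) u v \/
  exists2 f, f \in P & conn (f |` (C `\ [fset u; v])) u v.
Proof.
move=> cC uV PV [s [ps ls]].
have [h|nh] := pselect (conn (C `\ [fset u; v]) u v); [by left|right].
have [||x [y [Pxy ux uy]]] := @path_first_exit (conn (C `\ [fset u; v]) u) _ _ _ ps.
- exact: conn_refl.
- by rewrite ls.
exists [fset x; y] => //.
have yV : y \in Vs by apply: (fsubsetP (PV _ Pxy)); rewrite !inE eqxx orbT.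
have CD : C `\ [fset u; v] `<=` [fset x; y] |` (C `\ [fset u; v]) by exact: fsubsetU1.
have vy : conn (C `\ [fset u; v]) v y.
  by have [//|//|//] := @conn_del C u v u y (cC _ _ uV yV).
apply: conn_trans (connS CD ux) _; apply: conn_trans _ (connS CD (conn_sym vy)).
by apply: conn_edge; rewrite /fadj !inE eqxx.
Qed.

Lemma connected_exchange Vs C D u v : connected_on Vs C ->
  C `\ [fset u; v] `<=` D -> conn D u v -> connected_on Vs D.
Proof.
move=> cC CD uv a b aV bV; apply: conn_sub (cC a b aV bV) => x y h.
have [e|ne] := eqVneq [fset x; y] [fset u; v].
  by have [[-> ->]|[-> ->]] := fset2_inj e => //; exact: conn_sym.
by apply: conn_edge; apply: (fsubsetP CD); rewrite !inE ne.
Qed.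

(** A path of [T] from [u] to [v] cannot lie in [P]. It is taken without repeated vertices, so that
    deleting its edge xy outside [P] leaves the two remaining pieces intact, and uv closes the
    gap. *)
Lemma exchange_del Vs T P u v : connected_on Vs T -> u \in Vs -> v \in Vs ->
  ~ conn P u v ->
  exists2 f, f \in T & f \notin P /\ connected_on Vs ([fset u; v] |` (T `\ f)).
Proof.
move=> cT uV vV nP.
have [s [ps ls]] := cT u v uV vV.
case: (shortenP ps) ls => {ps}s ps us _ ls.
have [p1 [y [p2 [es xyP]]]] : exists p1 y p2, s = p1 ++ y :: p2 /\ ~~ fadj P (last u p1) y.
  have : ~~ path (fadj P) u s by apply/negP => h; apply: nP; exists s.
  elim: s (u) {ps us ls} => [//|x s IH] z /=.
  rewrite negb_and => /orP[h|/IH[p1 [y [p2 [-> h]]]]]; first by exists [::], x, s.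
  by exists (x :: p1), y, p2.
move: ps us ls; rewrite es cat_path last_cat /= => /and3P[ps1 xy ps2] us ls.
set x := last u p1 in xy xyP.
exists [fset x; y] => //; split => //.
have us' : uniq ((u :: p1) ++ (y :: p2)) by [].
have dis z : z \in u :: p1 -> z \notin y :: p2.
  move: us'; rewrite cat_uniq => /and3P[_ /hasPn h _] zin.
  by apply/negP => /h; rewrite /= zin.
have c1 : conn (T `\ [fset x; y]) u x.
  exists p1; split => //; apply: (@path_del _ _ y) => //; first by rewrite !inE eqxx orbT.
  by apply/negP => /dis; rewrite inE eqxx.
have c2 : conn (T `\ [fset x; y]) y v.
  exists p2; split => //; apply: (@path_del _ _ x) => //; first by rewrite !inE eqxx.
  by apply: dis; rewrite /x mem_last.
have TD := fsubsetU1 [fset u; v] (T `\ [fset x; y]).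
apply: (connected_exchange cT TD).
apply: conn_trans (conn_sym (connS TD c1)) _.
apply: conn_trans _ (conn_sym (connS TD c2)).
by apply: conn_edge; rewrite /fadj !inE eqxx.
Qed.

Lemma has_cycle_del Vs C : connected_on Vs C -> has_cycle C ->
  exists2 f, f \in C & connected_on Vs (C `\ f).
Proof.
move=> cC [[|x [|y [|z r]]] [//= _ [us cs]]].
move: cs => /= /and3P[xy yz zr].
exists [fset x; y] => //; apply: connected_exchange cC _ _; first exact: fsubset_refl.
apply: conn_sym; exists (z :: rcons r x); split; last by rewrite /= last_rcons.
move: us => /=; rewrite !inE !negb_or => /andP[/and3P[nxy nxz xr] /andP[/andP[nyz yr] /andP[zr' ur]]].
apply/andP; split.
  rewrite /fadj in yz *; rewrite !inE yz andbT.
  apply/eqP => e; have : z \in [fset x; y] by rewrite -e !inE eqxx orbT.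
  by rewrite !inE eq_sym (negPf nxz) eq_sym (negPf nyz).
apply: (@path_del _ _ y) => //; first by rewrite !inE eqxx orbT.
by rewrite inE mem_rcons inE !negb_or nyz eq_sym nxy.
Qed.

Lemma path_in_Vs Vs Es u s : (forall f, f \in Es -> f `<=` Vs) ->
  path (fadj Es) u s -> all (mem Vs) s.
Proof.
move=> EV; elim: s u => [//|x s IH] u /= /andP[ux /IH->]; rewrite andbT.
by apply: (fsubsetP (EV _ ux)); rewrite !inE eqxx orbT.
Qed.

Lemma fconnectedE Vs Es : (forall f, f \in Es -> f `<=` Vs) ->
  fconnected Vs Es <-> connected_on Vs Es.
Proof.
move=> EV; split=> h u v uV vV.
  by have [s [ps [ls _]]] := h u v uV vV; exists s.
have [s [ps ls]] := h u v uV vV; exists s; split => //; split => //.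
exact: path_in_Vs ps.
Qed.

(** As long as there is a cycle, one of its edges can be deleted without losing connectedness; the
    induction is on the number of edges. *)
Lemma connected_spanning_tree Vs Es C : (forall f, f \in Es -> f `<=` Vs) ->
  C `<=` Es -> connected_on Vs C ->
  exists2 T, spanning_tree Vs Es T & T `<=` C.
Proof.
move=> EV; move: {2}(#|` C|) (leqnn #|` C|) => n.
elim: n C => [|n IH] C Cn CE cC.
all: have [hc|nc] := pselect (has_cycle C).
- have [f fC _] := has_cycle_del cC hc.
  by move: Cn; rewrite leqn0 cardfs_eq0 => /eqP C0; rewrite C0 inE in fC.
- exists C => //; split => //; split => //; apply/fconnectedE => // f fC.
  exact: EV (fsubsetP CE _ fC).
- have [f fC cCf] := has_cycle_del cC hc.
  have [||//|T hT TC] := IH (C `\ f).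
  + by move: Cn; rewrite (cardfsD1 f) fC.
  + exact: fsubset_trans (fsubD1set _ _) CE.
  + by exists T => //; exact: fsubset_trans TC (fsubD1set _ _).
- exists C => //; split => //; split => //; apply/fconnectedE => // f fC.
  exact: EV (fsubsetP CE _ fC).
Qed.

End Connectivity.

Section MST.
Variables (V : choiceType) (R : realType).
Implicit Types (u v : V) (H T : {fset {fset V}}) (w : {fset V} -> R).

Definition light H u v w (t : R) : {fset {fset V}} :=
  [fset f in H | (f != [fset u; v]) && (w f <= t)].

(* The infimum is min(w_uv, m) with m the minimax weight of the paths from u to v
   avoiding uv; putting w_uv into the set covers the case where uv is a bridge. *)
Definition minimax_set H u v w : set R :=
  [set t | t = w [fset u; v] \/ (0 <= t /\ conn (light H u v w t) u v)].
Definition minimax H u v w : R := inf (minimax_set H u v w).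

Section minimax_basic.
Variables (u v : V) (w : {fset V} -> R).
Hypothesis we0 : 0 <= w [fset u; v].

Lemma minimax_set_lb H : lbound (minimax_set H u v w) 0.
Proof. by move=> t [->|[]]. Qed.

Lemma minimax_le H t : minimax_set H u v w t -> minimax H u v w <= t.
Proof. by apply: ge_inf; exists 0; exact: minimax_set_lb. Qed.

Lemma le_minimax H t : lbound (minimax_set H u v w) t -> t <= minimax H u v w.
Proof. by apply: lb_le_inf; exists (w [fset u; v]); left. Qed.

Lemma minimax_ge0 H : 0 <= minimax H u v w.
Proof. apply: le_minimax; exact: minimax_set_lb. Qed.

Lemma minimax_le_w H : minimax H u v w <= w [fset u; v].
Proof. by apply: minimax_le; left. Qed.

End minimax_basic.

Lemma minimax_antimono H H' u v w : 0 <= w [fset u; v] -> H `<=` H' ->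
  minimax H' u v w <= minimax H u v w.
Proof.
move=> we0 /fsubsetP HH'; apply: le_minimax => t [->|[t0 c]].
  exact: minimax_le_w.
apply: minimax_le => //; right; split => //; apply: connS c.
by apply/fsubsetP => f; rewrite !inE /= => /andP[/HH' -> ->].
Qed.

Lemma minimax_mono H u v w w' : 0 <= w [fset u; v] -> w [fset u; v] <= w' [fset u; v] ->
  (forall f, f \in H -> w f <= w' f) ->
  minimax H u v w <= minimax H u v w'.
Proof.
move=> we0 we Hw; apply: le_minimax => t [->|[t0 c]].
  by apply: le_trans we; exact: minimax_le_w.
apply: minimax_le => //; right; split => //; apply: connS c.
apply/fsubsetP => f; rewrite !inE /= => /and3P[fH -> ft].
by rewrite fH (le_trans (Hw _ fH) ft).
Qed.

Lemma minimax_local H u v w w' : 0 <= w [fset u; v] -> w [fset u; v] = w' [fset u; v] ->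
  (forall f, f \in H -> w f = w' f) ->
  minimax H u v w = minimax H u v w'.
Proof.
move=> we0 we Hw; apply/le_anti/andP; split; apply: minimax_mono.
all: rewrite -?we ?lexx //.
all: by move=> f /Hw ->.
Qed.

(** If a level [t] below [g (minimax H u v w)] were attainable for [g \o w], the edges light at that
    level would, by monotonicity, have weights strictly below the minimax, and so would their
    maximum, as they are finitely many. The argument rests on finiteness and not on continuity
    because [g] will be the rounding, a step function. *)
Lemma minimax_comp (g : R -> R) H u v w : {homo g : x y / x <= y} -> g 0 = 0 ->
  0 <= w [fset u; v] ->
  g (minimax H u v w) <= minimax H u v (g \o w).
Proof.
move=> gm g0 we0; apply: le_minimax => t [->|[t0 c]] /=.
  by apply: gm; exact: minimax_le_w.
rewrite leNgt; apply/negP => tg.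
have D0 : 0 < minimax H u v w.
  rewrite lt_neqAle minimax_ge0 // andbT; apply/eqP => e.
  by move: tg; rewrite -e g0 ltNge t0.
pose L := light H u v (g \o w) t.
pose s := \big[Num.max/0]_(f <- L) w f.
have sD : s < minimax H u v w.
  rewrite /s big_seq; elim/big_ind: _ => //; first by move=> x y; rewrite gt_max => -> ->.
  move=> f; rewrite !inE => /and3P[_ _ /= ft]; rewrite ltNge; apply/negP => /gm.
  by rewrite leNgt (le_lt_trans ft tg).
suff : minimax H u v w <= s by rewrite leNgt sD.
apply: minimax_le => //; right; split; first exact: bigmax_ge_id.
apply: connS c; apply/fsubsetP => f fL; move: (fL); rewrite !inE => /and3P[-> -> _] /=.
exact: le_bigmax_seq.
Qed.

Section spanning.
Variables (Vs : {fset V}) (Es : {fset {fset V}}).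
Hypothesis EV : forall f, f \in Es -> f `<=` Vs.
Hypothesis cE : connected_on Vs Es.

(** The infimum runs over finitely many subsets of [Es], at least one of which is a spanning tree,
    so it is a minimum. *)
Lemma mst_attained w : exists2 T, spanning_tree Vs Es T &
  mst_weight w Vs Es = \sum_(f <- T) w f /\
  forall T', spanning_tree Vs Es T' -> mst_weight w Vs Es <= \sum_(f <- T') w f.
Proof.
have [T0 sT0 _] := connected_spanning_tree EV (fsubset_refl Es) cE.
have pE T : spanning_tree Vs Es T -> T \in fpowerset Es by case=> h _; rewrite fpowersetE.
pose F (i : fpowerset Es) := \sum_(f <- val i) w f.
pose P (i : fpowerset Es) := `[< spanning_tree Vs Es (val i) >].
have Pi0 : P [` pE _ sT0] by apply/asboolP.
case: (@Order.TotalTheory.arg_minP _ R _ [` pE _ sT0] P F Pi0) => i /asboolP Pi Fi.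
have least T' : spanning_tree Vs Es T' -> F i <= \sum_(f <- T') w f.
  by move=> sT'; apply: (Fi [` pE _ sT']); apply/asboolP.
have e : mst_weight w Vs Es = F i.
  apply/le_anti/andP; split.
    apply: ge_inf; last by exists (val i).
    by exists (F i) => _ [T [sT ->]]; exact: least.
  apply: lb_le_inf; first by exists (F i), (val i).
  by move=> _ [T [sT ->]]; exact: least.
by exists (val i) => //; split => // T' /least; rewrite e.
Qed.

Lemma mst_le w T : spanning_tree Vs Es T -> mst_weight w Vs Es <= \sum_(f <- T) w f.
Proof. by have [_ _ [_]] := mst_attained w; apply. Qed.

Lemma ler_sum_fsub (g : {fset V} -> R) (A B : {fset {fset V}}) : A `<=` B ->
  (forall f, f \in B -> 0 <= g f) -> \sum_(f <- A) g f <= \sum_(f <- B) g f.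
Proof.
move=> AB g0; rewrite (big_fsetID _ (mem A) B) /=.
have -> : [fset x in B | x \in A] = A.
  by apply/fsetP => f; rewrite !inE /=; case fA: (f \in A); rewrite ?andbF // (fsubsetP AB _ fA).
rewrite lerDl big_seq; apply: sumr_ge0 => f; rewrite !inE /= => /andP[fB _]; exact: g0.
Qed.

(** Lets the exchange arguments produce edge sets that are merely connected: acyclicity after an
    exchange never has to be checked. *)
Lemma mst_le_connected w C : (forall f, f \in Es -> 0 <= w f) -> C `<=` Es ->
  connected_on Vs C -> mst_weight w Vs Es <= \sum_(f <- C) w f.
Proof.
move=> w0 CE cC; have [T sT TC] := connected_spanning_tree EV CE cC.
apply: le_trans (mst_le w sT) _; apply: ler_sum_fsub => // f /(fsubsetP CE); exact: w0.
Qed.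

Lemma mst_lipschitz w w' :
  `|mst_weight w Vs Es - mst_weight w' Vs Es| <= \sum_(f <- Es) `|w f - w' f|.
Proof.
wlog h : w w' / mst_weight w' Vs Es <= mst_weight w Vs Es => [hw|].
  case/orP: (le_total (mst_weight w' Vs Es) (mst_weight w Vs Es)) => h; first exact: hw.
  rewrite distrC; under eq_bigr do rewrite distrC; exact: hw.
rewrite ger0_norm ?subr_ge0 //.
have [T sT [-> _]] := mst_attained w'.
apply: (@le_trans _ _ (\sum_(f <- T) w f - \sum_(f <- T) w' f)).
  by rewrite lerD2r mst_le.
rewrite -sumrB; apply: le_trans (ler_norm _) _; apply: le_trans (ler_norm_sum _ _ _) _.
by apply: ler_sum_fsub => //; case: sT.
Qed.

Definition zero_at (e : {fset V}) w : {fset V} -> R := fun f => if f == e then 0 else w f.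

Lemma sum_zero_at e w (T : {fset {fset V}}) :
  \sum_(f <- T) zero_at e w f = \sum_(f <- T `\ e) w f.
Proof.
have [eT|eT] := boolP (e \in T).
  rewrite (big_fsetD1 e) //= /zero_at eqxx add0r big_seq [RHS]big_seq.
  by apply: eq_bigr => f; rewrite !inE => /andP[/negPf ->].
have -> : T `\ e = T by apply/eqP; rewrite mem_fsetD1.
rewrite big_seq [RHS]big_seq.
by apply: eq_bigr => f fT; rewrite /zero_at; case: eqP fT => // ->; rewrite (negPf eT).
Qed.

(** Two exchanges, with e = uv. In an optimal tree for the weights zeroed at e, the edge e can be
    replaced by one of weight at most [t] as soon as [t] is attainable. Conversely, if M - M0 were
    below the minimax, the edges of weight at most M - M0 would not connect [u] to [v]; an optimal
    tree for [w] that avoids e then has a heavier edge on its path from [u] to [v], and trading it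
    for e, now free, would beat M0. *)
Lemma mst_minimax u v w : (forall f, f \in Es -> 0 <= w f) -> [fset u; v] \in Es ->
  mst_weight w Vs Es - mst_weight (zero_at [fset u; v] w) Vs Es = minimax Es u v w.
Proof.
move=> w0 eE; set e := [fset u; v]; set M := mst_weight w Vs Es; set M0 := mst_weight _ Vs Es.
have we0 : 0 <= w e by exact: w0.
have uV : u \in Vs by apply: (fsubsetP (EV eE)); rewrite !inE eqxx.
have vV : v \in Vs by apply: (fsubsetP (EV eE)); rewrite !inE eqxx orbT.
have z0 f : f \in Es -> 0 <= zero_at e w f by rewrite /zero_at; case: ifP => // _; exact: w0.
have M0M : M0 <= M.
  rewrite /M; have [T sT [-> _]] := mst_attained w.
  apply: le_trans (mst_le _ sT) _; rewrite sum_zero_at.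
  apply: ler_sum_fsub; first exact: fsubD1set.
  by move=> f fT; apply: w0; case: sT => /fsubsetP TE _; exact: TE.
have Tw (T : {fset {fset V}}) : e \in T -> \sum_(f <- T) w f = w e + \sum_(f <- T) zero_at e w f.
  by move=> eT; rewrite sum_zero_at (big_fsetD1 e).
have Tw' (T : {fset {fset V}}) : e \notin T -> \sum_(f <- T) w f = \sum_(f <- T) zero_at e w f.
  by move=> eT; rewrite sum_zero_at; have /eqP -> : T `\ e == T by rewrite mem_fsetD1.
apply/le_anti/andP; split.
  apply: le_minimax => t ht; rewrite lerBlDr.
  have [T sT [eM0 _]] := mst_attained (zero_at e w); rewrite /M0 eM0.
  have cT : connected_on Vs T.
    by case: sT => TE [fc _]; apply/fconnectedE => // f /(fsubsetP TE); exact: EV.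
  have TE : T `<=` Es by case: sT.
  have t0 : 0 <= t by case: ht => [->|[]].
  have [eT|eT] := boolP (e \in T); last first.
    by apply: le_trans (mst_le _ sT) _; rewrite Tw' // lerDr.
  case: ht => [->|[_ c]].
    by apply: le_trans (mst_le _ sT) _; rewrite Tw.
  have LV f : f \in light Es u v w t -> f `<=` Vs.
    by rewrite !inE => /andP[fE _]; exact: EV.
  have TeE : T `\ e `<=` Es by exact: fsubset_trans (fsubD1set _ _) TE.
  have [c'|[f fL c']] := exchange_add cT uV LV c.
    apply: le_trans (mst_le_connected w0 TeE _) _.
      by apply: connected_exchange cT _ c'; exact: fsubset_refl.
    by rewrite sum_zero_at lerDr.
  move: fL; rewrite !inE => /and3P[fE fe /= ft].
  have DE : f |` (T `\ e) `<=` Es.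
    by apply/fsubsetP => g; rewrite !inE => /orP[/eqP ->//|/andP[_ /(fsubsetP TE)]].
  apply: le_trans (mst_le_connected w0 DE _) _.
    by apply: connected_exchange cT _ c'; exact: fsubsetU1.
  have [fT|fT] := boolP (f \in T `\ e).
    have -> : f |` (T `\ e) = T `\ e.
      by apply/fsetP => g; rewrite !inE; case: eqP => // ->; move: fT; rewrite !inE => ->.
    by rewrite sum_zero_at lerDr.
  by rewrite big_fsetU1 //= sum_zero_at lerD2r.
rewrite leNgt; apply/negP => lt.
have nc : ~ conn (light Es u v w (M - M0)) u v.
  move=> c; move: lt; rewrite ltNge => /negP; apply.
  by apply: minimax_le => //; right; rewrite subr_ge0.
have [T sT [eM _]] := mst_attained w.
have TE : T `<=` Es by case: sT.
have cT : connected_on Vs T.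
  by case: sT => _ [fc _]; apply/fconnectedE => // f /(fsubsetP TE); exact: EV.
(* A tree containing e becomes cheaper by [w e] when e is made free, so M - M0 would be at least
   [w e], which bounds the minimax. *)
have [eT|eT] := boolP (e \in T).
  have : M - M0 >= w e.
    rewrite lerBrDr addrC -lerBrDr /M eM Tw // addrC addKr.
    exact: mst_le.
  by rewrite leNgt (lt_le_trans lt) //; exact: minimax_le_w.
have [f fT [fL cD]] := exchange_del cT uV vV nc.
have fE : f \in Es by exact: (fsubsetP TE).
have fe : f != e by apply: contraNneq eT => <-.
move: fL; rewrite !inE fE fe /= -ltNge => fM.
have DE : e |` (T `\ f) `<=` Es.
  by apply/fsubsetP => g; rewrite !inE => /orP[/eqP ->//|/andP[_ /(fsubsetP TE)]].
have := mst_le_connected z0 DE cD.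
rewrite sum_zero_at.
have -> : (e |` (T `\ f)) `\ e = T `\ f.
  apply/fsetP => g; rewrite !inE; case: eqP => //= ->.
  by rewrite (negPf eT) andbF.
move: eM; rewrite -/M -/M0 (big_fsetD1 f) //= => eM.
by move: fM; rewrite eM; lra.
Qed.

End spanning.
End MST.

(** * Balls and automorphisms *)

Section Balls.
Variables (V : choiceType) (adj : rel V).
Hypothesis adj_simple : simple_graph adj.
Hypothesis adj_lf : locally_finite adj.
Implicit Types (x y u v : V) (k : nat).

Definition nbr v : {fset V} := fset_set [set u | adj v u].

Lemma in_nbr v u : (u \in nbr v) = adj v u.
Proof. by rewrite in_fset_set //; apply/idP/idP; rewrite inE. Qed.

Fixpoint gball v k : {fset V} :=
  if k is k'.+1 then gball v k' `|` \bigcup_(x <- gball v k') nbr x else [fset v].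

Lemma walk_rcons v x y k : walk adj v x k -> adj x y -> walk adj v y k.+1.
Proof.
move=> [s [<- [ps <-]]] xy; exists (rcons s y).
by rewrite size_rcons rcons_path last_rcons ps.
Qed.

Lemma gballP v k u : reflect (exists2 j, (j <= k)%N & walk adj v u j) (u \in gball v k).
Proof.
elim: k u => [|k IH] u /=.
  apply: (iffP idP); first by rewrite inE => /eqP ->; exists 0%N => //; exists [::].
  by move=> [j]; rewrite leqn0 => /eqP -> [s [/eqP]]; rewrite size_eq0 => /eqP -> [_ <-]; rewrite inE.
apply: (iffP idP).
  rewrite inE => /orP[/IH[j jk h]|/bigfcupP[x /andP[/IH[j jk h] _]]].
    by exists j => //; exact: leqW.
  by rewrite in_nbr => xu; exists j.+1 => //; exact: walk_rcons h xu.
move=> [j]; rewrite leq_eqVlt => /orP[/eqP ->|jk h]; last by rewrite inE; apply/orP; left; apply/IH; exists j.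
move=> [s [sk [ps ls]]]; case/lastP: s sk ps ls => [//|s y].
rewrite size_rcons rcons_path last_rcons => -[sk] /andP[ps sy] <-.
rewrite inE; apply/orP; right; apply/bigfcupP; exists (last v s); last by rewrite in_nbr.
by rewrite andbT; apply/IH; exists k => //; exists s.
Qed.

Lemma gball_refl v k : v \in gball v k.
Proof. by apply/gballP; exists 0%N => //; exists [::]. Qed.

Lemma gball_sym v k u : u \in gball v k -> v \in gball u k.
Proof.
move=> /gballP[j jk [s [sj [ps ls]]]]; apply/gballP; exists j => //.
exists (rev (belast v s)); rewrite size_rev size_belast; split => //; split.
  rewrite -ls rev_path (eq_path (e' := adj)) // => x y; exact: adj_simple.1.
by case: s {sj ps} ls => [|x s] //= _; rewrite rev_cons last_rcons.
Qed.

Lemma gball_trans v j k u x : u \in gball v j -> x \in gball u k -> x \in gball v (j + k).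
Proof.
move=> /gballP[a aj [s [sa [ps ls]]]] /gballP[b bk [r [rb [pr lr]]]].
apply/gballP; exists (a + b)%N; first exact: leq_add.
by exists (s ++ r); rewrite size_cat sa rb cat_path last_cat ps ls.
Qed.

Lemma gball_mono v j k : (j <= k)%N -> gball v j `<=` gball v k.
Proof.
move=> jk; apply/fsubsetP => x /gballP[i ij h]; apply/gballP; exists i => //.
exact: leq_trans jk.
Qed.

Lemma gball_step v k x y : x \in gball v k -> adj x y -> y \in gball v k.+1.
Proof.
move=> /gballP[j jk h] xy; apply/gballP; exists j.+1 => //; exact: walk_rcons h xy.
Qed.

Lemma gball_in_ball (R : realType) v k u : u \in gball v k -> in_ball adj v (k%:R : R) u.
Proof. by move=> /gballP[j jk h]; exists j; split => //; rewrite ler_nat. Qed.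

Definition gballE v k : {fset {fset V}} :=
  \bigcup_(x <- gball v k) [fset [fset x; y] | y in nbr x & y \in gball v k].

Lemma gballEP v k f : reflect
  (exists x y, [/\ x \in gball v k, y \in gball v k, adj x y & f = [fset x; y]])
  (f \in gballE v k).
Proof.
apply: (iffP idP).
  move=> /bigfcupP[x /andP[xb _] /imfsetP[y /=]]; rewrite inE /= in_nbr => /andP[xy yb] ->.
  by exists x, y.
move=> [x [y [xb yb xy ->]]]; apply/bigfcupP; exists x; first by rewrite xb.
by apply/imfsetP; exists y; rewrite //= inE in_nbr xy.
Qed.

Lemma gballE_mono v j k : (j <= k)%N -> gballE v j `<=` gballE v k.
Proof.
move=> jk; apply/fsubsetP => f /gballEP[x [y [xb yb xy ->]]]; apply/gballEP.
by exists x, y; split => //; apply: (fsubsetP (gball_mono v jk)).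
Qed.

Lemma gballE_self u v k : adj u v -> [fset u; v] \in gballE u k.+1.
Proof.
move=> uv; apply/gballEP; exists u, v; split => //; first exact: gball_refl.
by apply: gball_step uv; exact: gball_refl.
Qed.

Lemma gballE_edge v k f : f \in gballE v k -> is_edge adj f.
Proof. by move=> /gballEP[x [y [_ _ xy ->]]]; exists x, y. Qed.

Lemma gballE_exhaust v (H : {fset {fset V}}) : connected_graph adj ->
  (forall f, f \in H -> is_edge adj f) -> exists k, H `<=` gballE v k.
Proof.
move=> cG HE; suff h (s : seq {fset V}) : (forall f, f \in s -> is_edge adj f) ->
    exists k, forall f, f \in s -> f \in gballE v k.
  by have [k hk] := h H HE; exists k; apply/fsubsetP.
elim: s {HE} => [|f s IH] HE; first by exists 0%N.
have [|k hk] := IH; first by move=> g gs; apply: HE; rewrite inE gs orbT.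
have [x [y [xy fE]]] := HE f (mem_head _ _).
have [j vx] := cG v x.
have xb : x \in gball v j by apply/gballP; exists j.
exists (maxn k j.+1) => g; rewrite inE => /orP[/eqP ->|/hk]; last first.
  apply: (fsubsetP (gballE_mono v _)); exact: leq_maxl.
apply: (fsubsetP (gballE_mono v (leq_maxr k j.+1))); apply/gballEP; exists x, y; split => //.
  by apply: (fsubsetP (gball_mono v (leqnSn j))).
exact: gball_step xy.
Qed.

Lemma card_bigfcup (K W : choiceType) (s : seq W) (F : W -> {fset K}) (D : nat) :
  (forall x : W, x \in s -> #|` F x| <= D)%N -> (#|` \bigcup_(x <- s) F x| <= size s * D)%N.
Proof.
elim: s => [|x s IH] h; first by rewrite big_nil cardfs0.
rewrite big_cons cardfsU; apply: leq_trans (leq_subr _ _) _.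
rewrite mulSn leq_add ?h ?mem_head //; apply: IH => y ys; apply: h.
by rewrite inE ys orbT.
Qed.

Variable D : nat.
Hypothesis degD : forall v, (#|` nbr v| <= D)%N.

Lemma card_gball v k : (#|` gball v k| <= D.+1 ^ k)%N.
Proof.
elim: k => [|k IH]; first by rewrite /= cardfs1.
apply: (@leq_trans (#|` gball v k| * D.+1)); last by rewrite expnSr leq_mul2r IH orbT.
rewrite /= cardfsU; apply: leq_trans (leq_subr _ _) _; rewrite mulnS leq_add2l.
by apply: card_bigfcup => x _; exact: degD.
Qed.

Lemma card_edges_le (Vs : {fset V}) (Es : {fset {fset V}}) :
  (forall f, f \in Es -> exists x y, [/\ x \in Vs, adj x y & f = [fset x; y]]) ->
  (#|` Es| <= #|` Vs| * D)%N.
Proof.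
move=> h; apply: (@leq_trans #|` \bigcup_(x <- Vs) [fset [fset x; y] | y in nbr x]|).
  apply: fsubset_leq_card; apply/fsubsetP => f /h[x [y [xV xy ->]]].
  apply/bigfcupP; exists x; first by rewrite xV.
  by apply/imfsetP; exists y; rewrite //= in_nbr.
apply: card_bigfcup => x _; apply: leq_trans (leq_imfset_card _ _ _) _.
exact: degD.
Qed.

(** Once there are two vertices, connectedness excludes isolated ones, so the edges cover [Vs], each
    covering at most two vertices. *)
Lemma card_edges_ge (Vs : {fset V}) (Es : {fset {fset V}}) :
  subgraph_of adj Vs Es -> connected_on Vs Es -> (2 <= #|` Vs|)%N ->
  (#|` Vs| <= #|` Es| * 2)%N.
Proof.
move=> sG cE V2; apply: (@leq_trans #|` \bigcup_(f <- Es) f|).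
  apply: fsubset_leq_card; apply/fsubsetP => x xV.
  have [y [yV yx]] : exists y, y \in Vs /\ y != x.
    have : (0 < #|` Vs `\ x|)%N by move: V2; rewrite (cardfsD1 x) xV.
    by rewrite cardfs_gt0 => /fset0Pn[y]; rewrite !inE => /andP[yx yV]; exists y.
  have [[|z s] [ps ls]] := cE x y xV yV; first by rewrite -ls eqxx in yx.
  move: ps => /= /andP[xz _]; apply/bigfcupP; exists [fset x; z].
    by rewrite andbT.
  by rewrite !inE eqxx.
by apply: card_bigfcup => f /sG[[x [y [_ ->]]] _]; rewrite cardfs2; case: (_ != _).
Qed.

End Balls.

Section Automorphisms.
Variables (V : choiceType) (adj : rel V).
Hypothesis adj_lf : locally_finite adj.
Implicit Types (x y u v : V) (k : nat).

Definition edge_map (phi : V -> V) (f : {fset V}) : {fset V} := [fset phi x | x in f].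

Lemma edge_map2 phi u v : edge_map phi [fset u; v] = [fset phi u; phi v].
Proof.
apply/fsetP => x; rewrite !inE; apply/imfsetP/orP => [[y /=]|].
  by rewrite !inE => /orP[]/eqP -> ->; rewrite eqxx; [left|right].
by case=> /eqP ->; [exists u|exists v]; rewrite //= !inE eqxx ?orbT.
Qed.

Lemma automorphism_inv phi : automorphism adj phi ->
  exists psi, [/\ automorphism adj psi, cancel phi psi & cancel psi phi].
Proof.
move=> [[psi pK qK] h]; exists psi; split => //; split; first by exists phi.
by move=> x y; rewrite -h !qK.
Qed.

Lemma automorphism_gball phi u k x : automorphism adj phi ->
  x \in gball adj u k -> phi x \in gball adj (phi u) k.
Proof.
move=> [_ h] /(gballP adj_lf)[j jk [s [sj [ps ls]]]]; apply/(gballP adj_lf); exists j => //.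
exists (map phi s); rewrite size_map; split => //; rewrite last_map ls; split => //.
by rewrite path_map (eq_path (e' := adj)) // => a b /=; rewrite h.
Qed.

Lemma automorphism_gballE phi u k f : automorphism adj phi ->
  f \in gballE adj u k -> edge_map phi f \in gballE adj (phi u) k.
Proof.
move=> aphi /(gballEP adj_lf)[x [y [xb yb xy ->]]]; apply/(gballEP adj_lf).
exists (phi x), (phi y); rewrite edge_map2 aphi.2; split => //; exact: automorphism_gball.
Qed.

Lemma minimax_automorphism_le (R : realType) (w : {fset V} -> R) phi u v k :
  automorphism adj phi -> 0 <= w [fset phi u; phi v] ->
  minimax (gballE adj (phi u) k) (phi u) (phi v) w <=
  minimax (gballE adj u k) u v (w \o edge_map phi).
Proof.
move=> aphi w0; have inj : injective phi by apply: bij_inj; exact: aphi.1.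
apply: le_minimax => t [->|[t0 [s [ps ls]]]] /=.
  by rewrite edge_map2; exact: minimax_le_w.
apply: minimax_le => //; right; split => //.
exists (map phi s); rewrite last_map ls; split => //; rewrite path_map.
apply: sub_path ps => x y; rewrite /fadj /= !inE /= edge_map2 => /and3P[xyb ne wt].
apply/and3P; split => //; first by rewrite -edge_map2; exact: automorphism_gballE.
apply: contra ne => /eqP /fset2_inj[[/inj -> /inj ->]//|[/inj -> /inj ->]].
by rewrite fset2C.
Qed.

(** The reverse inequality is the one already proved, applied to the inverse automorphism. *)
Lemma minimax_automorphism (R : realType) (w : {fset V} -> R) phi u v k :
  automorphism adj phi -> 0 <= w [fset phi u; phi v] ->
  minimax (gballE adj (phi u) k) (phi u) (phi v) w =
  minimax (gballE adj u k) u v (w \o edge_map phi).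
Proof.
move=> aphi w0; apply/le_anti/andP; split; first exact: minimax_automorphism_le.
have [psi [apsi pK qK]] := automorphism_inv aphi.
have := @minimax_automorphism_le R (w \o edge_map phi) psi (phi u) (phi v) k apsi.
rewrite /= !pK edge_map2 => /(_ w0) h; apply: le_trans h _.
suff -> : (w \o edge_map phi) \o edge_map psi = w by [].
apply/funext => f /=; congr w; rewrite /edge_map -imfset_comp /=.
by apply/fsetP => x; apply/imfsetP/idP => [[y yf ->]|xf]; [rewrite /= qK|exists x => //=; rewrite qK].
Qed.

Lemma bounded_degree : vertex_transitive adj ->
  exists D, forall v, (#|` nbr adj v| <= D)%N.
Proof.
move=> vt; have [[v0 _]|nV] := pselect (exists v : V, True); last first.
  by exists 0%N => v; case: nV; exists v.
exists #|` nbr adj v0| => v; have [phi [aphi <-]] := vt v0 v.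
have [psi [apsi pK qK]] := automorphism_inv aphi.
apply: (@leq_trans #|` [fset phi x | x in nbr adj v0]|); last exact: leq_imfset_card.
apply: fsubset_leq_card; apply/fsubsetP => y; rewrite in_nbr // => py.
apply/imfsetP; exists (psi y); rewrite //= ?qK // in_nbr //.
by rewrite -aphi.2 qK.
Qed.

End Automorphisms.

(** * Expectations and quantization *)

Section Expectation.
Context d (T : measurableType d) (R : realType) (P : probability T R).
Implicit Types (F G : T -> R) (c : R).

Definition L1 F := P.-integrable setT (EFin \o F).
Definition EX F : R := \int[P]_t F t.

Lemma L1_meas F : L1 F -> measurable_fun setT F.
Proof. by move=> /integrableP[/measurable_EFinP]. Qed.

Lemma L1_dom F G : measurable_fun setT F -> (forall t, `|F t| <= G t) -> L1 G -> L1 F.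
Proof.
move=> mF FG; apply: le_integrable => //; first exact/measurable_EFinP.
by move=> t _ /=; rewrite lee_fin (le_trans (FG t)) // ler_norm.
Qed.

Lemma L1_cst c : L1 (fun=> c).
Proof. exact: finite_measure_integrable_cst. Qed.

Lemma L1_bounded F c : measurable_fun setT F -> (forall t, `|F t| <= c) -> L1 F.
Proof. by move=> mF Fc; apply: L1_dom mF Fc (L1_cst c). Qed.

Lemma L1D F G : L1 F -> L1 G -> L1 (fun t => F t + G t).
Proof. by move=> iF iG; have := integrableD measurableT iF iG. Qed.

Lemma L1Z c F : L1 F -> L1 (fun t => c * F t).
Proof. by move=> iF; have := integrableZl measurableT c iF. Qed.

Lemma L1B F G : L1 F -> L1 G -> L1 (fun t => F t - G t).
Proof. by move=> iF iG; have := integrableB measurableT iF iG. Qed.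

Lemma L1_abs F : L1 F -> L1 (fun t => `|F t|).
Proof. by move=> iF; have := integrable_abse iF. Qed.

Lemma L1_sum (I : Type) (s : seq I) (F : I -> T -> R) :
  (forall i, L1 (F i)) -> L1 (fun t => \sum_(i <- s) F i t).
Proof.
move=> iF; elim: s => [|i s IH].
  by under eq_fun do rewrite big_nil; exact: L1_cst.
by under eq_fun do rewrite big_cons; exact: L1D.
Qed.

Lemma EXD F G : L1 F -> L1 G -> EX (fun t => F t + G t) = EX F + EX G.
Proof. by move=> iF iG; exact: RintegralD. Qed.

Lemma EXB F G : L1 F -> L1 G -> EX (fun t => F t - G t) = EX F - EX G.
Proof. by move=> iF iG; exact: RintegralB. Qed.

Lemma EXZ c F : L1 F -> EX (fun t => c * F t) = c * EX F.
Proof. by move=> iF; exact: RintegralZl. Qed.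

Lemma EX_cst c : EX (fun=> c) = c.
Proof.
rewrite /EX Rintegral_cst //.
by rewrite [X in fine X](@probability_setT _ _ _ P) mulr1.
Qed.

Lemma EX_sum (I : Type) (s : seq I) (F : I -> T -> R) :
  (forall i, L1 (F i)) -> EX (fun t => \sum_(i <- s) F i t) = \sum_(i <- s) EX (F i).
Proof.
move=> iF; elim: s => [|i s IH].
  by rewrite big_nil -[RHS]EX_cst; apply: eq_Rintegral => t _; rewrite big_nil.
rewrite big_cons -IH -EXD //; last exact: L1_sum.
by apply: eq_Rintegral => t _; rewrite big_cons.
Qed.

Lemma EX_le F G : L1 F -> L1 G -> (forall t, F t <= G t) -> EX F <= EX G.
Proof. by move=> iF iG FG; apply: le_Rintegral. Qed.

Lemma EX_ge0 F : (forall t, 0 <= F t) -> 0 <= EX F.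
Proof. by move=> F0; apply: Rintegral_ge0. Qed.

Lemma eq_EX F G : F =1 G -> EX F = EX G.
Proof. by move=> FG; apply: eq_Rintegral => t _; exact: FG. Qed.

Lemma EX_abs_le F : L1 F -> `|EX F| <= EX (fun t => `|F t|).
Proof. by move=> iF; exact: le_normr_Rintegral. Qed.

Lemma EX_E F : L1 F -> (\int[P]_t (F t)%:E)%E = (EX F)%:E.
Proof.
by move=> iF; rewrite /EX /Rintegral fineK //; exact: integrable_fin_num.
Qed.

Lemma L1_indic (S : set T) : measurable S -> L1 (\1_S).
Proof. by move=> mS; exact: integrable_indic. Qed.

Lemma EX_indic (S : set T) : measurable S -> EX (\1_S) = fine (P S).
Proof. by move=> mS; rewrite /EX /Rintegral integral_indic // setIT. Qed.

End Expectation.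

Section FiniteTransfer.
Context d (T : measurableType d) (R : realType) (P : probability T R).
Variables (I A : finType) (X : I -> T -> A) (p : A -> R).
Hypothesis mX : forall i a, measurable (X i @^-1` [set a]).
Hypothesis lawX : forall a : {ffun I -> A},
  P [set t | forall i, X i t = a i] = (\prod_i p (a i))%:E.

Lemma measurable_config (a : {ffun I -> A}) : measurable [set t | forall i, X i t = a i].
Proof.
have -> : [set t | forall i, X i t = a i] = \big[setI/setT]_(i : I) (X i @^-1` [set a i]).
  apply/seteqP; split=> t /=.
    by move=> h; elim/big_ind: _ => // i _; exact: h.
  move=> h i; move: h; rewrite (bigD1 i) //=; by case.
by apply: big_ind => //; exact: measurableI.
Qed.

Let config t : {ffun I -> A} := [ffun i => X i t].

Lemma config_decomp (Phi : {ffun I -> A} -> R) t :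
  Phi (config t) = \sum_a Phi a * \1_[set t | forall i, X i t = a i] t.
Proof.
rewrite (bigD1 (config t)) //= big1 ?addr0; last first.
  move=> a ne; rewrite indicE memNset ?mulr0 // => h.
  by move/eqP: ne; apply; apply/ffunP => i; rewrite ffunE h.
by rewrite indicE mem_set ?mulr1 // => i; rewrite ffunE.
Qed.

Lemma L1_config (Phi : {ffun I -> A} -> R) : L1 P (fun t => Phi (config t)).
Proof.
rewrite (_ : (fun t => _) = (fun t => \sum_a Phi a * \1_[set t | forall i, X i t = a i] t)).
  by apply: L1_sum => a; apply: L1Z; apply: L1_indic; exact: measurable_config.
by apply/funext => t; exact: config_decomp.
Qed.

Lemma EX_config (Phi : {ffun I -> A} -> R) :
  EX P (fun t => Phi (config t)) = fE p Phi.
Proof.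
rewrite (eq_EX P (G := fun t => \sum_a Phi a * \1_[set t | forall i, X i t = a i] t)); last first.
  exact: config_decomp.
rewrite EX_sum; last by move=> a; apply: L1Z; apply: L1_indic; exact: measurable_config.
apply: eq_bigr => a _; rewrite EXZ; last by apply: L1_indic; exact: measurable_config.
rewrite EX_indic; last exact: measurable_config.
by rewrite lawX mulrC.
Qed.

End FiniteTransfer.

(** * Rounding of the weights to a finite grid *)

Section Quantization.
Variable R : realType.
Variable k : nat.
Local Notation K := (k.+1%:R : R).
Local Notation N := (k.+1 * k.+1)%N.

(* Negative numbers are rounded to 0, since [Num.truncn] vanishes on them. *)
Definition qidx (x : R) : 'I_N.+1 := inord (minn (Num.truncn (x * K)) N).
Definition qval (a : 'I_N.+1) : R := a%:R / K.
Definition quant (x : R) : R := qval (qidx x).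

Lemma qidxE x : qidx x = minn (Num.truncn (x * K)) N :> nat.
Proof. by rewrite /qidx inordK // ltnS geq_minr. Qed.

Lemma K_gt0 : 0 < K. Proof. exact: ltr0Sn. Qed.

Lemma qval_ge0 a : 0 <= qval a.
Proof. by rewrite /qval divr_ge0. Qed.

Lemma quant_mono : {homo quant : x y / x <= y}.
Proof.
move=> x y xy; rewrite /quant /qval ler_pM2r ?invr_gt0 ?K_gt0 // ler_nat !qidxE.
rewrite leq_min geq_minr andbT; apply: leq_trans (geq_minl _ _) _.
by apply: le_truncn; rewrite ler_pM2r ?K_gt0.
Qed.

Lemma quant0 : quant 0 = 0.
Proof. by rewrite /quant /qval qidxE mul0r truncn0 min0n mul0r. Qed.

Lemma quant_le x : 0 <= x -> quant x <= x.
Proof.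
move=> x0; rewrite /quant /qval qidxE ler_pdivrMr ?K_gt0 //.
apply: (@le_trans _ _ (Num.truncn (x * K))%:R); first by rewrite ler_nat geq_minl.
by rewrite truncn_le mulr_ge0 // ltW ?K_gt0.
Qed.

Lemma quant_neg x : x <= 0 -> quant x = 0.
Proof.
move=> x0; apply/le_anti; rewrite qval_ge0 andbT -quant0; exact: quant_mono.
Qed.

(** Below the cut-off K the error is at most one mesh, 1/K; above it, x >= K and the error is at
    most x <= x^2 / K. This quadratic growth is why mean square errors call for a fourth moment. *)
Lemma quant_err x : 0 <= x -> x - quant x <= (1 + x ^+ 2) / K.
Proof.
move=> x0; have K0 := K_gt0.
rewrite ler_pdivlMr // mulrBl /quant /qval qidxE divfK ?gt_eqF //.
have xK0 : 0 <= x * K by rewrite mulr_ge0 // ltW.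
have [h|h] := leqP (Num.truncn (x * K)) N.
  have /andP[_] := truncn_itv xK0; rewrite -natr1.
  have := sqr_ge0 x; lra.
have h1 : N%:R <= x * K.
  by apply: le_trans (_ : (Num.truncn (x * K))%:R <= _); [rewrite ler_nat ltnW|rewrite truncn_le].
have h2 : K <= x by move: h1; rewrite natrM ler_pM2r.
have h3 : x * K <= x ^+ 2 by rewrite expr2 ler_wpM2l.
by have : 0 <= N%:R :> R by []; lra.
Qed.

Lemma measurable_qidx (a : 'I_N.+1) : measurable (qidx @^-1` [set a]).
Proof.
have mge (j : nat) : measurable [set x : R | (j <= qidx x)%N].
  case: j => [|j].
    by rewrite (_ : [set _ | _] = setT) //; apply/seteqP; split.
  have [h|h] := leqP j.+1 N; last first.
    rewrite (_ : [set _ | _] = set0) //; apply/seteqP; split=> x //=.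
    by rewrite qidxE leq_min => /andP[_]; rewrite leqNgt h.
  rewrite (_ : [set _ | _] = `[j.+1%:R / K, +oo[%classic) //.
  apply/seteqP; split=> x /=; rewrite in_itv /= andbT qidxE leq_min h andbT truncn_gt_nat.
    by rewrite ler_pdivrMr ?K_gt0.
  by rewrite ler_pdivrMr ?K_gt0.
rewrite (_ : _ @^-1` _ = ([set x : R | (a <= qidx x)%N] `\` [set x : R | (a.+1 <= qidx x)%N])%classic).
  exact: measurableD.
apply/seteqP; split=> x /=; first by move=> ->; rewrite ltnn; split.
by move=> [h1 /negP]; rewrite -leqNgt => h2; apply/val_inj/anti_leq; rewrite h2.
Qed.

End Quantization.

(** * Approximation and normalisation in L^2 *)

Section SquareIntegrable.
Context d (T : measurableType d) (R : realType) (P : probability T R).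
Implicit Types (F G M Y : T -> R).

Definition L2 F := measurable_fun setT F /\ L1 P (fun t => F t ^+ 2).

Lemma L2_cst c : L2 (fun=> c).
Proof. by split; [exact: measurable_cst|exact: L1_cst]. Qed.

Lemma L2D F G : L2 F -> L2 G -> L2 (fun t => F t + G t).
Proof.
move=> [mF iF] [mG iG]; split; first exact: measurable_funD.
apply: (@L1_dom _ _ _ _ _ (fun t => 2 * F t ^+ 2 + 2 * G t ^+ 2)).
- by apply: measurable_funX; exact: measurable_funD.
- move=> t; rewrite ger0_norm ?sqr_ge0 // -subr_ge0.
  rewrite (_ : _ - _ = (F t - G t) ^+ 2) ?sqr_ge0 //; ring.
- by apply: L1D; exact: L1Z.
Qed.

Lemma L2N F : L2 F -> L2 (fun t => - F t).
Proof.
move=> [mF iF]; split; first exact: measurableT_comp.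
by rewrite (_ : (fun t => _) = (fun t => F t ^+ 2)) //; apply/funext => t; rewrite sqrrN.
Qed.

Lemma L2B F G : L2 F -> L2 G -> L2 (fun t => F t - G t).
Proof. by move=> lF /L2N lG; exact: L2D. Qed.

Lemma L2M F G : L2 F -> L2 G -> L1 P (fun t => F t * G t).
Proof.
move=> [mF iF] [mG iG].
apply: (@L1_dom _ _ _ _ _ (fun t => F t ^+ 2 + G t ^+ 2)).
- exact: measurable_funM.
- move=> t; rewrite normrM.
  rewrite -[F t ^+ 2]real_normK ?num_real // -[G t ^+ 2]real_normK ?num_real //.
  have := sqr_ge0 (`|F t| - `|G t|); have := mulr_ge0 (normr_ge0 (F t)) (normr_ge0 (G t)).
  have -> : (`|F t| - `|G t|) ^+ 2 = `|F t| ^+ 2 - 2 * (`|F t| * `|G t|) + `|G t| ^+ 2 by ring.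
  lra.
- exact: L1D.
Qed.

Lemma L2_L1 F : L2 F -> L1 P F.
Proof.
move=> lF; have := L2M lF (L2_cst 1).
by rewrite (_ : (fun t => _) = F) //; apply/funext => t; rewrite mulr1.
Qed.

Lemma EX_sqrD F G : L2 F -> L2 G ->
  EX P (fun t => (F t + G t) ^+ 2) <= 2 * EX P (fun t => F t ^+ 2) + 2 * EX P (fun t => G t ^+ 2).
Proof.
move=> lF lG; have [_ iF] := lF; have [_ iG] := lG; have [_ iFG] := L2D lF lG.
rewrite -(EXZ 2 iF) -(EXZ 2 iG) -(EXD (L1Z 2 iF) (L1Z 2 iG)).
apply: (EX_le iFG (L1D (L1Z 2 iF) (L1Z 2 iG))) => t.
rewrite -subr_ge0 (_ : _ - _ = (F t - G t) ^+ 2) ?sqr_ge0 //; ring.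
Qed.

Definition VX F := EX P (fun t => (F t - EX P F) ^+ 2).

Lemma fine_expectation F : L2 F -> fine ('E_P[F])%E = EX P F.
Proof. by move=> lF; rewrite unlock. Qed.

Lemma L2_centered F c : L2 F -> L2 (fun t => F t - c).
Proof. by move=> lF; apply: L2B => //; exact: L2_cst. Qed.

Lemma variance_VX F : L2 F -> ('V_P[F])%E = (VX F)%:E.
Proof.
move=> lF; rewrite /variance unlock unlock /VX.
have [_ iF] := L2_centered (EX P F) lF.
rewrite -(EX_E iF); apply: eq_integral => t _ /=.
by rewrite /= [fine _](_ : _ = EX P F).
Qed.

Lemma VX_le F c : L2 F -> VX F <= EX P (fun t => (F t - c) ^+ 2).
Proof.
move=> lF; have iF := L2_L1 lF; have lc := L2_centered c lF.
have [_ i1] := L2_centered (EX P F) lF; have [_ i2] := lc.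
have ic := L2_L1 lc.
rewrite /VX (eq_EX _ (G := fun t => (F t - c) ^+ 2 + ((- 2 * (EX P F - c)) * (F t - c) + (EX P F - c) ^+ 2))); last first.
  by move=> t; ring.
have iZ := L1Z (- 2 * (EX P F - c)) ic.
rewrite (EXD i2 (L1D iZ (L1_cst P _))) (EXD iZ (L1_cst P _)) (EXZ _ ic).
rewrite (EXB iF (L1_cst P _)) !EX_cst gerDl.
set m := EX P F - c.
have -> : -2 * m * m + m ^+ 2 = - (m ^+ 2) by ring.
by rewrite oppr_le0 sqr_ge0.
Qed.

Section approximation.
Variables (M N Y : T -> R) (zeta eta : R).
Hypotheses (lM : L2 M) (lN : L2 N) (lY : L2 Y).
Hypothesis MN : EX P (fun t => (M t - N t) ^+ 2) <= zeta.
Hypothesis NY : EX P (fun t => (N t - EX P N - Y t) ^+ 2) <= eta.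

(** In this section [M] will be the tree weight, [N] the weight after rounding, and [Y] the local
    martingale sum that approximates the centered [N]. *)
Lemma VX_approx_le : VX M <= 2 * zeta + 2 * VX N.
Proof.
apply: le_trans (VX_le (EX P N) lM) _.
rewrite (eq_EX _ (G := fun t => ((M t - N t) + (N t - EX P N)) ^+ 2)); last by move=> t; ring.
apply: le_trans (EX_sqrD (L2B lM lN) (L2_centered (EX P N) lN)) _.
by rewrite lerD2r ler_wpM2l.
Qed.

Lemma VX_approx_ge : VX N <= 2 * zeta + 2 * VX M.
Proof.
apply: le_trans (VX_le (EX P M) lN) _.
rewrite (eq_EX _ (G := fun t => (- (M t - N t) + (M t - EX P M)) ^+ 2)); last by move=> t; ring.
apply: le_trans (EX_sqrD (L2N (L2B lM lN)) (L2_centered (EX P M) lM)) _.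
rewrite lerD2r ler_wpM2l // (eq_EX _ (G := fun t => (M t - N t) ^+ 2)) // => t.
by rewrite sqrrN.
Qed.

Lemma centered_approx : EX P (fun t => (M t - EX P M - Y t) ^+ 2) <= 4 * zeta + 2 * eta.
Proof.
have lMN := L2B lM lN.
have lMNc := L2_centered (EX P M - EX P N) lMN.
rewrite (eq_EX _ (G := fun t => ((M t - N t - (EX P M - EX P N)) + (N t - EX P N - Y t)) ^+ 2)); last by move=> t; ring.
apply: le_trans (EX_sqrD lMNc (L2B (L2_centered _ lN) lY)) _.
apply: lerD; last exact: ler_wpM2l.
have -> : 4 * zeta = 2 * (2 * zeta) by ring.
apply: ler_wpM2l => //.
have h := VX_le 0 lMN; rewrite /VX in h.
rewrite (EXB (L2_L1 lM) (L2_L1 lN)) in h.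
apply: le_trans h _.
rewrite (eq_EX _ (G := fun t => (M t - N t) ^+ 2)); last by move=> t; rewrite subr0.
apply: le_trans MN _.
have z0 : 0 <= zeta by apply: le_trans MN; apply: EX_ge0 => t; exact: sqr_ge0.
by rewrite mulr_natl mulr2n lerDl.
Qed.

End approximation.

Section normalised.
Variables (M Y : T -> R) (e lam : R).
Hypotheses (lM : L2 M) (lY : L2 Y) (lam0 : 0 < lam) (VM : 0 < VX M).
Hypothesis MY : EX P (fun t => (M t - EX P M - Y t) ^+ 2) <= e * VX M.
Let s := Num.sqrt (VX M).

Let s0 : 0 < s. Proof. by rewrite sqrtr_gt0. Qed.
Let s2 : s ^+ 2 = VX M. Proof. by rewrite sqr_sqrtr // ltW. Qed.
Let del t := (M t - EX P M) / s - Y t / s.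
Let lMc : L2 (fun t => M t - EX P M). Proof. exact: L2_centered. Qed.

Let lZ c F : L2 F -> L2 (fun t => F t / c).
Proof.
move=> [mF iF]; split; first by apply: measurable_funM => //; exact: measurable_cst.
rewrite (_ : (fun t => _) = (fun t => (c ^+ 2)^-1 * F t ^+ 2)); first exact: L1Z.
by apply/funext => t; rewrite expr_div_n mulrC.
Qed.

Let ldel : L2 del. Proof. by apply: L2B; exact: lZ. Qed.

Lemma EX_del_sqr : EX P (fun t => del t ^+ 2) <= e.
Proof.
have [_ i1] := L2B lMc lY.
rewrite (eq_EX _ (G := fun t => (VX M)^-1 * (M t - EX P M - Y t) ^+ 2)); last first.
  move=> t; rewrite /del -mulrBl expr_div_n s2 mulrC //.
by rewrite (EXZ _ i1) mulrC ler_pdivrMr.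
Qed.

(** With [del] the difference of the two arguments, |del| <= lam + del^2 / lam turns the L^2 bound
    into an L^1 bound with a free parameter. *)
Lemma normalised_lipschitz (h : R -> R) (ch : R) : measurable_fun setT h ->
  (forall u, `|h u| <= 1) -> 0 <= ch -> (forall u v, `|h v - h u| <= ch * `|v - u|) ->
  `|EX P (fun t => h ((M t - EX P M) / s)) - EX P (fun t => h (Y t / s))| <= ch * (lam + e / lam).
Proof.
move=> mh h1 ch0 hl.
have i1 F : L2 F -> L1 P (fun t => h (F t)).
  move=> [mF _]; apply: (@L1_bounded _ _ _ _ _ 1) => //; exact: measurableT_comp.
have j1 := i1 _ (lZ s lMc); have j2 := i1 _ (lZ s lY).
have [md id2] := ldel.
rewrite -(EXB j1 j2); apply: le_trans (EX_abs_le (L1B j1 j2)) _.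
have iB := L1D (L1_cst P lam) (L1Z lam^-1 id2).
apply: (@le_trans _ _ (EX P (fun t => ch * (lam + lam^-1 * del t ^+ 2)))).
  apply: (EX_le (L1_abs (L1B j1 j2)) (L1Z ch iB)) => t.
  apply: le_trans (hl _ _) _; apply: ler_wpM2l => //; rewrite -/(del t).
  have := sqr_ge0 (`|del t| - lam); rewrite -[del t ^+ 2]real_normK ?num_real //.
  have n0 := normr_ge0 (del t).
  move=> q; rewrite -(ler_pM2l lam0) mulrDr mulrA divff ?gt_eqF // mul1r.
  have := mulr_ge0 (ltW lam0) n0; move: q.
  have -> : (`|del t| - lam) ^+ 2 = `|del t| ^+ 2 - 2 * (lam * `|del t|) + lam * lam by ring.
  lra.
rewrite (EXZ _ iB) (EXD (L1_cst P lam) (L1Z _ id2)) EX_cst (EXZ _ id2).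
apply: ler_wpM2l => //; rewrite lerD2l mulrC; apply: ler_wpM2r; first by rewrite invr_ge0 ltW.
exact: EX_del_sqr.
Qed.

(** The normalised [M], called [m], has second moment 1. With z = m - y one has m^2 - y^2 = 2 m z -
    z^2, and the cross term is at most lam m^2 + z^2 / lam. *)
Lemma normalised_variance :
  `|1 - EX P (fun t => (Y t / s) ^+ 2)| <= lam + (1 + lam^-1) * e.
Proof.
have lMs := lZ s lMc; have lYs := lZ s lY.
have [_ iM2] := lMs; have [_ iY2] := lYs; have [_ id2] := ldel.
have EM : EX P (fun t => ((M t - EX P M) / s) ^+ 2) = 1.
  have [_ i0] := lMc.
  rewrite (eq_EX _ (G := fun t => (VX M)^-1 * (M t - EX P M) ^+ 2)); last first.
    by move=> t; rewrite expr_div_n s2 mulrC.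
  by rewrite (EXZ _ i0) mulVf // gt_eqF.
rewrite -{1}EM -(EXB iM2 iY2); apply: le_trans (EX_abs_le (L1B iM2 iY2)) _.
have iB := L1D (L1Z lam iM2) (L1Z (1 + lam^-1) id2).
apply: (@le_trans _ _ (EX P (fun t => lam * ((M t - EX P M) / s) ^+ 2 + (1 + lam^-1) * del t ^+ 2))).
  apply: (EX_le (L1_abs (L1B iM2 iY2)) iB) => t.
  rewrite /del; set m := (M t - EX P M) / s; set y := Y t / s.
  have -> : m ^+ 2 - y ^+ 2 = (m - y) * (2 * m - (m - y)) by ring.
  set z := m - y.
  have l1 : lam * lam^-1 = 1 by rewrite divff // gt_eqF.
  have a1 : 0 <= lam^-1 * (lam * m + z) ^+ 2 by rewrite mulr_ge0 ?sqr_ge0 // invr_ge0 ltW.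
  have a2 : 0 <= lam^-1 * (lam * m - z) ^+ 2 by rewrite mulr_ge0 ?sqr_ge0 // invr_ge0 ltW.
  have z2 := sqr_ge0 z.
  have e1 : lam^-1 * (lam * m + z) ^+ 2 = lam * m ^+ 2 + 2 * (m * z) + lam^-1 * z ^+ 2.
    transitivity ((lam * lam^-1) * (lam * m ^+ 2) + (lam * lam^-1) * (2 * (m * z)) + lam^-1 * z ^+ 2).
      by ring.
    by rewrite l1 !mul1r.
  have e2 : lam^-1 * (lam * m - z) ^+ 2 = lam * m ^+ 2 - 2 * (m * z) + lam^-1 * z ^+ 2.
    transitivity ((lam * lam^-1) * (lam * m ^+ 2) - (lam * lam^-1) * (2 * (m * z)) + lam^-1 * z ^+ 2).
      by ring.
    by rewrite l1 !mul1r.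
  rewrite e1 in a1; rewrite e2 in a2.
  have -> : z * (2 * m - z) = 2 * (m * z) - z ^+ 2 by ring.
  by rewrite ler_norml mulrDl mul1r; apply/andP; split; lra.
rewrite (EXD (L1Z _ iM2) (L1Z _ id2)) (EXZ _ iM2) (EXZ _ id2) EM mulr1 lerD2l.
apply: ler_wpM2l; last exact: EX_del_sqr.
by rewrite addr_ge0 // invr_ge0 ltW.
Qed.

End normalised.

Lemma prob_ramp (F : T -> R) a b : measurable_fun setT F -> a < b ->
  fine (P [set t | F t <= a]) <= EX P (fun t => ramp a b (F t)) <= fine (P [set t | F t <= b]).
Proof.
move=> mF ab.
have mS c : measurable [set t | F t <= c].
  have := mF measurableT `]-oo, c]%classic; rewrite setTI => h.
  rewrite (_ : [set _ | _] = F @^-1` `]-oo, c]%classic); first by apply: h.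
  by apply/seteqP; split=> t /=; rewrite in_itv.
have mr : measurable_fun setT (fun t => ramp a b (F t)).
  apply: measurableT_comp => //; apply: continuous_measurable_fun; exact: ramp_continuous.
have ir : L1 P (fun t => ramp a b (F t)).
  have r1 t : `|ramp a b (F t)| <= 1.
    by have /andP[h0 h1] := ramp01 a b (F t); rewrite ger0_norm.
  exact: (L1_bounded P mr r1).
rewrite -!EX_indic //; apply/andP; split.
  apply: (EX_le (L1_indic P (mS a)) ir) => t; rewrite indicE.
  case: (boolP (t \in _)) => h /=; last by have /andP[] := ramp01 a b (F t).
  by rewrite ramp_le //; rewrite inE in h.
apply: (EX_le ir (L1_indic P (mS b))) => t; rewrite indicE.
case: (boolP (t \in _)) => h /=; first by have /andP[] := ramp01 a b (F t).
rewrite ramp_ge //; move: h; rewrite notin_setE /= => /negP; rewrite -ltNge; exact: ltW.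
Qed.

End SquareIntegrable.

(** * Two separated values of a non-degenerate law *)

Section Nondegenerate.
Variables (R : realType) (mu : probability R R).

Let mle (x : R) : measurable [set y : R | y <= x].
Proof.
by rewrite (_ : [set _ | _] = `]-oo, x]%classic) //; apply/seteqP; split=> y /=; rewrite in_itv.
Qed.

Let mge (x : R) : measurable [set y : R | x <= y].
Proof.
by rewrite (_ : [set _ | _] = `[x, +oo[%classic) //; apply/seteqP; split=> y /=; rewrite in_itv /= andbT.
Qed.

Lemma fine_measure_gt0 (A : set R) : measurable A -> mu A != 0%E -> 0 < fine (mu A).
Proof.
move=> mA h; rewrite lt_neqAle fine_ge0 // andbT eq_sym; apply: contra h => /eqP h.
by rewrite -[mu A]fineK ?h // fin_num_measure.
Qed.

(** Otherwise, for all 0 <= a < b, one of the two tails is null. With [c] the infimum of the points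
    that have mass to their left, everything below c - 1/n is null by definition and everything
    above c + 1/n by this dichotomy, so [mu] would be the point mass at [c]. *)
Lemma nondegenerate_split : mu [set x : R | x < 0] = 0%E ->
  (forall c : R, mu [set c] != 1%E) ->
  exists a b q, [/\ a < b, 0 < q, q <= 1 &
    q <= fine (mu [set x | x <= a]) /\ q <= fine (mu [set x | b <= x]) /\ 0 <= a].
Proof.
move=> mneg mnd; apply: contrapT => nex.
have dich a b : 0 <= a -> a < b -> mu [set x | x <= a] = 0%E \/ mu [set x | b <= x] = 0%E.
  move=> a0 ab; have [/eqP|na] := boolP (mu [set x | x <= a] == 0%E); first by left.
  have [/eqP|nb] := boolP (mu [set x | b <= x] == 0%E); first by right.
  case: nex; exists a, b, (Num.min (fine (mu [set x | x <= a])) (fine (mu [set x | b <= x]))).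
  split => //; first by rewrite lt_min !fine_measure_gt0.
    rewrite ge_min; apply/orP; left; rewrite -lee_fin fineK ?fin_num_measure //.
    exact: probability_le1.
  by rewrite !ge_min !lexx orbT.
have neg x : x < 0 -> mu [set y | y <= x] = 0%E.
  move=> x0; apply/eqP; rewrite -measure_le0 -mneg; apply: le_measure; rewrite ?inE //.
    by rewrite (_ : [set _ | _] = `]-oo, 0[%classic) //; apply/seteqP; split=> y /=; rewrite in_itv.
  by move=> y /= yx; exact: le_lt_trans yx x0.
pose S := [set x : R | mu [set y | y <= x] <> 0%E].
have S0 : lbound S 0.
  by move=> x /= h; rewrite leNgt; apply/negP => /neg.
have nb (F : (set R)^nat) : (forall n, measurable (F n)) -> (forall n, mu (F n) = 0%E) ->
    mu (\bigcup_n F n)%classic = 0%E.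
  move=> mF F0; apply/negligibleP; first exact: bigcup_measurable.
  apply: (@negligible_bigcup _ _ _ mu F) => n; exists (F n); split; [exact: mF|exact: F0|exact: subset_refl].
have Sne : S !=set0.
  apply: contrapT => Sn.
  have : mu setT = 0%E.
    rewrite (_ : setT = (\bigcup_n [set y : R | y <= n%:R])%classic).
      apply: nb => // n; apply: contrapT => h; apply: Sn; by exists n%:R.
    apply/seteqP; split=> // x _; exists (Num.truncn x).+1 => //=.
    by apply: ltW; apply: real_truncnS_gt; exact: num_real.
  by rewrite (@probability_setT _ _ _ mu) => /eqP; rewrite onee_eq0.
have hS : has_inf S by split => //; exists 0.
pose c := inf S.
have c0 : 0 <= c by apply: lb_le_inf.
have n0 (n : nat) : 0 < n.+1%:R^-1 :> R by rewrite invr_gt0.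
have lo n : mu [set y | y <= c - n.+1%:R^-1] = 0%E.
  apply: contrapT => h; have : c <= c - n.+1%:R^-1 by apply: ge_inf => //; exists 0.
  by rewrite lerBrDr gerDl leNgt n0.
have hi n : mu [set y | c + n.+1%:R^-1 <= y] = 0%E.
  have n2 : 0 < n.+1%:R^-1 / 2 :> R by rewrite divr_gt0.
  have [s Ss sc] := inf_adherent n2 hS.
  have [||h|//] := dich (c + n.+1%:R^-1 / 2) (c + n.+1%:R^-1).
  - by rewrite addr_ge0 // ltW.
  - by rewrite ltrD2l ltr_pdivrMr // ltr_pMr // ltr1n.
  exfalso; apply: Ss; apply/eqP; rewrite -measure_le0 -h; apply: le_measure; rewrite ?inE //.
  by move=> y /= ys; apply: le_trans ys _; exact: ltW.
have mc : measurable [set c] by exact: measurable_set1.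
have cc : mu (~` [set c])%classic = 0%E.
  apply/eqP; rewrite -measure_le0.
  have <- : mu ((\bigcup_n [set y : R | y <= c - n.+1%:R^-1]) `|` (\bigcup_n [set y : R | c + n.+1%:R^-1 <= y]))%classic = 0%E.
    apply/negligibleP; first by apply: measurableU; exact: bigcup_measurable.
    by apply: negligibleU; apply/negligibleP; try (exact: bigcup_measurable); apply: nb.
  apply: le_measure; rewrite ?inE //; first exact: measurableC.
    by apply: measurableU; exact: bigcup_measurable.
  move=> y /= yc; case: (ltgtP y c) => [h|h|//].
    left; have p : 0 < c - y by rewrite subr_gt0.
    exists (Num.truncn (c - y)^-1) => //=.
    have := real_truncnS_gt (num_real (c - y)^-1).
    by rewrite invf_plt ?posrE // lerBrDr -lerBrDl => /ltW.
  right; have p : 0 < y - c by rewrite subr_gt0.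
  exists (Num.truncn (y - c)^-1) => //=.
  have := real_truncnS_gt (num_real (y - c)^-1).
  by rewrite invf_plt ?posrE // -lerBrDl => /ltW.
have := mnd c; have := probability_setC mu mc; rewrite cc => h.
have : mu [set c] = 1%E.
  have fc : mu [set c] \is a fin_num by exact: fin_num_measure.
  by move: h; rewrite -(fineK fc) -EFinB => -[h]; congr (_%:E); lra.
by move=> ->; rewrite eqxx.
Qed.

End Nondegenerate.

(** * Choice of the constants *)

Section Budgets.
Variable R : realFieldType.
Implicit Types ch eta C c tau E s e : R.

(** Six shares of eta / 6: two for the Lipschitz term, three for the variance defect and [delta],
    one for the Taylor remainder. [e] is chosen so that (1 + 1/lam) e = lam. *)
Lemma stein_budget ch (c1 : R) eta : 0 <= ch -> 0 <= c1 -> 0 < eta ->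
  exists lam e delta, [/\ 0 < lam, 0 < e, 0 < delta &
    ch * (lam + e / lam) + (c1 * ((lam + (1 + lam^-1) * e) + delta) + eta / 6) <= eta].
Proof.
move=> ch0 c10 eta0; pose S := ch + c1 + 1.
have S0 : 0 < S by rewrite /S; lra.
pose lam := eta / (6 * S).
have l0 : 0 < lam by rewrite divr_gt0 // mulr_gt0.
have li0 : 0 < lam^-1 by rewrite invr_gt0.
have q0 : 0 < 1 + lam^-1 by rewrite addr_gt0.
pose e := lam / (1 + lam^-1).
have e0 : 0 < e by rewrite divr_gt0.
have Sl : S * lam = eta / 6 by rewrite /lam; field; rewrite gt_eqF.
have eq : (1 + lam^-1) * e = lam by rewrite /e mulrCA divff ?mulr1 // gt_eqF.
have el : e / lam <= lam by rewrite -[leRHS]eq mulrC ler_wpM2r ?(ltW e0) //; lra.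
exists lam, e, lam; split => //; rewrite eq.
have a1 : ch * (lam + e / lam) <= ch * (lam + lam) by rewrite ler_wpM2l // lerD2l.
have a2 : ch * lam <= S * lam by rewrite ler_wpM2r ?(ltW l0) // /S; lra.
have a3 : c1 * lam <= S * lam by rewrite ler_wpM2r ?(ltW l0) // /S; lra.
rewrite Sl in a2 a3; rewrite !mulrDr in a1 *; lra.
Qed.

(** [E] will be the number of edges and [s] a standard deviation. As s^2 is at least of order [E],
    the left side is of order 1/E, and in [scale_third] of order 1/sqrt(E). *)
Lemma scale_fourth C c tau : 0 <= C -> 0 < c -> 0 < tau ->
  exists B, forall E s, B <= E -> 0 < E -> 0 < s -> c / 4 * E <= s ^+ 2 ->
    E * C / s ^+ 4 <= tau.
Proof.
move=> C0 c0 t0; exists (16 * C / (c ^+ 2 * tau)) => E s BE E0 s0 hs.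
have cE0 : 0 <= c / 4 * E by rewrite !mulr_ge0 ?invr_ge0 // ltW.
rewrite ler_pdivrMr ?exprn_gt0 //.
apply: (@le_trans _ _ (tau * (c / 4 * E) ^+ 2)); last first.
  rewrite ler_wpM2l ?(ltW t0) // -[4%N]/(2 * 2)%N exprM ler_pXn2r ?nnegrE //.
  by rewrite exprn_ge0 // ltW.
move: BE; rewrite ler_pdivrMr ?mulr_gt0 ?exprn_gt0 // => h.
have -> : tau * (c / 4 * E) ^+ 2 = E * (E * (c ^+ 2 * tau) / 16) by field.
by rewrite ler_pM2l // ler_pdivlMr // mulrC.
Qed.

Lemma scale_third C c tau : 0 <= C -> 0 < c -> 0 < tau ->
  exists B, forall E s, B <= E -> 0 < E -> 0 < s -> c / 4 * E <= s ^+ 2 ->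
    E * C / s ^+ 3 <= tau.
Proof.
move=> C0 c0 t0; pose s1 := 4 * C / (tau * c).
have s10 : 0 <= s1 by rewrite divr_ge0 ?mulr_ge0 // ltW.
exists (4 * s1 ^+ 2 / c) => E s BE E0 s0 hs.
have s1s : s1 <= s.
  rewrite -(ler_pXn2r (n := 2)) ?nnegrE ?(ltW s0) //; apply: le_trans hs.
  by move: BE; rewrite ler_pdivrMr // => h; have := h; rewrite mulrC [E * c]mulrC; lra.
rewrite ler_pdivrMr ?exprn_gt0 // exprSr.
apply: (@le_trans _ _ (tau * (c / 4 * E * s1))); last first.
  rewrite ler_wpM2l ?(ltW t0) //; apply: ler_pM => //.
  by rewrite !mulr_ge0 ?invr_ge0 // ltW.
rewrite le_eqVlt; apply/orP; left; apply/eqP; rewrite /s1; field.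
by rewrite !gt_eqF.
Qed.

(** Four sources of error, each given e c / 16 per edge: rounding ([x]), finite radius ([y]),
    truncation ([m / z]) and vertices whose ball leaves the graph ([bad]). They add up to e c / 4
    per edge, which is at most e V. *)
Lemma approx_budget E (V bad D m x y z : R) e c :
  0 <= E -> 0 <= e -> c / 4 * E <= V ->
  4 * x <= (e * c / 16) * E -> 4 * y <= e * c / 16 -> 2 * (2 * m / z) <= e * c / 16 ->
  2 * (bad * D * m) <= (e * c / 16) * E ->
  4 * x + 2 * (E * (2 * y + 2 * m / z) + bad * D * m) <= e * V.
Proof.
move=> E0 e0 cV h1 h2 h3 h4.
have := ler_wpM2l e0 cV; have := ler_wpM2l E0 h2; have := ler_wpM2l E0 h3.
move: (2 * m / z) {h3} => W; move: (bad * D * m) h4 => B h4.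
have -> : E * (2 * W) = 2 * (E * W) by ring.
have -> : E * (4 * y) = 4 * (E * y) by ring.
have -> : e * (c / 4 * E) = 4 * (E * (e * c / 16)) by field.
have -> : E * (2 * y + W) = 2 * (E * y) + E * W by ring.
rewrite [_ * E]mulrC in h1; rewrite [_ * E]mulrC in h4.
move: (E * (e * c / 16)) (E * W) (E * y) (e * V) h1 h4 => Q X Y Z *; lra.
Qed.
End Budgets.

(** * Random weights *)

Section Weights.
Context d (T : measurableType d) (R : realType) (P : probability T R).
Variables (mu : probability R R) (V : choiceType) (adj : rel V) (w : {fset V} -> T -> R).
Hypothesis w_meas : forall e, is_edge adj e -> measurable_fun setT (w e).
Hypothesis w_indep : mutually_independent P (is_edge adj) w.
Hypothesis w_law : forall e (B : set R), is_edge adj e -> measurable B ->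
  P (w e @^-1` B) = mu B.
Hypothesis mu_neg : mu [set x : R | x < 0] = 0%E.
Hypothesis mu_moment : exists2 delta : R, 0 < delta &
  (\int[mu]_x ((`|x| `^ (4 + delta))%:E) < +oo)%E.

Lemma integrable_moment4 : L1 mu (fun x => 1 + x ^+ 4).
Proof.
have [delta d0 hd] := mu_moment.
have mp : measurable_fun setT (fun x : R => `|x| `^ (4 + delta)).
  apply: (@measurableT_comp _ _ _ _ _ _ (fun y : R => y `^ (4 + delta))).
    exact: measurable_powR.
  exact: normr_measurable.
have ip : L1 mu (fun x => `|x| `^ (4 + delta)).
  apply/integrableP; split; first exact/measurable_EFinP.
  by under eq_integral do rewrite /= ger0_norm ?powR_ge0 //.
have iG : L1 mu (fun x => 2 + `|x| `^ (4 + delta)) by apply: L1D => //; exact: L1_cst.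
refine (L1_dom _ _ iG).
- by apply: measurable_funD => //; exact: measurable_funX.
- move=> x; rewrite ger0_norm ?addr_ge0 ?exprn_even_ge0 //.
  have -> : x ^+ 4 = `|x| ^+ 4 by rewrite -normrX ger0_norm // exprn_even_ge0.
  have n0 := normr_ge0 x; have p0 := powR_ge0 `|x| (4 + delta).
  have [h|h] := lerP `|x| 1.
    have : `|x| ^+ 4 <= 1 by rewrite exprn_ile1.
    lra.
  suff : `|x| ^+ 4 <= `|x| `^ (4 + delta) by lra.
  rewrite -powR_mulrn // ler_powR ?(ltW h) //; lra.
Qed.

Definition mom4 : R := EX mu (fun x => 1 + x ^+ 4).

Lemma mom4_ge1 : 1 <= mom4.
Proof.
rewrite -[leLHS](EX_cst mu); apply: EX_le.
- exact: L1_cst.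
- exact: integrable_moment4.
- by move=> x; rewrite lerDl exprn_even_ge0.
Qed.

Lemma ge0_edge_integral e (g : R -> R) : is_edge adj e -> measurable_fun setT g ->
  (forall x, 0 <= g x) -> (\int[P]_t (g (w e t))%:E = \int[mu]_x (g x)%:E)%E.
Proof.
move=> he mg g0.
pose X := mfun_Sub (mem_set (w_meas he)).
transitivity (\int[pushforward P X]_x (g x)%:E)%E.
  rewrite ge0_integral_pushforward //; first exact/measurable_EFinP.
  by move=> y _; rewrite lee_fin.
by apply: eq_measure_integral => B mB _; exact: w_law.
Qed.

Lemma edge_L1 e (g : R -> R) : is_edge adj e -> measurable_fun setT g ->
  (forall x, 0 <= g x) -> L1 mu g ->
  L1 P (fun t => g (w e t)) /\ EX P (fun t => g (w e t)) = EX mu g.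
Proof.
move=> he mg g0 ig; have mgw : measurable_fun setT (fun t => g (w e t)).
  by apply: measurableT_comp => //; exact: w_meas.
have E := ge0_edge_integral he mg g0.
split; last by rewrite /EX /Rintegral E.
apply/integrableP; split; first exact/measurable_EFinP.
move: ig => /integrableP[_].
under eq_integral do rewrite /= ger0_norm //.
by under [in X in _ -> X]eq_integral do rewrite /= ger0_norm //; rewrite E.
Qed.

Lemma edge_moment e : is_edge adj e ->
  L1 P (fun t => 1 + w e t ^+ 4) /\ EX P (fun t => 1 + w e t ^+ 4) = mom4.
Proof.
move=> he; apply: (edge_L1 (g := fun x => 1 + x ^+ 4)) => //.
- by apply: measurable_funD => //; exact: measurable_funX.
- by move=> x; rewrite addr_ge0 ?exprn_even_ge0.
- exact: integrable_moment4.
Qed.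

Lemma measurable_quant k : measurable_fun setT (@quant R k).
Proof.
apply: nondecreasing_measurable => //; exact: quant_mono.
Qed.

(** The squared error is at most ((1 + x^2) / K)^2 <= 2 (1 + x^4) / K^2. This is known for x >= 0,
    whence the almost-everywhere comparison. *)
Lemma quant_sqr_err e k : is_edge adj e ->
  L1 P (fun t => (w e t - quant k (w e t)) ^+ 2) /\
  EX P (fun t => (w e t - quant k (w e t)) ^+ 2) <= 2 * mom4 / k.+1%:R ^+ 2.
Proof.
move=> he.
pose g (x : R) := (x - quant k x) ^+ 2.
pose c : R := 2 / k.+1%:R ^+ 2.
have K0 : 0 < k.+1%:R :> R by [].
have c0 : 0 <= c by rewrite divr_ge0 // exprn_ge0.
have mg : measurable_fun setT g.
  by apply: measurable_funX; apply: measurable_funB => //; exact: measurable_quant.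
have g0 x : 0 <= g x by exact: sqr_ge0.
have i4 := integrable_moment4.
have ig : L1 mu g.
  apply: L1_dom mg _ i4 => x; rewrite ger0_norm // /g.
  suff h : (x - quant k x) ^+ 2 <= x ^+ 2.
    have h1 := sqr_ge0 (x ^+ 2 - 1).
    have e1 : (x ^+ 2 - 1) ^+ 2 = x ^+ 4 - 2 * x ^+ 2 + 1 by ring.
    rewrite e1 in h1; have := sqr_ge0 x; lra.
  case: (lerP 0 x) => x0; last by rewrite quant_neg ?subr0 // ltW.
  have h1 := quant_le k x0; have h2 : 0 <= quant k x by exact: qval_ge0.
  by rewrite ler_pXn2r ?nnegrE ?subr_ge0 //; lra.
have [iP eP] := edge_L1 he mg g0 ig.
split => //; rewrite eP.
have -> : 2 * mom4 / k.+1%:R ^+ 2 = EX mu (fun x => c * (1 + x ^+ 4)).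
  by rewrite EXZ // /c /mom4; ring.
rewrite -lee_fin -!EX_E //; last exact: L1Z.
apply: ae_ge0_le_integral => //.
- by move=> x _; rewrite lee_fin.
- exact/measurable_EFinP.
- by move=> x _; rewrite lee_fin mulr_ge0 // addr_ge0 ?exprn_even_ge0.
- by apply/measurable_EFinP/measurable_funM => //; exact: (L1_meas i4).
exists [set x : R | x < 0]; split => //.
  by rewrite (_ : [set _ | _] = `]-oo, 0[%classic) //; apply/seteqP; split=> x /=; rewrite in_itv.
move=> x /= /not_implyP[_] /negP; rewrite lee_fin -ltNge => h.
rewrite ltNge; apply/negP => x0; move: h; apply/negP; rewrite -leNgt /g.
have e1 := quant_err k x0; have e0 := quant_le k x0.
apply: (@le_trans _ _ (((1 + x ^+ 2) / k.+1%:R) ^+ 2)).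
  by rewrite ler_pXn2r ?nnegrE ?subr_ge0 ?divr_ge0 ?addr_ge0 ?sqr_ge0.
rewrite expr_div_n /c [leRHS]mulrAC ler_wpM2r ?invr_ge0 ?exprn_ge0 //.
rewrite -subr_ge0 (_ : _ - _ = (x ^+ 2 - 1) ^+ 2) ?sqr_ge0 //; ring.
Qed.

Section level.
Variable k : nat.
Local Notation A := 'I_(k.+1 * k.+1).+1.

Definition pquant (a : A) : R := fine (mu (qidx k @^-1` [set a])).

Lemma pquant_ge0 a : 0 <= pquant a.
Proof. exact: fine_ge0. Qed.

Lemma pquantE a : mu (qidx k @^-1` [set a]) = (pquant a)%:E.
Proof. by rewrite /pquant fineK // fin_num_measure //; exact: measurable_qidx. Qed.

Lemma pquant_sum (Q : pred A) :
  \sum_(a | Q a) pquant a = fine (mu [set x : R | Q (qidx k x)]).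
Proof.
have mq (a : A) : measurable (@qidx R k @^-1` [set a]) by exact: measurable_qidx.
have mS : measurable [set x : R | Q (qidx k x)].
  rewrite (_ : [set _ | _] = (\bigcup_(a in [set a : A | Q a]) (@qidx R k @^-1` [set a]))%classic).
    by apply: fin_bigcup_measurable.
  by apply/seteqP; split=> x /= => [h|[a /= Qa ->]//]; exists (qidx k x).
rewrite -(EX_indic _ mS).
rewrite (eq_EX _ (G := fun x => \sum_a (Q a)%:R * \1_(@qidx R k @^-1` [set a]) x)); last first.
  move=> x; rewrite (bigD1 (qidx k x)) //= big1 ?addr0.
    rewrite [in RHS]indicE mem_set // mulr1 indicE; congr (nat_of_bool _)%:R.
    by apply/idP/idP; rewrite inE.
  by move=> a ne; rewrite indicE memNset ?mulr0 // => /= e; rewrite e eqxx in ne.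
rewrite EX_sum; last by move=> a; apply: L1Z; apply: L1_indic.
rewrite [LHS]big_mkcond; apply: eq_bigr => a _; rewrite EXZ; last exact: L1_indic.
by rewrite EX_indic // -/(pquant a); case: (Q a); rewrite ?mul1r ?mul0r.
Qed.

Lemma pquant_sum1 : \sum_a pquant a = 1.
Proof.
rewrite (pquant_sum xpredT) (_ : [set _ | _] = setT) ?(@probability_setT _ _ _ mu) //.
by apply/seteqP; split.
Qed.

Section family.
Variables (I : finType) (iota : I -> {fset V}).
Hypothesis iota_inj : injective iota.
Hypothesis iota_edge : forall i, is_edge adj (iota i).

(** The edges are read through an injection [iota], which will be either the inclusion of an edge
    set or its composition with an automorphism; both families then get the same product law. *)
Definition qweight (t : T) : {ffun I -> A} := [ffun i => qidx k (w (iota i) t)].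

Lemma qweight_meas i a : measurable ((fun t => qidx k (w (iota i) t)) @^-1` [set a]).
Proof.
have := w_meas (iota_edge i) measurableT (measurable_qidx a).
by rewrite setTI.
Qed.

(** Independence speaks of events indexed by edges, so [B] transports the prescribed values along
    [iota] and is the whole line off its image. *)
Lemma qweight_law (a : {ffun I -> A}) :
  P [set t | forall i, qidx k (w (iota i) t) = a i] = (\prod_i pquant (a i))%:E.
Proof.
pose B (f : {fset V}) : set R :=
  if [pick i | iota i == f] is Some i then qidx k @^-1` [set a i] else setT.
have Bi i : B (iota i) = qidx k @^-1` [set a i].
  by rewrite /B; case: pickP => [j /eqP/iota_inj -> //|/(_ i)]; rewrite eqxx.
have := @w_indep (map iota (enum I)) B.
rewrite (map_inj_uniq iota_inj) enum_uniq => h.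
have -> : [set t | forall i, qidx k (w (iota i) t) = a i] =
   (\bigcap_(f in [set f | f \in map iota (enum I)]) (w f @^-1` B f))%classic.
  apply/seteqP; split=> t /=.
    by move=> ha f /= /mapP[i _ ->]; rewrite /= Bi /=; exact: ha.
  move=> ha i; have := ha (iota i); rewrite /= Bi /=; apply.
  by apply/mapP; exists i; rewrite // mem_enum.
rewrite h //; last 2 first.
- by move=> f /mapP[i _ ->].
- by move=> f; rewrite /B; case: pickP => // i _; exact: measurable_qidx.
rewrite big_map big_enum /= -prodEFin; apply: eq_bigr => i _.
by rewrite w_law // Bi ?pquantE //; exact: measurable_qidx.
Qed.

Lemma qweight_L1 (Phi : {ffun I -> A} -> R) : L1 P (fun t => Phi (qweight t)).
Proof. exact: (L1_config _ qweight_meas). Qed.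

Lemma qweight_EX (Phi : {ffun I -> A} -> R) :
  EX P (fun t => Phi (qweight t)) = fE pquant Phi.
Proof. exact: (EX_config qweight_meas qweight_law). Qed.

End family.
End level.

Hypothesis adj_simple : simple_graph adj.
Hypothesis adj_lf : locally_finite adj.
Hypothesis adj_vt : vertex_transitive adj.

Definition restr (H : {fset {fset V}}) k (x : {ffun H -> 'I_(k.+1 * k.+1).+1}) (f : {fset V}) : R :=
  if insub f is Some i then qval R (x i) else 0.

Lemma restr_in (H : {fset {fset V}}) k (x : {ffun H -> 'I_(k.+1 * k.+1).+1}) f (fH : f \in H) :
  restr x f = qval R (x [` fH]).
Proof. by rewrite /restr insubT. Qed.

Lemma restr_ge0 (H : {fset {fset V}}) k (x : {ffun H -> 'I_(k.+1 * k.+1).+1}) f : 0 <= restr x f.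
Proof. by rewrite /restr; case: insubP => // i _ _; exact: qval_ge0. Qed.

Definition ball_moment k r u v : R :=
  EX P (fun t => minimax (gballE adj u r) u v (fun f => quant k (w f t)) ^+ 2).

Definition qw k t (f : {fset V}) : R := quant k (w f t).

Lemma qw_ge0 k t f : 0 <= qw k t f.
Proof. exact: qval_ge0. Qed.

Lemma minimax_qw (H : {fset {fset V}}) k u v t (iota : H -> {fset V}) (g : {fset V} -> {fset V}) :
  (forall i, iota i = g (val i)) -> [fset u; v] \in H ->
  minimax H u v (qw k t \o g) = minimax H u v (@restr H k (qweight k iota t)).
Proof.
move=> ig eH.
have h f : f \in H -> (qw k t \o g) f = @restr H k (qweight k iota t) f.
  by move=> fH; rewrite restr_in ffunE ig.
apply: minimax_local => //; [exact: qw_ge0|exact: h].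
Qed.

Lemma gballE_inj_edge u r (i : gballE adj u r) : is_edge adj (val i).
Proof. by apply: (gballE_edge adj_lf) (valP i). Qed.

(** The radius is a successor so that the edge uv lies in the ball and its weight is part of the
    configuration. *)
Lemma ball_moment_fE k r u v : adj u v ->
  L1 P (fun t => minimax (gballE adj u r.+1) u v (qw k t) ^+ 2) /\
  ball_moment k r.+1 u v =
  fE (@pquant k) (fun x : {ffun gballE adj u r.+1 -> _} => minimax (gballE adj u r.+1) u v (restr x) ^+ 2).
Proof.
move=> uv; have eH := gballE_self adj_lf r uv.
have E t : minimax (gballE adj u r.+1) u v (qw k t) ^+ 2 =
   minimax (gballE adj u r.+1) u v (@restr (gballE adj u r.+1) k (qweight k val t)) ^+ 2.
  by congr (_ ^+ 2); exact: (@minimax_qw _ k u v t val id).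
split.
  rewrite (_ : (fun t => _) = (fun t => minimax (gballE adj u r.+1) u v (@restr (gballE adj u r.+1) k (qweight k val t)) ^+ 2)).
    exact: (qweight_L1 (@gballE_inj_edge u r.+1) (fun x => minimax (gballE adj u r.+1) u v (@restr (gballE adj u r.+1) k x) ^+ 2)).
  by apply/funext.
rewrite -(qweight_EX val_inj (@gballE_inj_edge u r.+1)); exact: eq_EX.
Qed.

(** The images of the edges of the ball are again distinct edges, so their rounded weights have the
    same product law. *)
Lemma ball_moment_automorphism k r u v phi : adj u v -> automorphism adj phi ->
  ball_moment k r.+1 (phi u) (phi v) = ball_moment k r.+1 u v.
Proof.
move=> uv aphi; rewrite (ball_moment_fE k r uv).2.
pose iota (i : gballE adj u r.+1) := edge_map phi (val i).
have iinj : injective iota.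
  move=> i j e; apply: val_inj; have inj := bij_inj aphi.1.
  apply/fsetP => x; have := congr1 (fun f : {fset V} => phi x \in f) e.
  by rewrite /iota /edge_map !mem_imfset.
have iedge i : is_edge adj (iota i).
  have [x [y [xy e]]] := gballE_inj_edge i.
  by exists (phi x), (phi y); rewrite aphi.2 /iota e edge_map2.
rewrite -(qweight_EX iinj iedge); apply: eq_EX => t; congr (_ ^+ 2).
rewrite minimax_automorphism //; last exact: qw_ge0.
by apply: minimax_qw => //; exact: gballE_self.
Qed.

Lemma ball_moment_antimono k r s u v : adj u v -> (r <= s)%N -> ball_moment k s.+1 u v <= ball_moment k r.+1 u v.
Proof.
move=> uv rs; apply: EX_le.
- exact: (ball_moment_fE k s uv).1.
- exact: (ball_moment_fE k r uv).1.
move=> t; rewrite ler_pXn2r ?nnegrE ?minimax_ge0 ?qw_ge0 //; try exact: qw_ge0.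
by apply: minimax_antimono; [exact: qw_ge0|exact: (gballE_mono adj_lf)].
Qed.

Lemma ball_moment_ge0 k r u v : 0 <= ball_moment k r u v.
Proof. by apply: EX_ge0 => t; exact: sqr_ge0. Qed.

(** The bound is uniform in [r]. With [D] the minimax of the unrounded weights, the minimax of the
    rounded ones lies between [quant D] and [D], so it is off by at most (1 + w^2) / (k + 1).
    Factoring the difference of squares costs a further factor 2 w, and the resulting cubic is below
    4 (1 + w^4). *)
Lemma ball_moment_level k l r u v : adj u v ->
  `|ball_moment k r.+1 u v - ball_moment l r.+1 u v| <= 4 * mom4 * (k.+1%:R^-1 + l.+1%:R^-1).
Proof.
move=> uv; set H := gballE adj u r.+1; set e := [fset u; v].
have he : is_edge adj e by exists u, v.
have [i4 m4] := edge_moment he.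
have Lk := (ball_moment_fE k r uv).1; have Ll := (ball_moment_fE l r uv).1.
rewrite -EXB //; apply: le_trans (EX_abs_le _) _; first exact: L1B.
have -> : 4 * mom4 * (k.+1%:R^-1 + l.+1%:R^-1) =
   EX P (fun t => (4 * (k.+1%:R^-1 + l.+1%:R^-1)) * (1 + w e t ^+ 4)).
  by rewrite EXZ // m4; ring.
apply: EX_le; [by apply: L1_abs; exact: L1B|exact: L1Z|] => t.
(* A weight may be negative on a null set; its positive part rounds to the same value, so the
   comparison holds for every [t]. *)
pose wp f := Num.max 0 (w f t).
have wp0 f : 0 <= wp f by rewrite le_max lexx.
have qwp j f : qw j t f = quant j (wp f).
  rewrite /qw /wp; case: (lerP (w f t) 0) => h; last by [].
  by rewrite quant_neg // quant0.
pose D := minimax H u v wp.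
have D0 : 0 <= D by exact: minimax_ge0.
have Dw : D <= wp e by exact: minimax_le_w.
have De j : 0 <= D - minimax H u v (qw j t) <= (1 + wp e ^+ 2) / j.+1%:R.
  apply/andP; split.
    rewrite subr_ge0; apply: minimax_mono => [||f _]; rewrite ?qwp ?quant_le //.
    exact: qval_ge0.
  apply: (@le_trans _ _ (D - quant j D)).
    have q0 : quant j 0 = 0 :> R by exact: quant0.
    have h := @minimax_comp V R (quant j) H u v wp (@quant_mono R j) q0 (wp0 e).
    rewrite lerD2l lerN2; apply: le_trans h _.
    by rewrite le_eqVlt; apply/orP; left; apply/eqP; congr (minimax _ _ _ _); apply/funext => f /=; rewrite qwp.
  apply: le_trans (quant_err j D0) _.
  by rewrite ler_wpM2r ?invr_ge0 // lerD2l ler_pXn2r ?nnegrE.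
have Dj0 j : 0 <= minimax H u v (qw j t) by apply: minimax_ge0; exact: qw_ge0.
have wpe : (1 + wp e ^+ 2) * (2 * wp e) <= 4 * (1 + w e t ^+ 4).
  rewrite /wp; case: (lerP (w e t) 0) => h.
    by rewrite mulr0 mulr0 mulr_ge0 // addr_ge0 ?exprn_even_ge0.
  set y := w e t; have y0 : 0 <= y by exact: ltW.
  have h1 := sqr_ge0 (y ^+ 2 - y); have h2 := sqr_ge0 (y ^+ 2 - 1); have h3 := sqr_ge0 (y - 1).
  have e1 : (y ^+ 2 - y) ^+ 2 = y ^+ 4 - 2 * y ^+ 3 + y ^+ 2 by ring.
  have e2 : (y ^+ 2 - 1) ^+ 2 = y ^+ 4 - 2 * y ^+ 2 + 1 by ring.
  have e3 : (y - 1) ^+ 2 = y ^+ 2 - 2 * y + 1 by ring.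
  have e4 : (1 + y ^+ 2) * (2 * y) = 2 * y + 2 * y ^+ 3 by ring.
  rewrite e1 in h1; rewrite e2 in h2; rewrite e3 in h3; rewrite e4.
  have := sqr_ge0 y; lra.
set a := minimax H u v (qw k t); set b := minimax H u v (qw l t).
have -> : a ^+ 2 - b ^+ 2 = ((D - b) - (D - a)) * (a + b) by ring.
rewrite normrM.
have ak := De k; have bl := De l; rewrite -/a -/b in ak bl.
have ab2 : `|a + b| <= 2 * wp e.
  rewrite ger0_norm; last by rewrite addr_ge0 ?Dj0.
  by move/andP: ak => [? _]; move/andP: bl => [? _]; lra.
have abd : `|D - b - (D - a)| <= (1 + wp e ^+ 2) * (k.+1%:R^-1 + l.+1%:R^-1).
  rewrite mulrDr; move: ak bl => /andP[a1 a2] /andP[b1 b2].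
  move: a1 a2 b1 b2; move: (_ / k.+1%:R) (_ / l.+1%:R) => X Y a1 a2 b1 b2.
  by rewrite ler_norml; apply/andP; split; lra.
apply: le_trans (ler_pM _ _ abd ab2) _ => //.
have kl0 : 0 <= k.+1%:R^-1 + l.+1%:R^-1 :> R by rewrite addr_ge0.
set kap := k.+1%:R^-1 + l.+1%:R^-1 in kl0 *.
have -> : (1 + wp e ^+ 2) * kap * (2 * wp e) = kap * ((1 + wp e ^+ 2) * (2 * wp e)) by ring.
have -> : 4 * kap * (1 + w e t ^+ 4) = kap * (4 * (1 + w e t ^+ 4)) by ring.
exact: ler_wpM2l.
Qed.

Lemma nonincreasing_nonneg_cauchy (a : nat -> R) (eps : R) : 0 < eps ->
  (forall r, 0 <= a r) -> (forall r s, (r <= s)%N -> a s <= a r) ->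
  exists r, forall s, a r - a s <= eps.
Proof.
move=> e0 a0 am; pose S := [set x | exists r, x = a r].
have hS : has_inf S by split; [exists (a 0%N), 0%N|exists 0 => _ [r ->]].
have [_ [r ->] hr] := inf_adherent e0 hS.
exists r => s; have : inf S <= a s by apply: ge_inf; [exact: hS.2|exists s].
by move: hr; lra.
Qed.

Lemma close_differences (a b x y e : R) :
  `|a - x| <= e / 3 -> `|b - y| <= e / 3 -> x - y <= e / 3 -> a - b <= e.
Proof. by rewrite !ler_norml => /andP[? ?] /andP[? ?] ?; lra. Qed.

(** The radius has to serve all edges and all fine levels at once, since the level will depend on
    the graph. It is found at the single level [k0] for the finitely many edges at [v0];
    automorphisms carry it to every edge, and [ball_moment_level] to every level from [k0] on. *)
Lemma ball_moment_stable (eps : R) : 0 < eps ->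
  exists r k0, forall k s u v, (k0 <= k)%N -> (r <= s)%N -> adj u v ->
    ball_moment k r.+1 u v - ball_moment k s.+1 u v <= eps.
Proof.
move=> e0; have [[v0 _]|nV] := pselect (exists v : V, True); last first.
  by exists 0%N, 0%N => k s u v; case: nV; exists v.
have m0 : 0 < mom4 by apply: lt_le_trans mom4_ge1.
(* 24 = 4 * 2 * 3: each change of level then costs at most eps / 3. *)
pose k0 := Num.truncn (24 * mom4 / eps).
have hk0 k : (k0 <= k)%N -> k.+1%:R^-1 <= eps / (24 * mom4).
  move=> kk; rewrite -[eps / _]invf_div lef_pV2 ?posrE ?divr_gt0 ?mulr_gt0 //.
  have xb0 : 0 <= 24 * mom4 / eps by rewrite divr_ge0 ?mulr_ge0 // ltW.
  have /andP[_ /ltW h] := truncn_itv xb0; apply: le_trans h _.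
  by rewrite ler_nat ltnS.
have [r hr] : exists r, forall s y, y \in nbr adj v0 ->
    ball_moment k0 r.+1 v0 y - ball_moment k0 s.+1 v0 y <= eps / 3.
  suff h (l : seq V) : (forall y, y \in l -> adj v0 y) ->
     exists r, forall s y, y \in l -> ball_moment k0 r.+1 v0 y - ball_moment k0 s.+1 v0 y <= eps / 3.
    by have [|r hr] := h (nbr adj v0); [move=> y; rewrite in_nbr|exists r].
  elim: l => [|y l IH] hl; first by exists 0%N.
  have [|r1 h1] := IH; first by move=> z zl; apply: hl; rewrite inE zl orbT.
  have vy : adj v0 y by apply: hl; rewrite inE eqxx.
  have [|||r2 h2] := @nonincreasing_nonneg_cauchy (fun r => ball_moment k0 r.+1 v0 y) (eps / 3).
  - by rewrite divr_gt0.
  - by move=> r; exact: ball_moment_ge0.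
  - by move=> a b; exact: ball_moment_antimono.
  exists (maxn r1 r2) => s z; rewrite inE => /orP[/eqP ->|zl].
    apply: le_trans (h2 s); rewrite lerD2r; apply: ball_moment_antimono => //; exact: leq_maxr.
  have v0z : adj v0 z by apply: hl; rewrite inE zl orbT.
  apply: le_trans (h1 s z zl); rewrite lerD2r; apply: ball_moment_antimono => //; exact: leq_maxl.
exists r, k0 => k s u v kk rs uv.
have [phi [aphi phiu]] := adj_vt v0 u.
have [psi [apsi pK qK]] := automorphism_inv aphi.
have v0y : adj v0 (psi v) by rewrite -aphi.2 phiu qK.
rewrite -phiu -(qK v) !ball_moment_automorphism //.
have h := hr s (psi v); rewrite in_nbr // in h; have {}h := h v0y.
have a1 := @ball_moment_level k k0 r v0 (psi v) v0y.
have a2 := @ball_moment_level k k0 s v0 (psi v) v0y.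
have b : 4 * mom4 * (k.+1%:R^-1 + k0.+1%:R^-1) <= eps / 3.
  apply: (@le_trans _ _ (4 * mom4 * (eps / (24 * mom4) + eps / (24 * mom4)))).
    by rewrite ler_wpM2l ?mulr_ge0 ?(ltW m0) // lerD ?hk0.
  rewrite le_eqVlt; apply/orP; left; apply/eqP; field.
  by rewrite gt_eqF.
exact: (close_differences (le_trans a1 b) (le_trans a2 b) h).
Qed.

Variables (src dst : {fset V} -> V).
Hypothesis ends_adj : forall e, is_edge adj e -> adj (src e) (dst e).
Hypothesis ends_eq : forall e, is_edge adj e -> e = [fset src e; dst e].
Variable D : nat.
Hypothesis degD : forall v, (#|` nbr adj v| <= D)%N.

Lemma sum_sqr_le (J : finType) (a : J -> R) :
  (\sum_j a j) ^+ 2 <= #|J|%:R * \sum_j a j ^+ 2.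
Proof.
rewrite expr2 mulr_suml.
apply: (@le_trans _ _ (\sum_i \sum_j (a i ^+ 2 / 2 + a j ^+ 2 / 2))).
  apply: ler_sum => i _; rewrite mulr_sumr; apply: ler_sum => j _.
  have := sqr_ge0 (a i - a j).
  have -> : (a i - a j) ^+ 2 = a i ^+ 2 - 2 * (a i * a j) + a j ^+ 2 by ring.
  lra.
rewrite (eq_bigr (fun i => #|J|%:R * (a i ^+ 2 / 2) + \sum_j a j ^+ 2 / 2)); last first.
  by move=> i _; rewrite big_split /= sumr_const mulr_natl.
rewrite big_split /= sumr_const -mulr_sumr -mulr_suml -[X in _ + X]mulr_natl.
rewrite le_eqVlt; apply/orP; left; apply/eqP; by field.
Qed.

(** * One finite graph at one rounding level *)

Section PerGraph.
Variables (Vs : {fset V}) (Es : {fset {fset V}}) (k : nat).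
Hypothesis sG : subgraph_of adj Vs Es.
Hypothesis cE : connected_on Vs Es.
Local Notation A := 'I_(k.+1 * k.+1).+1.
Local Notation cfg := {ffun Es -> A}.
Local Notation p := (@pquant k).
Implicit Types (i j : Es) (x y z : cfg).

Let p0 := @pquant_ge0 k.
Let p1 := @pquant_sum1 k.

Definition res x : {fset V} -> R := @restr Es k x.

Lemma EsV f : f \in Es -> f `<=` Vs. Proof. by move=> /sG[]. Qed.

Lemma val_edge i : is_edge adj (val i). Proof. by have [] := sG (valP i). Qed.

Lemma res_val x i : res x (val i) = qval R (x i).
Proof. by rewrite /res /restr valK. Qed.

Lemma res_ge0 x f : 0 <= res x f. Proof. exact: restr_ge0. Qed.

Lemma ends_val i : [fset src (val i); dst (val i)] = val i.
Proof. by rewrite -ends_eq //; exact: val_edge. Qed.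

(* Increments of the edge i: [Hn] on the whole graph, [Dn] on the ball of radius
   r + 1 around an endpoint, [Gn] its truncation; [Ln] is the locally dependent
   martingale approximating [Fn - E Fn]. *)
Definition Fn x : R := mst_weight (res x) Vs Es.
Definition Hn i x : R := minimax Es (src (val i)) (dst (val i)) (res x).
Definition Dn r i x : R :=
  minimax (gballE adj (src (val i)) r.+1) (src (val i)) (dst (val i)) (res x).
Definition good r i := gballE adj (src (val i)) r.+1 `<=` Es.
Definition Gn r (Kt : R) i x : R := if good r i then Num.min (Dn r i x) Kt else 0.
Definition Ln r (Kt : R) x : R := \sum_i mdiff p i (Gn r Kt i) x.

(** The tree weight minus the increment of [i] no longer involves the weight of [i], so both have
    the same [i]-th martingale difference. *)
Lemma Fn_Hn i x : Fn x - Hn i x = mst_weight (zero_at (val i) (res x)) Vs Es.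
Proof.
have := @mst_minimax V R Vs Es EsV cE (src (val i)) (dst (val i)) (res x).
rewrite ends_val => h; rewrite /Hn -h; [by rewrite /Fn; ring| |exact: valP].
by move=> f _; exact: res_ge0.
Qed.

Lemma mst_local (u v : {fset V} -> R) : (forall f, f \in Es -> u f = v f) ->
  mst_weight u Vs Es = mst_weight v Vs Es.
Proof.
move=> uv; apply/eqP; rewrite -subr_eq0 -normr_le0.
apply: le_trans (mst_lipschitz EsV cE _ _) _.
by rewrite big_seq big1 // => f fE; rewrite uv // subrr normr0.
Qed.

Lemma zero_at_res_upd i a x f : zero_at (val i) (res (upd i a x)) f = zero_at (val i) (res x) f.
Proof.
rewrite /zero_at; case: eqP => // ne; rewrite /res /restr; case: insubP => // j _ jf.
by rewrite /upd ffunE; case: eqP => // ji; case: ne; rewrite -jf ji.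
Qed.

Lemma mdiff_Fn i x : mdiff p i Fn x = mdiff p i (Hn i) x.
Proof.
apply: mdiff_indep => {}x y xy; rewrite !Fn_Hn; apply: mst_local => f fE.
rewrite /zero_at; case: eqP => // ne; rewrite /res (restr_in _ fE) (restr_in _ fE).
rewrite xy // !inE; apply/eqP => e; apply: ne; by rewrite -e.
Qed.

Lemma Hn_ge0 i x : 0 <= Hn i x.
Proof. by apply: minimax_ge0; exact: res_ge0. Qed.

Lemma Hn_le i x : Hn i x <= qval R (x i).
Proof.
rewrite -res_val; have := @minimax_le_w V R (src (val i)) (dst (val i)) (res x) (res_ge0 x _) Es.
by rewrite ends_val.
Qed.

Lemma Dn_ge0 r i x : 0 <= Dn r i x.
Proof. by apply: minimax_ge0; exact: res_ge0. Qed.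

Lemma Dn_le r i x : Dn r i x <= qval R (x i).
Proof.
rewrite -res_val; have := @minimax_le_w V R (src (val i)) (dst (val i)) (res x) (res_ge0 x _) (gballE adj (src (val i)) r.+1).
by rewrite ends_val.
Qed.

Lemma Hn_le_Dn r i x : good r i -> Hn i x <= Dn r i x.
Proof. by move=> g; apply: minimax_antimono => //; exact: res_ge0. Qed.

Lemma fE_moment i : fE p (fun x => 1 + qval R (x i) ^+ 4) <= mom4.
Proof.
rewrite -(qweight_EX val_inj val_edge (fun x => 1 + qval R (x i) ^+ 4)).
have [i4 m4] := edge_moment (val_edge i); rewrite -m4.
apply: EX_le => //.
  exact: (qweight_L1 val_edge (fun x => 1 + qval R (x i) ^+ 4)).
move=> t; rewrite lerD2l ffunE -/(quant k (w (val i) t)).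
case: (lerP 0 (w (val i) t)) => h.
  by rewrite ler_pXn2r ?nnegrE ?qval_ge0 // quant_le.
by rewrite quant_neg ?(ltW h) // expr0n exprn_even_ge0.
Qed.

Lemma fE_le_moment i (F : cfg -> R) : (forall x, F x <= 1 + qval R (x i) ^+ 4) ->
  fE p F <= mom4.
Proof. by move=> h; apply: le_trans (fE_moment i); exact: le_fE. Qed.

Lemma sqr_le_moment (y : R) : y ^+ 2 <= 1 + y ^+ 4.
Proof.
have := sqr_ge0 (y ^+ 2 - 1); have := sqr_ge0 y.
have -> : (y ^+ 2 - 1) ^+ 2 = y ^+ 4 - 2 * y ^+ 2 + 1 by ring.
lra.
Qed.

Lemma fE_Hn_sqr i : fE p (fun x => Hn i x ^+ 2) <= mom4.
Proof.
apply: (fE_le_moment (i := i)) => x; apply: le_trans (sqr_le_moment _).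
by rewrite ler_pXn2r ?nnegrE ?Hn_ge0 ?qval_ge0 // Hn_le.
Qed.

Lemma Fn_centered x : Fn x - fE p Fn = \sum_i mdiff p i (Hn i) x.
Proof. by rewrite -(mdiff_sum p1); apply: eq_bigr => i _; rewrite mdiff_Fn. Qed.

Lemma variance_upper : fE p (fun x => (Fn x - fE p Fn) ^+ 2) <= #|` Es|%:R * mom4.
Proof.
rewrite (eq_fE p (G := fun x => (\sum_i mdiff p i (Hn i) x) ^+ 2)); last first.
  by move=> x; rewrite Fn_centered.
rewrite (fE_sum_mdiff_sqr p1).
apply: (@le_trans _ _ (\sum_(i : Es) mom4)).
  by apply: ler_sum => i _; apply: le_trans (fE_Hn_sqr i); exact: fE_mdiff_sqr.
by rewrite sumr_const -[leLHS]mulr_natl cardfE.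
Qed.

(** On a good edge 0 <= H <= D, hence (D - H)^2 <= D^2 - H^2. The mean of D^2 is a ball moment at
    radius r + 1, and that of H^2 is at least the moment on a ball containing the whole graph. *)
Lemma local_error r s i : good r i -> Es `<=` gballE adj (src (val i)) s.+1 ->
  fE p (fun x => (Dn r i x - Hn i x) ^+ 2) <=
  ball_moment k r.+1 (src (val i)) (dst (val i)) - ball_moment k s.+1 (src (val i)) (dst (val i)).
Proof.
move=> g Es_s; set u := src (val i); set v := dst (val i).
have uv : adj u v by apply: ends_adj; exact: val_edge.
have eE : [fset u; v] \in Es by rewrite ends_val; exact: valP.
apply: (@le_trans _ _ (fE p (fun x => Dn r i x ^+ 2 - Hn i x ^+ 2))).
  apply: le_fE => // x; have h0 := Hn_ge0 i x; have h1 := Hn_le_Dn x g.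
  rewrite -subr_ge0.
  have -> : Dn r i x ^+ 2 - Hn i x ^+ 2 - (Dn r i x - Hn i x) ^+ 2 =
    2 * (Hn i x * (Dn r i x - Hn i x)) by ring.
  by rewrite !mulr_ge0 // subr_ge0.
rewrite -(qweight_EX val_inj val_edge (fun x => Dn r i x ^+ 2 - Hn i x ^+ 2)).
have [Lr _] := ball_moment_fE k r uv; have [Ls _] := ball_moment_fE k s uv.
rewrite /ball_moment -(EXB Lr Ls).
apply: (EX_le (qweight_L1 val_edge (fun x => Dn r i x ^+ 2 - Hn i x ^+ 2)) (L1B Lr Ls)) => t.
 have qr f : f \in Es -> res (qweight k val t) f = qw k t f.
  by move=> fE; rewrite /res (restr_in _ fE) ffunE.
have eD : Dn r i (qweight k val t) = minimax (gballE adj u r.+1) u v (qw k t).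
  apply: minimax_local; [exact: res_ge0|exact: qr|].
  by move=> f fb; apply: qr; exact: (fsubsetP g).
have eH : Hn i (qweight k val t) = minimax Es u v (qw k t).
  by apply: minimax_local; [exact: res_ge0|exact: qr|exact: qr].
have m0 H : 0 <= minimax H u v (qw k t) by apply: minimax_ge0; exact: qw_ge0.
rewrite eD eH lerD2l lerN2 ler_pXn2r ?nnegrE ?m0 //.
by apply: minimax_antimono Es_s; exact: qw_ge0.
Qed.

(** Where the truncation acts, (D - Kt) Kt <= D^2, and D is at most the weight of the edge. *)
Lemma trunc_error r (Kt : R) i : 0 < Kt ->
  fE p (fun x => (Dn r i x - Num.min (Dn r i x) Kt) ^+ 2) <= mom4 / Kt ^+ 2.
Proof.
move=> K0; rewrite ler_pdivlMr ?exprn_gt0 // mulrC -fEZ.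
apply: (fE_le_moment (i := i)) => x.
have d0 := Dn_ge0 r i x; have dw := Dn_le r i x; have q0 := qval_ge0 R (x i).
have h4 : Dn r i x ^+ 4 <= qval R (x i) ^+ 4 by rewrite ler_pXn2r ?nnegrE.
case: (lerP (Dn r i x) Kt) => h.
  by rewrite subrr expr0n mulr0 addr_ge0 ?exprn_ge0.
apply: (@le_trans _ _ (Dn r i x ^+ 4)); last by lra.
rewrite -exprMn -[4%N]/(2 * 2)%N exprM ler_pXn2r ?nnegrE ?mulr_ge0 ?exprn_ge0 ?subr_ge0 ?(ltW h) ?(ltW K0) //.
by rewrite expr2; apply: ler_pM; rewrite ?subr_ge0 ?(ltW h) ?(ltW K0) // gerBl ltW.
Qed.

Lemma Gn_error r s (Kt eps : R) i : 0 < Kt -> 0 <= eps ->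
  Es `<=` gballE adj (src (val i)) s.+1 ->
  ball_moment k r.+1 (src (val i)) (dst (val i)) - ball_moment k s.+1 (src (val i)) (dst (val i)) <= eps ->
  fE p (fun x => (Hn i x - Gn r Kt i x) ^+ 2) <=
    2 * eps + 2 * mom4 / Kt ^+ 2 + (~~ good r i)%:R * mom4.
Proof.
move=> K0 e0 Es_s ae; have m1 := le_trans ler01 mom4_ge1.
have mK : 0 <= 2 * mom4 / Kt ^+ 2 by rewrite divr_ge0 ?mulr_ge0 ?exprn_ge0 ?(ltW K0).
have [g|g] := boolP (good r i).
  rewrite mul0r addr0.
  apply: (@le_trans _ _ (2 * fE p (fun x => (Dn r i x - Hn i x) ^+ 2) +
     2 * fE p (fun x => (Dn r i x - Num.min (Dn r i x) Kt) ^+ 2))).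
    rewrite -!fEZ -fED; apply: (le_fE p0) => x; rewrite /Gn g.
    set a := Dn r i x - Hn i x; set b := Dn r i x - Num.min (Dn r i x) Kt.
    have -> : Hn i x - Num.min (Dn r i x) Kt = b - a by rewrite /a /b; ring.
    have := sqr_ge0 (a + b); rewrite -subr_ge0 => h.
    rewrite -subr_ge0 (_ : _ - _ = (a + b) ^+ 2) ?sqr_ge0 //; ring.
  apply: lerD; first by apply: ler_wpM2l => //; exact: le_trans (local_error g Es_s) ae.
  by rewrite -mulrA; apply: ler_wpM2l => //; exact: trunc_error.
rewrite mul1r; apply: (@le_trans _ _ mom4); last by rewrite lerDr addr_ge0 // mulr_ge0.
apply: le_trans (fE_Hn_sqr i); apply: (le_fE p0) => x; rewrite /Gn (negPf g) subr0 //.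
Qed.

Lemma Ln_error r s (Kt eps : R) : 0 < Kt -> 0 <= eps ->
  (forall i, Es `<=` gballE adj (src (val i)) s.+1) ->
  (forall u v, adj u v -> ball_moment k r.+1 u v - ball_moment k s.+1 u v <= eps) ->
  fE p (fun x => (Fn x - fE p Fn - Ln r Kt x) ^+ 2) <=
    #|` Es|%:R * (2 * eps + 2 * mom4 / Kt ^+ 2) + #|[set i | ~~ good r i]%SET|%:R * mom4.
Proof.
move=> K0 e0 Es_s ae.
rewrite (eq_fE p (G := fun x => (\sum_i mdiff p i (fun y => Hn i y - Gn r Kt i y) x) ^+ 2)); last first.
  move=> x; rewrite Fn_centered /Ln -sumrB; congr (_ ^+ 2).
  by apply: eq_bigr => i _; rewrite mdiffB.
rewrite (fE_sum_mdiff_sqr p1).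
apply: (@le_trans _ _ (\sum_(i : Es) (2 * eps + 2 * mom4 / Kt ^+ 2 + (~~ good r i)%:R * mom4))).
  apply: ler_sum => i _; apply: le_trans (fE_mdiff_sqr p0 p1 _ _) _.
  apply: (Gn_error K0 e0 (Es_s i)); apply: ae; apply: ends_adj; exact: val_edge.
rewrite big_split /= sumr_const -[X in X + _]mulr_natl -cardfE -mulr_suml lerD2l.
rewrite ler_wpM2r ?(le_trans ler01 mom4_ge1) // -natr_sum ler_nat.
by rewrite -sum1dep_card [leqRHS]big_mkcond /=; apply: leq_sum => i _; case: (good r i).
Qed.

(** The source of a bad edge is a vertex whose ball is not contained in the graph, and at most [D]
    edges share a source. *)
Lemma bad_edges r : (#|[set i | ~~ good r i]%SET| <=
  #|` [fset v in Vs | ~~ `[< ball_in adj v (r.+1%:R : R) Vs Es >]]%fset| * D)%N.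
Proof.
set bad := [fset v in Vs | _]%fset.
pose BE : {fset {fset V}} := [fset f in Es | ~~ (gballE adj (src f) r.+1 `<=` Es)]%fset.
apply: (@leq_trans #|` BE|).
  rewrite cardE -(size_map val); apply: uniq_leq_size.
    by rewrite (map_inj_uniq val_inj) enum_uniq.
  move=> f /mapP[i]; rewrite mem_enum !inE => hi ->.
  by rewrite (valP i).
apply: (card_edges_le adj_lf degD) => f; rewrite !inE /= => /andP[fE fb].
have fe : is_edge adj f by have [] := sG fE.
exists (src f), (dst f); split; [|exact: ends_adj|exact: ends_eq].
rewrite !inE /=; apply/andP; split.
  by apply: (fsubsetP (EsV fE)); rewrite [f in _ \in f](ends_eq fe) !inE eqxx.
apply: contra fb => /asboolP[_ h]; apply/fsubsetP => g /(gballEP adj_lf)[x [y [xb yb xy ->]]].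
by apply: h => //; exact: (gball_in_ball adj_lf).
Qed.

Lemma Es_le : (#|` Es| <= #|` Vs| * D)%N.
Proof.
apply: (card_edges_le adj_lf degD) => f fE.
have fe : is_edge adj f by have [] := sG fE.
exists (src f), (dst f); split; [|exact: ends_adj|exact: ends_eq].
by apply: (fsubsetP (EsV fE)); rewrite [f in _ \in f](ends_eq fe) !inE eqxx.
Qed.

(** If all other edges at [u] weigh at least [b], every path from [u] to [v] avoiding the edge [i]
    contains an edge of weight at least [b]; raising the weight of [i] from light to heavy then
    raises the increment from at most [a] to at least [b]. By independence this has probability at
    least q ^ D. Otherwise monotonicity keeps the change nonnegative. *)
Lemma variance_lower (a b q : R) : a < b -> 0 <= q -> q <= 1 ->
  q <= \sum_(c | qval R c <= a) p c -> q <= \sum_(c | b <= qval R c) p c ->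
  #|` Es|%:R * (q ^+ 2 * ((b - a) * q ^+ D) ^+ 2 / 2) <= fE p (fun x => (Fn x - fE p Fn) ^+ 2).
Proof.
move=> ab q0 q1 qa qb.
rewrite (eq_fE p (G := fun x => (\sum_i mdiff p i Fn x) ^+ 2)); last first.
  by move=> x; rewrite (mdiff_sum p1).
rewrite (fE_sum_mdiff_sqr p1).
apply: (@le_trans _ _ (\sum_(i : Es) (q ^+ 2 * ((b - a) * q ^+ D) ^+ 2 / 2))).
  by rewrite sumr_const -[leRHS]mulr_natl cardfE.
apply: ler_sum => i _.
have ba0 : 0 <= b - a by rewrite subr_ge0 ltW.
apply: (@mdiff_sqr_ge _ _ _ _ p0 p1 i Fn (fun c => qval R c <= a) (fun c => b <= qval R c)) => //.
  by rewrite mulr_ge0 // exprn_ge0.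
move=> lo hi lolo hihi.
pose u := src (val i); pose v := dst (val i).
pose J := [set j : Es | (j != i) && (u \in val j)]%SET.
have JD : (#|J| <= D)%N.
  rewrite cardE -(size_map val).
  apply: (@leq_trans #|` [fset [fset u; y] | y in nbr adj u]%fset|); last first.
    by apply: leq_trans (leq_imfset_card _ _ _) _; exact: degD.
  apply: uniq_leq_size; first by rewrite (map_inj_uniq val_inj) enum_uniq.
  move=> f /mapP[j]; rewrite mem_enum !inE => /andP[_ uj] ->.
  have [x [y [xy jE]]] := val_edge j.
  move: uj; rewrite jE !inE => /orP[]/eqP ->; apply/imfsetP.
    by exists y; rewrite //= in_nbr.
  exists x; last exact: fset2C.
  by rewrite /= in_nbr // adj_simple.1.
apply: (@le_trans _ _ ((b - a) * (\sum_(c | b <= qval R c) p c) ^+ #|J|)).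
  rewrite ler_wpM2l //; apply: (@le_trans _ _ (q ^+ #|J|)).
    by apply: ler_wiXn2l.
  by rewrite lerXn2r ?nnegrE ?(le_trans q0 qb).
rewrite -(fE_prod_coord p1 J) -fEZ; apply: (le_fE p0) => z.
have e1 c : Fn (upd i c z) = Hn i (upd i c z) + mst_weight (zero_at (val i) (res z)) Vs Es.
  have -> : mst_weight (zero_at (val i) (res z)) Vs Es = mst_weight (zero_at (val i) (res (upd i c z))) Vs Es.
    by apply: mst_local => f _; rewrite zero_at_res_upd.
  by rewrite -Fn_Hn; ring.
rewrite (e1 hi) (e1 lo).
have -> : forall s t m : R, s + m - (t + m) = s - t by move=> s t m; ring.
have upi c : upd i c z i = c by rewrite /upd ffunE eqxx.
have Hlo : Hn i (upd i lo z) <= a.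
  by apply: le_trans (Hn_le _ _) _; rewrite upi.
have [hJ|nJ] := boolP [forall (j | j \in J), b <= qval R (z j)].
  rewrite big1 ?mulr1; last by move=> j jJ; rewrite (forall_inP hJ j jJ).
  suff hb : b <= Hn i (upd i hi z) by exact: lerB hb Hlo.
  (* The empty path would give [u = v], against irreflexivity; otherwise the first edge of the path
     belongs to [J]. *)
  apply: le_minimax => t [->|[t0 [[|y s] [/= ps ls]]]].
  - by rewrite ends_val res_val upi.
  - have uv := ends_adj (val_edge i).
    by move: uv; rewrite -ls adj_simple.2.
  move: ps => /andP[+ _]; rewrite /fadj !inE /= => /and3P[fE ne ft].
  apply: le_trans ft; rewrite -[[fset u; y]]/(val [` fE]) res_val.
  have ni : [` fE] != i by apply: contra ne => /eqP e; rewrite ends_val -[X in _ == val X]e eqxx.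
  rewrite /upd ffunE (negPf ni); apply: (forall_inP hJ).
  by rewrite inE ni /= !inE eqxx.
move: nJ; rewrite negb_forall => /existsP[j]; rewrite negb_imply => /andP[jJ /negPf h].
rewrite (bigD1 j jJ) /= h mul0r.
rewrite mulr0 subr_ge0; apply: minimax_mono; first exact: res_ge0.
  rewrite ends_val !res_val !upi; apply: le_trans lolo _; apply: le_trans (ltW ab) hihi.
move=> f fE; rewrite -[f]/(val [` fE]) !res_val /upd !ffunE; case: eqP => // _.
apply: le_trans lolo _; exact: le_trans (ltW ab) hihi.
Qed.

(** On a bad edge [Gn] is constant, but [stein_local] asks that [i] belong to its own set, hence the
    singleton. *)
Definition Bset r i : {set Es} :=
  if good r i then [set j : Es | val j \in gballE adj (src (val i)) r.+1]%SET else [set i]%SET.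

Lemma Bset_self r i : i \in Bset r i.
Proof.
rewrite /Bset; case: ifP => _; rewrite inE //.
have h := ends_adj (val_edge i).
by rewrite -{1}[val i]ends_val; exact: (gballE_self adj_lf).
Qed.

Lemma Gn_depends r Kt i : depends (Bset r i) (Gn r Kt i).
Proof.
move=> x y xy; rewrite /Gn; case: ifPn => // g; congr (Num.min _ _).
have xyf f (fE : f \in Es) : f \in gballE adj (src (val i)) r.+1 -> res x f = res y f.
  move=> fb; rewrite /res (restr_in _ fE) (restr_in _ fE) xy //.
  by rewrite /Bset g inE.
have vi : val i \in gballE adj (src (val i)) r.+1.
  by have := Bset_self r i; rewrite /Bset g inE.
apply: minimax_local; first exact: res_ge0.
  by rewrite ends_val; apply: xyf => //; exact: valP.
by move=> f fb; apply: xyf => //; exact: (fsubsetP g).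
Qed.

Lemma Gn_bound r Kt i x : 0 < Kt -> `|Gn r Kt i x| <= Kt.
Proof.
move=> K0; rewrite /Gn; case: ifP => _; last by rewrite normr0 ltW.
rewrite ger0_norm; last by rewrite le_min Dn_ge0 ltW.
by rewrite ge_min lexx orbT.
Qed.

Lemma Bset_near r i j v : j \in Bset r i -> v \in val j ->
  v \in gball adj (src (val i)) r.+1.
Proof.
rewrite /Bset; case: ifPn => g; rewrite inE.
  by move=> /(gballEP adj_lf)[x [y [xb yb _ ->]]]; rewrite in_fset2 => /orP[]/eqP ->.
move=> /eqP ->; rewrite -{1}[val i]ends_val in_fset2 => /orP[]/eqP ->; first exact: gball_refl.
apply: (fsubsetP (gball_mono adj_lf _ (ltn0Sn r))).
apply: (gball_step adj_lf (gball_refl adj_lf _ 0)); apply: ends_adj; exact: val_edge.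
Qed.

Definition degN r := (D.+1 ^ (r.+1 + r.+1) * D)%N.

(** If the two sets share an edge, the sources of [i] and [j] are both within r + 1 of one of its
    endpoints, hence within 2 (r + 1) of each other. *)
Lemma Bset_degree r i : (#|[set j | ~~ [disjoint Bset r i & Bset r j]]%SET| <= degN r)%N.
Proof.
pose U := gball adj (src (val i)) (r.+1 + r.+1).
apply: (@leq_trans #|` \bigcup_(u <- U) [fset [fset u; y] | y in nbr adj u]%fset|); last first.
  apply: leq_trans (card_bigfcup (D := D) _) _.
    by move=> u _; apply: leq_trans (leq_imfset_card _ _ _) _; exact: degD.
  by rewrite leq_mul2r (card_gball degD) orbT.
rewrite cardE -(size_map val); apply: uniq_leq_size.
  by rewrite (map_inj_uniq val_inj) enum_uniq.
move=> f /mapP[j]; rewrite mem_enum inE => /pred0Pn[l /andP[/= li lj]] ->.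
have ls : src (val l) \in val l by rewrite -{2}[val l]ends_val !inE eqxx.
have h1 := Bset_near li ls; have h2 := Bset_near lj ls.
apply/bigfcupP; exists (src (val j)).
  by rewrite andbT; apply: (gball_trans adj_lf h1); apply: (gball_sym adj_simple adj_lf).
apply/imfsetP; exists (dst (val j)); last by rewrite ends_val.
by rewrite /= in_nbr //; apply: ends_adj; exact: val_edge.
Qed.

(** A martingale difference is a difference of two conditional expectations, so truncation at [Kt]
    bounds it by [2 * Kt]; it depends on no more coordinates than [Gn] does. *)
Lemma Ln_stein r (Kt s c1 c2 delta : R) (f f' : R -> R) (W := fun x => Ln r Kt x / s) :
  0 < Kt -> 0 < s -> (forall u, `|f' u| <= c1) ->
  (forall u v, `|f v - f u - (v - u) * f' u| <= c2 * (v - u) ^+ 2) ->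
  0 <= delta ->
  #|` Es|%:R * (degN r ^ 3)%:R * (2 * ((degN r)%:R * (2 * Kt) ^+ 2)) ^+ 2 / s ^+ 4 <= delta ^+ 2 ->
  `|fE p (fun x => f' (W x) - W x * f (W x))| <=
    c1 * (`|1 - fE p (fun x => W x ^+ 2)| + delta)
    + #|` Es|%:R * (2 * Kt) * c2 * ((degN r)%:R * (2 * Kt)) ^+ 2 / s ^+ 3.
Proof.
move=> K0 s0 f'c1 fc2 d0 hd; rewrite cardfE in hd *.
apply: (@stein_local _ _ _ _ p0 p1 (Bset r) (fun i => mdiff p i (Gn r Kt i))) => //.
- exact: Bset_self.
- by move=> i; apply: mdiff_depends; exact: Gn_depends.
- by move=> i x; apply: (norm_mdiff p0 p1) => y; exact: Gn_bound.
- by move=> i; apply: (fE_mdiff p1).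
- exact: Bset_degree.
Qed.

Definition Mt (t : T) : R := mst_weight (fun e => w e t) Vs Es.
Definition Nt (t : T) : R := Fn (qweight k val t).

Lemma NtE t : Nt t = mst_weight (qw k t) Vs Es.
Proof. by apply: mst_local => f fE; rewrite /res (restr_in _ fE) ffunE. Qed.

(** The infimum is rewritten as a minimum of finitely many sums of weights, one for each spanning
    tree, with [T0] providing the initial value. *)
Lemma measurable_Mt : measurable_fun setT Mt.
Proof.
have [T0 sT0 _] := connected_spanning_tree EsV (fsubset_refl Es) cE.
pose s := [seq S <- fpowerset Es | `[< spanning_tree Vs Es S >]].
have mw (S : {fset {fset V}}) : S `<=` Es -> measurable_fun setT (fun t => \sum_(f <- S) w f t).
  move=> SE.
  rewrite (_ : (fun t => _) = (fun t => \sum_(i : S) w (val i) t)).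
    apply: measurable_sum => i; apply: w_meas.
    by have [] := sG (fsubsetP SE _ (valP i)).
  by apply/funext => t; rewrite (big_seq_fsetE _ _ _ (fun f => w f t)).
have ms : forall S, S \in s -> S `<=` Es by move=> S; rewrite mem_filter fpowersetE => /andP[].
pose wt S t := \sum_(f <- S : {fset {fset V}}) w f t.
have -> : Mt = (fun t => \big[Num.min/wt T0 t]_(S <- s) wt S t).
  apply/funext => t; apply/le_anti/andP; split.
    rewrite big_seq; elim/big_ind: _ => [|x y hx hy|S].
    - exact: (mst_le EsV cE).
    - by rewrite le_min hx hy.
    - by rewrite mem_filter => /andP[/asboolP sS _]; exact: (mst_le EsV cE).
  have [S sS [e _]] := mst_attained EsV cE (fun e => w e t).
  rewrite /Mt e; have Ss : S \in s.
    by rewrite mem_filter fpowersetE; case: (sS) => -> _; rewrite andbT; apply/asboolP.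
  elim: s {ms} Ss => [//|S' s IH]; rewrite inE big_cons ge_min => /orP[/eqP ->|/IH ->].
    by rewrite lexx.
  by rewrite orbT.
elim: s ms => [|S s IH] ms.
  rewrite (_ : (fun t => _) = wt T0).
    by apply: mw; case: sT0.
  by apply/funext => t; rewrite big_nil.
rewrite (_ : (fun t => _) = wt S \min
   (fun t => \big[Num.min/wt T0 t]_(S <- s) wt S t)).
  apply: measurable_minr; first by apply: mw; apply: ms; rewrite inE eqxx.
  by apply: IH => S' S's; apply: ms; rewrite inE S's orbT.
by apply/funext => t; rewrite big_cons.
Qed.

Lemma sum_sqr_fset (g : {fset V} -> R) :
  (\sum_(f <- Es) g f) ^+ 2 <= #|` Es|%:R * \sum_(i : Es) g (val i) ^+ 2.
Proof. by rewrite (big_seq_fsetE _ _ _ g) cardfE; exact: sum_sqr_le. Qed.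

Lemma mst_weight0 : mst_weight (fun=> 0 : R) Vs Es = 0.
Proof.
by have [S _ [-> _]] := mst_attained EsV cE (fun=> 0 : R); rewrite big1.
Qed.

Lemma L2_Mt : L2 P Mt.
Proof.
split; first exact: measurable_Mt.
have iS : L1 P (fun t => #|` Es|%:R * \sum_(i : Es) (1 + w (val i) t ^+ 4)).
  by apply: L1Z; apply: L1_sum => i; exact: (edge_moment (val_edge i)).1.
refine (L1_dom _ _ iS); first by apply: measurable_funX; exact: measurable_Mt.
move=> t; rewrite ger0_norm ?sqr_ge0 //.
have h := mst_lipschitz EsV cE (fun e => w e t) (fun=> 0 : R).
rewrite mst_weight0 subr0 -/(Mt t) in h.
rewrite -real_normK ?num_real //.
apply: (@le_trans _ _ ((\sum_(f <- Es) `|w f t - 0|) ^+ 2)).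
  by rewrite ler_pXn2r ?nnegrE ?sumr_ge0.
apply: le_trans (sum_sqr_fset _) _; apply: ler_wpM2l => //.
apply: ler_sum => i _; rewrite subr0 real_normK ?num_real //.
exact: sqr_le_moment.
Qed.

Lemma L2_qweight (Phi : cfg -> R) : L2 P (fun t => Phi (qweight k val t)).
Proof.
split; first exact: (L1_meas (qweight_L1 val_edge Phi)).
exact: (qweight_L1 val_edge (fun x => Phi x ^+ 2)).
Qed.

Lemma L2_Nt : L2 P Nt. Proof. exact: L2_qweight. Qed.

Lemma EX_qweight (Phi : cfg -> R) : EX P (fun t => Phi (qweight k val t)) = fE p Phi.
Proof. exact: (qweight_EX val_inj val_edge). Qed.

(** Lipschitz bound, then Cauchy-Schwarz. The square of the number of edges is harmless, the level
    [k] being chosen after the graph. *)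
Lemma Mt_Nt : EX P (fun t => (Mt t - Nt t) ^+ 2) <=
  #|` Es|%:R ^+ 2 * (2 * mom4 / k.+1%:R ^+ 2).
Proof.
have [_ iM] := L2B L2_Mt L2_Nt.
have iq i := (quant_sqr_err k (val_edge i)).1.
have iS := L1Z #|` Es|%:R (L1_sum (index_enum _) iq).
apply: (@le_trans _ _ (EX P (fun t => #|` Es|%:R * \sum_(i : Es) (w (val i) t - quant k (w (val i) t)) ^+ 2))).
  apply: (EX_le iM iS) => t.
  have h := mst_lipschitz EsV cE (fun e => w e t) (qw k t).
  rewrite -NtE -/(Mt t) in h.
  rewrite -real_normK ?num_real //.
  apply: (@le_trans _ _ ((\sum_(f <- Es) `|w f t - qw k t f|) ^+ 2)).
    by rewrite ler_pXn2r ?nnegrE ?sumr_ge0.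
  apply: le_trans (sum_sqr_fset _) _; apply: ler_wpM2l => //.
  by apply: ler_sum => i _; rewrite real_normK ?num_real.
rewrite (EXZ _ (L1_sum (index_enum _) iq)) (EX_sum _ iq) expr2 -mulrA.
apply: ler_wpM2l => //.
apply: (@le_trans _ _ (\sum_(i : Es) (2 * mom4 / k.+1%:R ^+ 2))).
  by apply: ler_sum => i _; exact: (quant_sqr_err k (val_edge i)).2.
by rewrite sumr_const -[leLHS]mulr_natl cardfE.
Qed.

Definition Yt r Kt (t : T) : R := Ln r Kt (qweight k val t).

Lemma VX_Nt : VX P Nt = fE p (fun x => (Fn x - fE p Fn) ^+ 2).
Proof. by rewrite /VX EX_qweight (EX_qweight (fun x => (Fn x - fE p Fn) ^+ 2)). Qed.

Lemma Nt_Yt r Kt : EX P (fun t => (Nt t - EX P Nt - Yt r Kt t) ^+ 2) =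
  fE p (fun x => (Fn x - fE p Fn - Ln r Kt x) ^+ 2).
Proof. by rewrite EX_qweight (EX_qweight (fun x => (Fn x - fE p Fn - Ln r Kt x) ^+ 2)). Qed.

(** [s] is the standard deviation of the true weight and not of the local sum. Replacing one by the
    other costs the Lipschitz term inside the ramp and [lam + (1 + lam^-1) * e] in the second
    moment; the rest is the Stein bound for the local sum. *)
Lemma graph_stein_bound a b r (Kt c1 c2 c delta e lam : R) (f f' : R -> R)
    (s := Num.sqrt (VX P Mt)) :
  a < b -> 0 < Kt -> 0 < lam -> 0 < VX P Mt ->
  (forall u, `|f' u| <= c1) ->
  (forall u v, `|f v - f u - (v - u) * f' u| <= c2 * (v - u) ^+ 2) ->
  (forall u, f' u - u * f u = ramp a b u - c) ->
  0 <= delta ->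
  #|` Es|%:R * (degN r ^ 3)%:R * (2 * ((degN r)%:R * (2 * Kt) ^+ 2)) ^+ 2 / s ^+ 4 <= delta ^+ 2 ->
  EX P (fun t => (Mt t - EX P Mt - Yt r Kt t) ^+ 2) <= e * VX P Mt ->
  `|EX P (fun t => ramp a b ((Mt t - EX P Mt) / s)) - c| <=
   (b - a)^-1 * (lam + e / lam) + (c1 * ((lam + (1 + lam^-1) * e) + delta)
    + #|` Es|%:R * (2 * Kt) * c2 * ((degN r)%:R * (2 * Kt)) ^+ 2 / s ^+ 3).
Proof.
move=> ab K0 l0 VM f'c1 fc2 fh d0 hd MY.
have s0 : 0 < s by rewrite sqrtr_gt0.
have lY : L2 P (Yt r Kt) := L2_qweight (Ln r Kt).
have lM := L2_Mt.
have c10 : 0 <= c1 by apply: le_trans (normr_ge0 _) (f'c1 0).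
have hr : measurable_fun setT (ramp a b).
  by apply: continuous_measurable_fun; exact: ramp_continuous.
have r1 u : `|ramp a b u| <= 1.
  by have /andP[h0 h1] := ramp01 a b u; rewrite ger0_norm.
have ba0 : 0 <= (b - a)^-1 by rewrite invr_ge0 subr_ge0 ltW.
have h1 := normalised_lipschitz lM lY l0 VM MY hr r1 ba0 (fun u v => ramp_lipschitz u v ab).
have h2 := normalised_variance lM lY l0 VM MY.
rewrite -/s in h1 h2.
set E1 := EX P _ in h1 *; set E2 := EX P _ in h1.
have -> : E1 - c = (E1 - E2) + (E2 - c) by ring.
apply: le_trans (ler_normD _ _) _; apply: lerD h1 _.
have e2 : E2 - c = fE p (fun x => f' (Ln r Kt x / s) - Ln r Kt x / s * f (Ln r Kt x / s)).
  rewrite /E2 (EX_qweight (fun x => ramp a b (Ln r Kt x / s))).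
  rewrite -[X in _ - X](fE_cst Es p1 c) -fEB.
  by apply: eq_fE => x; rewrite fh.
rewrite e2; apply: le_trans (Ln_stein K0 s0 f'c1 fc2 d0 hd) _.
rewrite lerD2r; apply: ler_wpM2l => //; rewrite lerD2r.
apply: le_trans h2; rewrite le_eqVlt; apply/orP; left; apply/eqP.
by rewrite (EX_qweight (fun x => (Ln r Kt x / s) ^+ 2)).
Qed.

Lemma graph_approx r s (Kt eps : R) : 0 < Kt -> 0 <= eps ->
  (forall i, Es `<=` gballE adj (src (val i)) s.+1) ->
  (forall u v, adj u v -> ball_moment k r.+1 u v - ball_moment k s.+1 u v <= eps) ->
  EX P (fun t => (Mt t - EX P Mt - Yt r Kt t) ^+ 2) <=
    4 * (#|` Es|%:R ^+ 2 * (2 * mom4 / k.+1%:R ^+ 2)) +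
    2 * (#|` Es|%:R * (2 * eps + 2 * mom4 / Kt ^+ 2) +
      (#|` [fset v in Vs | ~~ `[< ball_in adj v (r.+1%:R : R) Vs Es >]]%fset| * D)%:R * mom4).
Proof.
move=> K0 e0 hs ha.
have lY : L2 P (Yt r Kt) := L2_qweight (Ln r Kt).
have h := Ln_error K0 e0 hs ha; rewrite -Nt_Yt in h.
apply: (centered_approx L2_Mt L2_Nt lY Mt_Nt).
apply: le_trans h _; rewrite lerD2l.
apply: ler_wpM2r; first exact: le_trans ler01 mom4_ge1.
by rewrite ler_nat bad_edges.
Qed.

(** A radius at which the ball around every source contains the whole graph; the second moment on
    that ball bounds that of the true increment from below, and how large the radius is does not
    matter. *)
Lemma exhaust_all r : connected_graph adj ->
  exists2 s, (r <= s)%N & forall i, Es `<=` gballE adj (src (val i)) s.+1.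
Proof.
move=> cG.
have Ee f : f \in Es -> is_edge adj f by move=> /sG[].
suff h (l : seq Es) : exists s, forall i, i \in l -> Es `<=` gballE adj (src (val i)) s.+1.
  have [s hs] := h (enum predT); exists (maxn r s); first exact: leq_maxl.
  move=> i; apply: fsubset_trans (hs i _) _; first by rewrite mem_enum.
  by apply: (gballE_mono adj_lf); rewrite ltnS leq_maxr.
elim: l => [|j l [s hs]]; first by exists 0%N.
have [q hq] := gballE_exhaust adj_lf (src (val j)) cG Ee.
exists (maxn s q) => i; rewrite inE => /orP[/eqP ->|/hs h].
  by apply: fsubset_trans hq _; apply: (gballE_mono adj_lf); rewrite leqW // leq_maxr.
by apply: fsubset_trans h _; apply: (gballE_mono adj_lf); rewrite ltnS leq_maxl.
Qed.

End PerGraph.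

(** * Variance order and normal limit along the sequence of graphs *)

Hypothesis mu_nd : forall c : R, mu [set c] != 1%E.
Hypothesis adj_conn : connected_graph adj.

Lemma level_choice (X z : R) k1 : 0 < z -> exists2 k, (k1 <= k)%N & X / k.+1%:R ^+ 2 <= z.
Proof.
move=> z0; pose k := maxn k1 (Num.truncn (X / z)); exists k; first exact: leq_maxl.
rewrite ler_pdivrMr ?exprn_gt0 // mulrC -ler_pdivrMr //.
apply: (@le_trans _ _ k.+1%:R).
  apply: le_trans (ltW (real_truncnS_gt (num_real _))) _.
  by rewrite ler_nat ltnS leq_maxr.
by rewrite -natrX ler_nat expnS expn1 leq_pmulr.
Qed.

(** Rounding down only enlarges the lower tail at [a >= 0]. It lowers [b] by at most (b - a) / 2
    once the mesh is fine, so the upper threshold moves to the midpoint. *)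
Lemma quantised_split : exists a b q k1, [/\ a < b, 0 < q, q <= 1 &
  forall k, (k1 <= k)%N ->
    q <= \sum_(c : 'I_(k.+1 * k.+1).+1 | qval R c <= a) pquant c /\
    q <= \sum_(c : 'I_(k.+1 * k.+1).+1 | b <= qval R c) pquant c].
Proof.
have [a [b [q [ab q0 q1 [qa [qb a0]]]]]] := nondegenerate_split mu_neg mu_nd.
have ba : 0 < b - a by rewrite subr_gt0.
exists a, ((a + b) / 2), q, (Num.truncn (2 * (1 + b ^+ 2) / (b - a))); split => //.
  by rewrite ltr_pdivlMr //; lra.
move=> k hk; rewrite !pquant_sum.
have mq (B : set R) : measurable B -> measurable (@quant R k @^-1` B).
  by move=> mB; have := measurable_quant k measurableT mB; rewrite setTI.
have mlo : measurable [set x : R | quant k x <= a].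
  rewrite (_ : [set _ | _] = @quant R k @^-1` `]-oo, a]%classic); first exact: mq.
  by apply/seteqP; split=> x /=; rewrite in_itv.
have mhi : measurable [set x : R | (a + b) / 2 <= quant k x].
  rewrite (_ : [set _ | _] = @quant R k @^-1` `[(a + b) / 2, +oo[%classic); first exact: mq.
  by apply/seteqP; split=> x /=; rewrite in_itv /= andbT.
have ml (c : R) : measurable [set x : R | x <= c].
  by rewrite (_ : [set _ | _] = `]-oo, c]%classic) //; apply/seteqP; split=> y /=; rewrite in_itv.
have mg (c : R) : measurable [set x : R | c <= x].
  by rewrite (_ : [set _ | _] = `[c, +oo[%classic) //; apply/seteqP; split=> y /=; rewrite in_itv /= andbT.
split.
  apply: le_trans qa _; apply: fine_le; rewrite ?fin_num_measure //.
  apply: le_measure; rewrite ?inE // => x /= xa.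
  case: (lerP 0 x) => x0; first by apply: le_trans xa; exact: quant_le.
  by rewrite -/(quant k x) quant_neg // ltW.
apply: le_trans qb _; apply: fine_le; rewrite ?fin_num_measure //.
apply: le_measure; rewrite ?inE // => x /= bx.
have b0 : 0 <= b by apply: le_trans (ltW ab).
apply: le_trans (quant_mono k bx).
have h1 := quant_err k b0.
have h2 : (1 + b ^+ 2) / k.+1%:R <= (b - a) / 2.
  rewrite ler_pdivrMr // mulrC -ler_pdivrMr ?divr_gt0 //.
  have -> : (1 + b ^+ 2) / ((b - a) / 2) = 2 * (1 + b ^+ 2) / (b - a).
    by field; rewrite gt_eqF.
  apply: le_trans (ltW (real_truncnS_gt (num_real _))) _.
  by rewrite ler_nat ltnS.
have := le_trans h1 h2; move: (quant k b) => z.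
by lra.
Qed.

Section Variance.
Variables (a b q : R) (k1 : nat).
Hypotheses (ab : a < b) (q0 : 0 < q) (q1 : q <= 1).
Hypothesis qsplit : forall k, (k1 <= k)%N ->
    q <= \sum_(c : 'I_(k.+1 * k.+1).+1 | qval R c <= a) pquant c /\
    q <= \sum_(c : 'I_(k.+1 * k.+1).+1 | b <= qval R c) pquant c.

(** The contribution per edge guaranteed by [variance_lower]. *)
Definition vconst : R := q ^+ 2 * ((b - a) * q ^+ D) ^+ 2 / 2.

Lemma vconst_gt0 : 0 < vconst.
Proof.
by rewrite /vconst divr_gt0 // mulr_gt0 ?exprn_gt0 // mulr_gt0 ?exprn_gt0 // subr_gt0.
Qed.

Lemma variance_algebra (M N c m z E : R) : N <= E * m -> E * c <= N ->
  M <= 2 * z + 2 * N -> N <= 2 * z + 2 * M -> z <= c / 4 * E ->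
  c / 4 * E <= M /\ M <= (c / 2 + 2 * m) * E.
Proof.
rewrite [E * m]mulrC [E * c]mulrC => h1 h2 h3 h4 h5.
have e1 : c / 4 * E = (c * E) / 4 by ring.
have e2 : (c / 2 + 2 * m) * E = (c * E) / 2 + 2 * (m * E) by ring.
by rewrite e1 e2; rewrite e1 in h5; split; lra.
Qed.

(** The level is fine enough for a mean square rounding error of at most vconst / 4 per edge; of the
    vconst per edge present in the rounded variance, comparing the two variances then leaves vconst
    / 4. *)
Lemma graph_variance Vs Es : subgraph_of adj Vs Es -> connected_on Vs Es ->
  (0 < #|` Es|)%N ->
  vconst / 4 * #|` Es|%:R <= VX P (Mt Vs Es) /\
  VX P (Mt Vs Es) <= (vconst / 2 + 2 * mom4) * #|` Es|%:R.
Proof.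
move=> sG cE E0; have c0 := vconst_gt0.
have z0 : 0 < vconst / 4 * #|` Es|%:R by apply: mulr_gt0; [rewrite divr_gt0|rewrite ltr0n].
have [k kk hz] := level_choice (#|` Es|%:R ^+ 2 * (2 * mom4)) k1 z0.
have [qa qb] := qsplit kk.
have u := variance_upper k sG cE.
have l := variance_lower sG cE ab (ltW q0) q1 qa qb.
rewrite -(VX_Nt k sG) in u l.
have lM := L2_Mt sG cE; have lN := L2_Nt k sG.
have MN := Mt_Nt k sG cE.
have MN' : EX P (fun t => (Mt Vs Es t - Nt Vs Es k t) ^+ 2) <= vconst / 4 * #|` Es|%:R.
  by apply: le_trans MN _; rewrite mulrA.
exact: (variance_algebra u l (VX_approx_le lM lN MN') (VX_approx_ge lM lN MN') (lexx _)).
Qed.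

Section Limit.
Variables (Vn : nat -> {fset V}) (En : nat -> {fset {fset V}}).
Hypothesis sGn : forall n, subgraph_of adj (Vn n) (En n).
Hypothesis cEn : forall n, connected_on (Vn n) (En n).
Hypothesis Vn_big : forall N : nat, \forall n \near \oo, (N <= #|` Vn n|)%N.
Hypothesis Vn_folner : forall r : R, 0 < r ->
  (fun n => (#|` [fset v in Vn n | ~~ `[< ball_in adj v r (Vn n) (En n) >]]|)%:R
             / (#|` Vn n|)%:R) @ \oo --> (0 : R).

Lemma edges_big (B : R) : \forall n \near \oo,
  [/\ B <= #|` En n|%:R, (0 < #|` En n|)%N, (0 < #|` Vn n|)%N,
     #|` Vn n|%:R <= 2 * #|` En n|%:R :> R & #|` En n|%:R <= #|` Vn n|%:R * D%:R :> R].
Proof.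
pose N := maxn 2 (Num.truncn (2 * B)).+1.
move: (Vn_big N); apply: filterS => n hN.
have V2 : (2 <= #|` Vn n|)%N by apply: leq_trans hN; exact: leq_maxl.
have ge := card_edges_ge (@sGn n) (@cEn n) V2.
have geR : #|` Vn n|%:R <= 2 * #|` En n|%:R :> R by rewrite -natrM ler_nat mulnC.
split => //.
- have h : 2 * B <= #|` Vn n|%:R.
    apply: le_trans (ltW (real_truncnS_gt (num_real (2 * B)))) _.
    by rewrite ler_nat; apply: leq_trans hN; exact: leq_maxr.
  have := le_trans h geR; rewrite ler_pM2l //.
- rewrite lt0n; apply/eqP => e0; move: ge; rewrite e0 mul0n leqn0 => /eqP e.
  by rewrite e in V2.
- exact: leq_trans V2.
- by rewrite -natrM ler_nat; exact: Es_le.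
Qed.

Lemma bad_small r (kap : R) : 0 < kap -> \forall n \near \oo,
  #|` [fset v in Vn n | ~~ `[< ball_in adj v (r.+1%:R : R) (Vn n) (En n) >]]|%:R <=
    kap * (2 * #|` En n|%:R) :> R.
Proof.
move=> kap0; have := Vn_folner (ltr0Sn R r).
move=> /cvgrPdist_le /(_ _ kap0) h; near=> n.
have [_ _ V0 geR _] : [/\ (0 : R) <= #|` En n|%:R, (0 < #|` En n|)%N, (0 < #|` Vn n|)%N,
     #|` Vn n|%:R <= 2 * #|` En n|%:R :> R & #|` En n|%:R <= #|` Vn n|%:R * D%:R :> R].
  by near: n; exact: edges_big.
have : `|0 - #|` [fset v in Vn n | ~~ `[< ball_in adj v (r.+1%:R : R) (Vn n) (En n) >]]|%:R / #|` Vn n|%:R| <= kap.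
  by near: n.
rewrite sub0r normrN ger0_norm ?divr_ge0 // ler_pdivrMr ?ltr0n // => hb.
by apply: le_trans hb _; apply: ler_wpM2l => //; exact: ltW.
Unshelve. all: by end_near.
Qed.

(** Neither the level [k] nor the exhausting radius [s], both chosen for a given [n], enters the
    final bound: its constants involve only [r], [Kt], the degree bound and the solution of Stein's
    equation. *)
Lemma ramp_limit x y : x < y -> exists2 c, Phi x <= c <= Phi y &
  forall eta, 0 < eta -> \forall n \near \oo,
    `|EX P (fun t => ramp x y ((Mt (Vn n) (En n) t - EX P (Mt (Vn n) (En n))) /
       Num.sqrt (VX P (Mt (Vn n) (En n))))) - c| <= eta.
Proof.
move=> xy; have [f [f' [c1 [c2 [c [cxy hf1 hf2 hf3]]]]]] := stein_solution xy.
exists c => // eta eta0.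
have c10 : 0 <= c1 by apply: le_trans (normr_ge0 _) (hf1 0).
have c20 : 0 <= c2.
  by have := hf2 0 1; rewrite subr0 expr1n mulr1; apply: le_trans; exact: normr_ge0.
have ch0 : 0 <= (y - x)^-1 by rewrite invr_ge0 subr_ge0 ltW.
have [lam [e [delta [l0 e0 d0 hb]]]] := stein_budget ch0 c10 eta0.
have v0 := vconst_gt0; have m1 := mom4_ge1.
have m0 : 0 < mom4 by apply: lt_le_trans m1.
(* The share per edge in [approx_budget]. *)
pose om := e * vconst / 16.
have om0 : 0 < om by rewrite /om divr_gt0 // mulr_gt0.
have om4 : 0 < om / 4 by rewrite divr_gt0.
have [r [k0 hal]] := ball_moment_stable om4.
(* As Kt >= 1, its square is at least [Kt], hence at least 4 mom4 / om. *)
pose Kt := 1 + 4 * mom4 / om.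
have KtE : 4 * mom4 / om <= Kt by rewrite /Kt lerDr.
have Kt1 : 1 <= Kt by rewrite /Kt lerDl; exact: divr_ge0 (mulr_ge0 (ler0n _ 4) (ltW m0)) (ltW om0).
have Kt0 : 0 < Kt by apply: lt_le_trans Kt1.
have hKt : 2 * (2 * mom4 / Kt ^+ 2) <= om.
  have -> : 2 * (2 * mom4 / Kt ^+ 2) = 4 * mom4 / Kt ^+ 2 by ring.
  rewrite ler_pdivrMr ?exprn_gt0 // [om * _]mulrC -ler_pdivrMr //.
  by apply: le_trans KtE _; rewrite expr2 ler_peMl // ltW.
(* The [+ 1] keeps the denominator positive even for [D = 0]. *)
pose kap := om / (4 * mom4 * (D%:R + 1)).
have D10 : 0 < D%:R + 1 :> R by rewrite ltr_wpDl.
have kap0 : 0 < kap by rewrite divr_gt0 // !mulr_gt0.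
pose C1 : R := (degN r ^ 3)%:R * (2 * ((degN r)%:R * (2 * Kt) ^+ 2)) ^+ 2.
have C10 : 0 <= C1 by rewrite mulr_ge0 ?sqr_ge0.
have [B1 hB1] := scale_fourth C10 v0 (exprn_gt0 2 d0).
pose C3 : R := 2 * Kt * c2 * ((degN r)%:R * (2 * Kt)) ^+ 2.
have C30 : 0 <= C3 by rewrite /C3 !mulr_ge0 ?sqr_ge0 ?(ltW Kt0) //.
have eta6 : 0 < eta / 6 by rewrite divr_gt0.
have [B2 hB2] := scale_third C30 v0 eta6.
near=> n.
have [EB E0 V0 VE EV] : [/\ Num.max B1 B2 <= #|` En n|%:R, (0 < #|` En n|)%N, (0 < #|` Vn n|)%N,
     #|` Vn n|%:R <= 2 * #|` En n|%:R :> R & #|` En n|%:R <= #|` Vn n|%:R * D%:R :> R].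
  by near: n; exact: edges_big.
have hbad : #|` [fset v in Vn n | ~~ `[< ball_in adj v (r.+1%:R : R) (Vn n) (En n) >]]|%:R <=
    kap * (2 * #|` En n|%:R) :> R by near: n; exact: bad_small.
have E0R : 0 < #|` En n|%:R :> R by rewrite ltr0n.
have [vl _] := graph_variance (@sGn n) (@cEn n) E0.
have zk : 0 < om / 4 * #|` En n|%:R by rewrite mulr_gt0.
have [k kk hk] := level_choice (#|` En n|%:R ^+ 2 * (2 * mom4)) k0 zk.
have [s rs hs] := exhaust_all (@sGn n) r adj_conn.
have happ := @graph_approx (Vn n) (En n) k (@sGn n) (@cEn n) r s Kt (om / 4) Kt0 (ltW om4) hs
  (fun u v uv => hal k s u v kk rs uv).
have VM : 0 < VX P (Mt (Vn n) (En n)).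
  by apply: lt_le_trans vl; apply: mulr_gt0 => //; exact: divr_gt0.
have MY : EX P (fun t => (Mt (Vn n) (En n) t - EX P (Mt (Vn n) (En n)) - Yt (En n) k r Kt t) ^+ 2)
    <= e * VX P (Mt (Vn n) (En n)).
  apply: le_trans happ _; rewrite natrM.
  apply: (approx_budget (ltW E0R) (ltW e0) vl).
  - rewrite -/om mulrA; apply: le_trans (ler_wpM2l _ hk) _ => //.
    by rewrite mulrA [4 * _]mulrC divfK.
  - by rewrite -/om mulrC divfK.
  - by rewrite -/om.
  - rewrite -/om.
    apply: (@le_trans _ _ (2 * (kap * (2 * #|` En n|%:R) * D%:R * mom4))).
      by rewrite ler_wpM2l // ler_wpM2r ?(ltW m0) // ler_wpM2r.
    have -> : 2 * (kap * (2 * #|` En n|%:R) * D%:R * mom4) =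
        om * #|` En n|%:R * (D%:R / (D%:R + 1)).
      by rewrite /kap; field; rewrite !gt_eqF.
    have D1 : D%:R / (D%:R + 1) <= 1 :> R by rewrite ler_pdivrMr // mul1r lerDl.
    exact: ler_piMr (mulr_ge0 (ltW om0) (ltW E0R)) D1.
have s0 : 0 < Num.sqrt (VX P (Mt (Vn n) (En n))) by rewrite sqrtr_gt0.
have s2 : vconst / 4 * #|` En n|%:R <= Num.sqrt (VX P (Mt (Vn n) (En n))) ^+ 2.
  by rewrite sqr_sqrtr // ltW.
have b1 : B1 <= #|` En n|%:R by apply: le_trans EB; rewrite le_max lexx.
have b2 : B2 <= #|` En n|%:R by apply: le_trans EB; rewrite le_max lexx orbT.
have hd := hB1 _ _ b1 E0R s0 s2; have ht := hB2 _ _ b2 E0R s0 s2.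
rewrite /C1 [X in X / _]mulrA in hd.
apply: (le_trans (@graph_stein_bound (Vn n) (En n) k (@sGn n) (@cEn n) x y r Kt c1 c2 c delta e lam f f'
  xy Kt0 l0 VM hf1 hf2 hf3 (ltW d0) hd MY)); apply: le_trans hb.
rewrite !lerD2l; apply: le_trans ht.
by rewrite le_eqVlt; apply/orP; left; apply/eqP; congr (_ / _); rewrite /C3; ring.
Unshelve. all: by end_near.
Qed.

Lemma measurable_normalised Vs Es (m c x : R) : subgraph_of adj Vs Es -> connected_on Vs Es ->
  measurable [set t | (Mt Vs Es t - m) / c <= x].
Proof.
move=> sG cE; have mF : measurable_fun setT (fun t => (Mt Vs Es t - m) / c).
  apply: measurable_funM => //; apply: measurable_funB => //; exact: measurable_Mt.
have := mF measurableT `]-oo, x]%classic; rewrite setTI => h.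
rewrite (_ : [set _ | _] = (fun t => (Mt Vs Es t - m) / c) @^-1` `]-oo, x]%classic); first by apply: h.
by apply/seteqP; split=> t /=; rewrite in_itv.
Qed.

(** The indicator of []-oo, x]] lies between the ramps on [x - th/2, x] and [x, x + th/2], whose
    limits lie between values of [Phi] that continuity puts within eta / 2 of [Phi x]. *)
Lemma normalised_cdf_limit x :
  (fun n => fine (P [set t | (Mt (Vn n) (En n) t - EX P (Mt (Vn n) (En n))) /
     Num.sqrt (VX P (Mt (Vn n) (En n))) <= x])) @ \oo --> Phi x.
Proof.
apply/cvgrPdist_le => eta eta0.
have eta2 : 0 < eta / 2 by rewrite divr_gt0.
have Pc : {for x, continuous (@Phi R)}.
  by apply/differentiable_continuous/derivable1_diffP; have [] := is_derive_Phi x.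
have /cvgrPdist_le /(_ _ eta2) /nbhs_ballP[th /= th0 hth] := Pc.
have th2 : 0 < th / 2 by rewrite divr_gt0.
have thlt : th / 2 < th by rewrite ltr_pdivrMr // ltr_pMr // ltr1n.
have hup : `|Phi x - Phi (x + th / 2)| <= eta / 2.
  by apply: hth; rewrite /ball /= opprD addrA subrr sub0r normrN gtr0_norm.
have hlo : `|Phi x - Phi (x - th / 2)| <= eta / 2.
  by apply: hth; rewrite /ball /= opprB addrCA subrr addr0 gtr0_norm.
have xu : x < x + th / 2 by rewrite ltrDl.
have lx : x - th / 2 < x by rewrite gtrBl.
have [cu /andP[_ cu2] hcu] := ramp_limit xu.
have [cl /andP[cl1 _] hcl] := ramp_limit lx.
near=> n.
have hu : `|EX P (fun t => ramp x (x + th / 2) ((Mt (Vn n) (En n) t - EX P (Mt (Vn n) (En n))) /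
       Num.sqrt (VX P (Mt (Vn n) (En n))))) - cu| <= eta / 2 by near: n; exact: hcu.
have hl : `|EX P (fun t => ramp (x - th / 2) x ((Mt (Vn n) (En n) t - EX P (Mt (Vn n) (En n))) /
       Num.sqrt (VX P (Mt (Vn n) (En n))))) - cl| <= eta / 2 by near: n; exact: hcl.
have mF : measurable_fun setT (fun t => (Mt (Vn n) (En n) t - EX P (Mt (Vn n) (En n))) /
       Num.sqrt (VX P (Mt (Vn n) (En n)))).
  apply: measurable_funM => //; apply: measurable_funB => //; apply: measurable_Mt => //.
have /andP[pu _] := prob_ramp P mF xu.
have /andP[_ pl] := prob_ramp P mF lx.
move: hu hl pu pl hup hlo cu2 cl1.
move: (EX P _) (EX P _) (fine _) (Phi (x + _)) (Phi (x - _)) (Phi x) => E1 E2 g Pu Pl Px.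
rewrite !ler_norml => /andP[? ?] /andP[? ?] ? ? /andP[? ?] /andP[? ?] ? ?.
by apply/andP; split; lra.
Unshelve. all: by end_near.
Qed.

End Limit.
End Variance.

Lemma mst_asymptotics (Vn : nat -> {fset V}) (En : nat -> {fset {fset V}}) :
  (forall n, subgraph_of adj (Vn n) (En n)) ->
  (forall n, connected_on (Vn n) (En n)) ->
  (forall N : nat, \forall n \near \oo, (N <= #|` Vn n|)%N) ->
  (forall r : R, 0 < r ->
    (fun n => (#|` [fset v in Vn n | ~~ `[< ball_in adj v r (Vn n) (En n) >]]|)%:R
             / (#|` Vn n|)%:R) @ \oo --> (0 : R)) ->
  (exists c C : R, [/\ 0 < c, 0 < C &
     \forall n \near \oo,
       ((c * (#|` Vn n|)%:R)%:E <= 'V_P[Mt (Vn n) (En n)])%E /\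
       ('V_P[Mt (Vn n) (En n)] <= (C * (#|` Vn n|)%:R)%:E)%E]) /\
  (forall x : R,
     (fun n => P [set t | (Mt (Vn n) (En n) t - fine 'E_P[Mt (Vn n) (En n)]) /
         Num.sqrt (fine 'V_P[Mt (Vn n) (En n)]) <= x])
       @ \oo --> normal_prob 0 1 `]-oo, x]).
Proof.
move=> sGn cEn Vn_big Vn_folner.
have [a [b [q [k1 [ab q0 q1 hq]]]]] := quantised_split.
have lM n : L2 P (Mt (Vn n) (En n)) by exact: L2_Mt.
have VE n : ('V_P[Mt (Vn n) (En n)])%E = (VX P (Mt (Vn n) (En n)))%:E by exact: variance_VX.
have EE n : fine ('E_P[Mt (Vn n) (En n)])%E = EX P (Mt (Vn n) (En n)) by exact: fine_expectation.
have v0 := vconst_gt0 ab q0; have m0 : 0 < mom4 by apply: lt_le_trans mom4_ge1.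
split.
  (* The variance is at least vconst / 4 per edge and there are at most two vertices per edge;
     conversely there are at most [D] edges per vertex. *)
  exists (vconst a b q / 8), ((vconst a b q / 2 + 2 * mom4) * (D%:R + 1)).
  have C0 : 0 < vconst a b q / 2 + 2 * mom4 by apply: addr_gt0; [exact: divr_gt0|exact: mulr_gt0].
  split; first by rewrite divr_gt0.
    by rewrite mulr_gt0 // ltr_wpDl.
  near=> n.
  have [_ E0 V0 VEn EV] : [/\ (0 : R) <= #|` En n|%:R, (0 < #|` En n|)%N, (0 < #|` Vn n|)%N,
     #|` Vn n|%:R <= 2 * #|` En n|%:R :> R & #|` En n|%:R <= #|` Vn n|%:R * D%:R :> R].
    by near: n; exact: edges_big.
  have [vl vu] := graph_variance ab q0 q1 hq (sGn n) (cEn n) E0.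
  rewrite VE !lee_fin; split.
    apply: le_trans vl; have := ler_wpM2l (ltW v0) VEn.
    move: (#|` Vn n|%:R) (#|` En n|%:R) => y z h.
    have -> : vconst a b q / 8 * y = (vconst a b q * y) / 8 by ring.
    have -> : vconst a b q / 4 * z = (vconst a b q * (2 * z)) / 8 by field.
    by rewrite ler_pM2r ?invr_gt0.
  apply: le_trans vu _; rewrite -mulrA; apply: ler_wpM2l; first exact: ltW.
  by apply: le_trans EV _; rewrite mulrC ler_wpM2r // lerDl.
move=> x.
have -> : (fun n => P [set t | (Mt (Vn n) (En n) t - fine 'E_P[Mt (Vn n) (En n)]) /
         Num.sqrt (fine 'V_P[Mt (Vn n) (En n)]) <= x]) =
   (fun n => (fine (P [set t | (Mt (Vn n) (En n) t - EX P (Mt (Vn n) (En n))) /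
     Num.sqrt (VX P (Mt (Vn n) (En n))) <= x]))%:E).
  apply/funext => n; rewrite VE EE /= fineK // fin_num_measure //.
  exact: measurable_normalised.
have -> : normal_prob 0 1 `]-oo, x]%classic = (Phi x)%:E.
  by rewrite /Phi fineK // fin_num_measure.
apply: cvg_EFin; first by near=> n.
exact: (normalised_cdf_limit ab q0 q1 hq).
Unshelve. all: by end_near.
Qed.

End Weights.

Local Open Scope classical_set_scope.
Local Open Scope ring_scope.
Local Open Scope fset_scope.

Theorem theorem2p3 (R : realType) (V : choiceType) (adj : rel V)
  (Vn : nat -> {fset V}) (En : nat -> {fset {fset V}})
  (d : measure_display) (T : measurableType d) (P : probability T R)
  (mu : probability R R) (w : {fset V} -> T -> R) :
  simple_graph adj -> connected_graph adj -> infinite_graph V ->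
  locally_finite adj -> vertex_transitive adj ->
  (forall n, subgraph_of adj (Vn n) (En n) /\ fconnected (Vn n) (En n)) ->
  (forall N : nat, \forall n \near \oo, (N <= #|` Vn n|)%N) ->
  (forall r : R, 0 < r ->
     (fun n => (#|` [fset v in Vn n | ~~ `[< ball_in adj v r (Vn n) (En n) >]]|)%:R
               / (#|` Vn n|)%:R) @ \oo --> (0 : R)) ->
  (* i.i.d. edge weights with law mu *)
  (forall e, is_edge adj e -> measurable_fun setT (w e)) ->
  mutually_independent P (is_edge adj) w ->
  (forall e (B : set R), is_edge adj e -> measurable B ->
     P (w e @^-1` B) = mu B) ->
  (* mu is nonnegative, non-degenerate, with a finite (4+delta)-th moment *)
  mu [set x : R | x < 0] = 0%E ->
  (forall c : R, mu [set c] != 1%E) ->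
  (exists2 delta : R, 0 < delta &
     (\int[mu]_x ((`|x| `^ (4 + delta))%:E) < +oo)%E) ->
  let M n := fun t => mst_weight (fun e => w e t) (Vn n) (En n) in
  (exists c C : R, [/\ 0 < c, 0 < C &
     \forall n \near \oo,
       ((c * (#|` Vn n|)%:R)%:E <= 'V_P[M n])%E /\
       ('V_P[M n] <= (C * (#|` Vn n|)%:R)%:E)%E]) /\
  (forall x : R,
     (fun n => P [set t | (M n t - fine 'E_P[M n]) / Num.sqrt (fine 'V_P[M n]) <= x])
       @ \oo --> normal_prob 0 1 `]-oo, x]).
Proof.
move=> adj_simple adj_conn V_inf adj_lf adj_vt graphs Vn_big Vn_folner.
move=> w_meas w_indep w_law mu_neg mu_nd mu_moment M.
(* Serves as a default endpoint for the finite sets that are not edges. *)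
have [v0 _] : exists v : V, True.
  apply: contrapT => nV; apply: V_inf.
  by rewrite (_ : [set: V]%classic = set0%classic) //; apply/seteqP; split=> v // _; apply: nV; exists v.
(* Each edge is oriented once and for all, so that the ball attached to it is centered at a definite
   endpoint. *)
have /boolp.choice[ends ends_spec] (e : {fset V}) : exists g : V * V,
    is_edge adj e -> adj g.1 g.2 /\ e = [fset g.1; g.2].
  have [[u [v [uv ->]]]|ne] := pselect (is_edge adj e); first by exists (u, v).
  by exists (v0, v0).
have [D degD] := bounded_degree adj_lf adj_vt.
have sGn n : subgraph_of adj (Vn n) (En n) by case: (graphs n).
have cGn n : connected_on (Vn n) (En n).
  by apply/fconnectedE; [move=> f /(sGn n)[]|case: (graphs n)].
exact: (mst_asymptotics w_meas w_indep w_law mu_neg mu_moment adj_simple adj_lf adj_vt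
  (fun e he => (ends_spec e he).1) (fun e he => (ends_spec e he).2) degD
  mu_nd adj_conn sGn cGn Vn_big Vn_folner).
Qed.
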